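(* For every $\alpha\in(0,1)$ there is a constant $C_\alpha$ depending only on $\alpha$ such that, for every $d\ge1$, the probability measure $\pi_\alpha\propto\exp(-V_\alpha)$ on $\mathbb{R}^d$ with $V_\alpha(x)=(1+\|x\|^2)^{\alpha/2}$ satisfies a weak Poincaré inequality with $$\beta_{\mathsf{WPI}}(r)=\inf_{\gamma\in(0,2\alpha]}C_\alpha\Big(d^{\frac{2(2-2\alpha+\gamma)}{\gamma}}+\ln\big(r^{-1}\big)^{\frac{2-2\alpha+\gamma}{\alpha}}\Big)\quad\text{and}\quad\Phi(\cdot)=\operatorname{Osc}(\cdot)^2,$$ where $\ln(r^{-1})$ is read as $\max\{\ln(r^{-1}),0\}$ when $r>1$.
   Context: Weak Poincaré inequality (WPI): a probability measure $\pi$ on $\mathbb{R}^d$ satisfies a WPI with weight $\beta_{\mathsf{WPI}}$ and functional $\Phi$ if $\beta_{\mathsf{WPI}}:(0,\infty)\to\mathbb{R}_+$ is non-increasing, $\Phi:L^2(\pi)\to[0,\infty]$ satisfies $\Phi(cf+a)=c^2\Phi(f)$ for all $a,c\in\mathbb{R}$, $f\in L^2(\pi)$, and for every $f\in\mathcal{C}^\infty(\mathbb{R}^d)$, $\operatorname{Var}_\pi(f)\le\beta_{\mathsf{WPI}}(r)\,\mathbb{E}_\pi[\|\nabla f\|^2]+r\,\Phi(f)$ for all $r>0$. Here $\operatorname{Osc}(f)=\sup f-\inf f$. *)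

(* Defs.v *)
From HB Require Import structures.
From mathcomp Require Import all_boot all_order all_algebra.
From mathcomp Require Import all_classical all_reals all_analysis.
From mathcomp Require Import measurable_realfun.

Set Implicit Arguments.
Unset Strict Implicit.
Unset Printing Implicit Defensive.

Import Order.TTheory GRing.Theory Num.Theory.
Import numFieldNormedType.Exports.

Local Open Scope classical_set_scope.
Local Open Scope ring_scope.

Definition rV_display : measure_display.
Proof. exact: default_measure_display. Qed.

(* 'rV[R]_n carries the product sigma-algebra, generated by the coordinates;
   it coincides with the Borel one. *)
Section measurable_rV.
Context {R : realType} {n : nat}.

Let coord (i : 'I_n) (x : 'rV[R]_n) : R := x ord0 i.

Let rV_set0 : g_sigma_preimage coord set0.
Proof. exact: sigma_algebra0. Qed.

Let rV_setC A : g_sigma_preimage coord A -> g_sigma_preimage coord (~` A).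
Proof. exact: sigma_algebraC. Qed.

Let rV_bigcup (F : (set 'rV[R]_n)^nat) :
  (forall i, g_sigma_preimage coord (F i)) ->
  g_sigma_preimage coord (\bigcup_i F i).
Proof. exact: sigma_algebra_bigcup. Qed.

HB.instance Definition _ := @isMeasurable.Build rV_display
  'rV[R]_n (g_sigma_preimage coord) rV_set0 rV_setC rV_bigcup.

End measurable_rV.

Section measurable_rV_lemmas.
Context {R : realType}.

Lemma measurable_rV_coord n (i : 'I_n) :
  measurable_fun [set: 'rV[R]_n] (fun x : 'rV[R]_n => x ord0 i).
Proof.
move=> _ Y mY; rewrite setTI; apply: sub_sigma_algebra => /=.
rewrite -bigcup_seq/=; exists i => /=; first by rewrite mem_index_enum.
by exists Y => //; rewrite setTI.
Qed.

Lemma measurable_fun_rVP d (T : measurableType d) n (f : T -> 'rV[R]_n) :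
  (forall i, measurable_fun [set: T] (fun x => f x ord0 i)) ->
  measurable_fun [set: T] f.
Proof.
move=> mf _ A mA; rewrite setTI.
pose G := image_set_system setT f (@measurable _ T).
have : G A.
  move: mA; apply; split.
    exact/sigma_algebra_image/sigma_algebra_measurable.
  move=> B; rewrite -bigcup_seq => -[i _ [C mC <-]].
  rewrite /G /image_set_system /= !setTI.
  by rewrite -[X in measurable X]setTI; exact: mf.
by rewrite /G /image_set_system /= setTI.
Qed.

Definition cons_rV n (p : measurableTypeR R * 'rV[R]_n) : 'rV[R]_n.+1 :=
  row_mx (p.1%:M : 'rV[R]_1) p.2.

Definition uncons_rV n (x : 'rV[R]_n.+1) :
    measurableTypeR R * 'rV[R]_n :=
  (x ord0 ord0, rsubmx (x : 'rV[R]_(1 + n))).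

Lemma cons_rV0 n (p : measurableTypeR R * 'rV[R]_n) : cons_rV p ord0 ord0 = p.1.
Proof.
have -> : ord0 = lshift n ord0 :> 'I_(1 + n) by exact: val_inj.
by rewrite [LHS]row_mxEl mxE.
Qed.

Lemma cons_rVS n (p : measurableTypeR R * 'rV[R]_n) i :
  cons_rV p ord0 (lift ord0 i) = p.2 ord0 i.
Proof.
have -> : lift ord0 i = rshift 1 i :> 'I_(1 + n) by exact: val_inj.
by rewrite [LHS]row_mxEr.
Qed.

Lemma cons_rVK n : cancel (@cons_rV n) (@uncons_rV n).
Proof. by move=> [a v]; rewrite /uncons_rV cons_rV0 /cons_rV row_mxKr. Qed.

Lemma uncons_rVK n : cancel (@uncons_rV n) (@cons_rV n).
Proof.
move=> x; apply/rowP => i; case: (unliftP ord0 i) => [j|] ->.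
  rewrite cons_rVS mxE; congr (x _ _); exact: val_inj.
by rewrite cons_rV0.
Qed.

Lemma measurable_cons_rV n : measurable_fun [set: measurableTypeR R * 'rV[R]_n] (@cons_rV n).
Proof.
apply: measurable_fun_rVP => i; case: (unliftP ord0 i) => [j|] ->.
  under eq_fun do rewrite cons_rVS.
  by apply: (measurableT_comp (measurable_rV_coord j)).
under eq_fun do rewrite cons_rV0.
exact: measurable_fst.
Qed.

Lemma measurable_uncons_rV n :
  measurable_fun [set: 'rV[R]_n.+1] (@uncons_rV n).
Proof.
apply: measurable_fun_pair => /=; first exact: measurable_rV_coord.
apply: measurable_fun_rVP => i.
by under eq_fun do rewrite /= mxE; exact: measurable_rV_coord.
Qed.

End measurable_rV_lemmas.

Section lebesgue_rV_succ.
Local Open Scope ereal_scope.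
Context {R : realType} {n : nat}.
Variable m : {sigma_finite_measure set 'rV[R]_n -> \bar R}.

Definition lebesgue_rV_succ : set 'rV[R]_n.+1 -> \bar R :=
  pushforward (@lebesgue_measure R \x m) (@cons_rV R n).

Let mcons := @measurable_cons_rV R n.

Let lebesgue_rV_succ0 : lebesgue_rV_succ set0 = 0.
Proof. by rewrite /lebesgue_rV_succ /pushforward preimage_set0 measure0. Qed.

Let lebesgue_rV_succ_ge0 A : 0 <= lebesgue_rV_succ A.
Proof. exact: measure_ge0. Qed.

Let lebesgue_rV_succ_sigma_additive : semi_sigma_additive lebesgue_rV_succ.
Proof.
move=> F mF tF mUF; rewrite /lebesgue_rV_succ /pushforward preimage_bigcup.
apply: measure_semi_sigma_additive.
- by move=> k; rewrite -[X in measurable X]setTI; exact: mcons.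
- apply/trivIsetP => /= i j _ _ ij; rewrite -preimage_setI.
  by move/trivIsetP : tF => /(_ _ _ _ _ ij) ->//; rewrite preimage_set0.
- by rewrite -preimage_bigcup -[X in measurable X]setTI; exact: mcons.
Qed.

HB.instance Definition _ := isMeasure.Build _ _ _ lebesgue_rV_succ
  lebesgue_rV_succ0 lebesgue_rV_succ_ge0 lebesgue_rV_succ_sigma_additive.

Let lebesgue_rV_succ_sigma_finite : sigma_finite setT lebesgue_rV_succ.
Proof.
have /sigma_finiteP[F [TF ndF Foo]] := sigma_finiteT (@lebesgue_measure R).
have /sigma_finiteP[G [TG ndG Goo]] := sigma_finiteT m.
exists (fun k => @uncons_rV R n @^-1` (F k `*` G k)).
  apply/seteqP; split => // x _.
  have [i _ Fix] : (\bigcup_i F i) (uncons_rV x).1 by rewrite -TF.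
  have [j _ Gjx] : (\bigcup_i G i) (uncons_rV x).2 by rewrite -TG.
  exists (maxn i j) => //; split.
    by move: Fix; exact/subsetPset/ndF/leq_maxl.
  by move: Gjx; exact/subsetPset/ndG/leq_maxr.
move=> k; have [mF Fk] := Foo k; have [mG Gk] := Goo k; split.
  rewrite -[X in measurable X]setTI; apply: measurable_uncons_rV => //.
  exact: measurableX.
rewrite /lebesgue_rV_succ /pushforward.
have -> : @cons_rV R n @^-1` (@uncons_rV R n @^-1` (F k `*` G k)) = F k `*` G k.
  rewrite -comp_preimage (_ : _ \o _ = id) ?preimage_id//.
  by apply/funext => p; exact: cons_rVK.
by rewrite product_measure1E// lte_mul_pinfty// ge0_fin_numE.
Qed.

HB.instance Definition _ := Measure_isSigmaFinite.Build _ _ _ lebesgue_rV_succ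
  lebesgue_rV_succ_sigma_finite.

End lebesgue_rV_succ.

Fixpoint lebesgue_rV {R : realType} (n : nat) :
    {sigma_finite_measure set 'rV[R]_n -> \bar R} :=
  match n with
  | 0 => dirac (0 : 'rV[R]_0)
  | n'.+1 => lebesgue_rV_succ (lebesgue_rV n')
  end.

Section gibbs.
Local Open Scope ereal_scope.
Context {R : realType} {d : nat}.
Variable V : {mfun 'rV[R]_d >-> R}.

Definition gibbs_weight (A : set 'rV[R]_d) : \bar R :=
  \int[lebesgue_rV d]_(x in A) (expR (- V x))%:E.

Lemma measurable_gibbs_density D :
  measurable_fun D (fun x : 'rV[R]_d => (expR (- V x))%:E).
Proof.
apply: measurable_funTS; apply/measurable_EFinP.
apply: measurableT_comp; first exact: measurable_expR.
exact: measurable_funN.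
Qed.

Let gibbs_weight0 : gibbs_weight set0 = 0.
Proof. exact: integral_set0. Qed.

Let gibbs_weight_ge0 A : 0 <= gibbs_weight A.
Proof. by apply: integral_ge0 => x _; rewrite lee_fin expR_ge0. Qed.

Let gibbs_weight_sigma_additive : semi_sigma_additive gibbs_weight.
Proof.
move=> F mF tF mUF; rewrite /gibbs_weight ge0_integral_bigcup//=.
- by apply: is_cvg_ereal_nneg_natsum_cond => n _ _; exact: gibbs_weight_ge0.
- exact: measurable_gibbs_density.
Qed.

HB.instance Definition _ := isMeasure.Build _ _ _ gibbs_weight
  gibbs_weight0 gibbs_weight_ge0 gibbs_weight_sigma_additive.

(* mnormalize falls back on its second argument only when the total mass is 0
   or +oo, which gibbs_weight_V_alphaT and pi_alphaE exclude for V_alpha. *)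
Definition gibbs : probability 'rV[R]_d R :=
  mnormalize gibbs_weight (dirac (0%R : 'rV[R]_d)).

End gibbs.

Section euclidean.
Context {R : realType} {d : nat}.
Implicit Types (f : 'rV[R]_d -> R) (x : 'rV[R]_d).

(* The canonical norm `|x| on 'rV[R]_d is the sup norm. *)
Definition enorm x : R := Num.sqrt (\sum_(i < d) x ord0 i ^+ 2).

Definition partial (i : 'I_d) f : 'rV[R]_d -> R :=
  fun x => 'D_(delta_mx ord0 i) f x.

Definition grad f x : 'rV[R]_d := \row_i partial i f x.

Definition smooth f : Prop := forall s : seq 'I_d,
  continuous (foldr partial f s) /\
  forall i x, derivable (foldr partial f s) x (delta_mx ord0 i).

Definition Osc f : \bar R :=
  (ereal_sup (range (EFin \o f)) - ereal_inf (range (EFin \o f)))%E.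

Definition V_alpha (alpha : R) x : R := (1 + enorm x ^+ 2) `^ (alpha / 2).

Lemma sqr_enorm x : enorm x ^+ 2 = \sum_(i < d) x ord0 i ^+ 2.
Proof. by rewrite /enorm sqr_sqrtr// sumr_ge0// => i _; rewrite sqr_ge0. Qed.

Lemma measurable_V_alpha alpha : measurable_fun setT (V_alpha alpha).
Proof.
apply: (measurableT_comp (measurable_powR _)).
under eq_fun do rewrite sqr_enorm.
apply: measurable_funD => //; apply: measurable_sum => i.
by apply: measurable_funX; exact: measurable_rV_coord.
Qed.

HB.instance Definition _ alpha :=
  isMeasurableFun.Build _ _ _ _ (V_alpha alpha) (measurable_V_alpha alpha).

End euclidean.

Definition pi_alpha {R : realType} (d : nat) (alpha : R) :
  probability 'rV[R]_d R := gibbs (V_alpha alpha).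

Section normalizability.
Local Open Scope ereal_scope.
Context {R : realType}.

Lemma integral_lebesgue_rV_prod n (g : R -> R) : measurable_fun setT g ->
  (forall x, 0 <= g x)%R ->
  \int[lebesgue_rV n]_x (\prod_(i < n) g (x ord0 i))%:E =
  (\int[lebesgue_measure]_x (g x)%:E) ^+ n.
Proof.
move=> mg g0; elim: n => [|n IHn].
  rewrite expe0 [LHS](_ : _ = \int[dirac (0%R : 'rV[R]_0)]_x (1%:E)).
    by rewrite integral_cst// /= diracT mule1.
  by apply: eq_integral => x _; rewrite big_ord0.
have mprod k : measurable_fun [set: 'rV[R]_k]
    (fun x => (\prod_(i < k) g (x ord0 i))%:E).
  apply/measurable_EFinP; apply: measurable_prod => i _.
  by apply: measurableT_comp => //; exact: measurable_rV_coord.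
have prod0 k (x : 'rV[R]_k) : 0 <= (\prod_(i < k) g (x ord0 i))%:E.
  by rewrite lee_fin prodr_ge0.
rewrite [LHS](_ : _ = \int[lebesgue_measure \x lebesgue_rV n]_p
    (\prod_(i < n.+1) g (cons_rV p ord0 i))%:E); last first.
  rewrite [LHS](ge0_integral_pushforward (@measurable_cons_rV R n))//.
  exact: mprod.

rewrite (@fubini_tonelli1 _ _ _ _ R lebesgue_measure (lebesgue_rV n))//;
  last exact: (measurableT_comp (mprod _) (@measurable_cons_rV R n)).
transitivity (\int[lebesgue_measure]_x
    ((g x)%:E * (\int[@lebesgue_measure R]_y (g y)%:E) ^+ n)).
  apply: eq_integral => x _; rewrite /fubini_F -IHn.
  rewrite -ge0_integralZl//.
    apply: eq_integral => y _; rewrite big_ord_recl cons_rV0 /= EFinM.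
    by under eq_bigr do rewrite cons_rVS.
  - exact: mprod.
  - by rewrite lee_fin.
rewrite ge0_integralZr//; first by rewrite expeS.
- exact/measurable_EFinP.
- by move=> x _; rewrite lee_fin.
- by apply: expe_ge0; apply: integral_ge0 => x _; rewrite lee_fin.
Qed.

Lemma lebesgue_rVT_neq0 n : lebesgue_rV n [set: 'rV[R]_n] != 0.
Proof.
elim: n => [|n IHn]; first by rewrite /= diracT.
rewrite /= /lebesgue_rV_succ /pushforward preimage_setT -setXTT.
rewrite product_measure1E// mule_neq0//.
have := @lebesgue_measure_itv R `]-oo, +oo[; rewrite set_itvNyy /= => ->.
by [].
Qed.

Lemma integral_oneDsqrV :
  \int[@lebesgue_measure R]_x ((1 + x ^+ 2)^-1)%:E < +oo.
Proof.
rewrite (@ge0_symfun_integralT R (fun x => (oneDsqr x)^-1)%R) //.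
- rewrite (_ : [set x | _] = `[0%R, +oo[%classic).
    by rewrite integral0y_oneDsqr -EFinM ltry.
  by apply/seteqP; split => x /=; rewrite in_itv /= andbT.
- exact: continuous_oneDsqrV.
- by move=> x; rewrite /= /oneDsqr sqrrN.
Qed.

Lemma gibbs_weight_V_alphaT (d : nat) (alpha : R) : (0 < alpha)%R ->
  0 < gibbs_weight (@V_alpha R d alpha) setT < +oo.
Proof.
move=> alpha0; apply/andP; split.
  rewrite lt0e measure_ge0 andbT; apply: contra (lebesgue_rVT_neq0 d) => /eqP.
  rewrite /gibbs_weight => int0.
  have /ae_eq_integral_abs : \int[lebesgue_rV d]_x
      `|(expR (- @V_alpha R d alpha x))%:E| = 0.
    rewrite -[RHS]int0; apply: eq_integral => x _.
    by rewrite gee0_abs// lee_fin expR_ge0.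
  move=> /(_ measurableT (measurable_gibbs_density (@V_alpha R d alpha) (D:=setT))) [N [mN N0 NT]].
  rewrite -measure_le0 -N0 le_measure ?inE// => x _; apply: NT => /= /(_ I) [] /eqP.
  by rewrite gt_eqF// expR_gt0.
pose K := (Num.bound (2 * d%:R / alpha)).+1.
have K0 : (0 < (K`!)%:R :> R)%R by rewrite ltr0n fact_gt0.
have dK : (d%:R <= alpha / 2 * K%:R)%R.
  rewrite mulrAC ler_pdivlMr// [leRHS]mulrC -ler_pdivrMr//.
  rewrite [X in (X / _)%R]mulrC.
  have c0 : (0 <= 2 * d%:R / alpha)%R by rewrite divr_ge0 ?mulr_ge0// ltW.
  by rewrite ltW// (lt_trans (archi_boundP c0))// ltr_nat.
pose g (t : R) : R := ((1 + t ^+ 2)^-1)%R.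
have g0 t : (0 <= g t)%R by rewrite invr_ge0 addr_ge0// sqr_ge0.
have mg : measurable_fun setT g.
  by apply: continuous_measurable_fun; exact: continuous_oneDsqrV.
have bnd (x : 'rV[R]_d) :
    (expR (- V_alpha alpha x) <= (K`!)%:R * \prod_(i < d) g (x ord0 i))%R.
  rewrite /V_alpha sqr_enorm; set N := (\sum_(i < d) _)%R.
  have N0 : (0 <= N)%R by rewrite sumr_ge0// => i _; rewrite sqr_ge0.
  have N1 : (1 <= 1 + N)%R by rewrite lerDl.
  have N1' : (0 <= 1 + N)%R by rewrite addr_ge0.
  rewrite expRN -[leRHS]invrK lef_pV2 ?posrE ?expR_gt0//; last first.
    rewrite invr_gt0 mulr_gt0// prodr_gt0// => i _.
    by rewrite invr_gt0 ltr_pwDl// sqr_ge0.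
  apply: le_trans (_ : _ <= ((1 + N) `^ (alpha / 2)) ^+ K / (K`!)%:R)%R _;
    last first.
    have := expR_ge1Dxn K.-1 (powR_ge0 (1 + N) (alpha / 2)).
    by apply: le_trans; rewrite lerDr.
  rewrite invfM mulrC ler_pM2r ?invr_gt0//.
  rewrite -powR_mulrn ?powR_ge0// -powRrM.
  apply: le_trans (ler_powR N1 dK); rewrite powR_mulrn//.
  rewrite prodfV invrK -[in leRHS](card_ord d) -prodr_const.
  apply: ler_prod => i _; rewrite addr_ge0 ?sqr_ge0//= lerD2l.
  by rewrite /N (bigD1 i)//= lerDl sumr_ge0// => j _; rewrite sqr_ge0.
apply: (@le_lt_trans _ _
  (\int[lebesgue_rV d]_x ((K`!)%:R * \prod_(i < d) g (x ord0 i))%:E)).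
  apply: ge0_le_integral => //.
  - exact: measurable_gibbs_density.
  - apply/measurable_EFinP; apply: measurable_funM => //.
    apply: measurable_prod => i _.
    by apply: measurableT_comp => //; exact: measurable_rV_coord.
  - by move=> x _; rewrite lee_fin; exact: bnd.
under eq_integral do rewrite EFinM.
rewrite ge0_integralZl//.
- rewrite integral_lebesgue_rV_prod// lte_mul_pinfty// ?lee_fin//.
  have intg0 : 0 <= \int[@lebesgue_measure R]_x (g x)%:E.
    by apply: integral_ge0 => x _; rewrite lee_fin.
  rewrite -ge0_fin_numE ?expe_ge0// fin_numX// ge0_fin_numE//.
  exact: integral_oneDsqrV.
- apply/measurable_EFinP; apply: measurable_prod => i _.
  by apply: measurableT_comp => //; exact: measurable_rV_coord.
- by move=> x _; rewrite lee_fin prodr_ge0.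
Qed.

Lemma pi_alphaE (d : nat) (alpha : R) (A : set 'rV[R]_d) : (0 < alpha)%R ->
  pi_alpha d alpha A =
  (\int[lebesgue_rV d]_(x in A) (expR (- V_alpha alpha x))%:E) *
  (fine (\int[lebesgue_rV d]_x (expR (- V_alpha alpha x))%:E))^-1%:E.
Proof.
move=> /(gibbs_weight_V_alphaT d)/andP[Z0 Zoo].
by rewrite /pi_alpha /gibbs /= /mnormalize gt_eqF// lt_eqF.
Qed.

End normalizability.

(* Elements of L^2(P) are square-integrable functions, not classes modulo
   almost-everywhere equality: Osc is a pointwise supremum and infimum. *)
Record weak_poincare {R : realType} {d : nat} (P : probability 'rV[R]_d R)
    (beta : R -> R) (Phi : ('rV[R]_d -> R) -> \bar R) : Prop := {
  wpi_beta_ge0 : forall r : R, 0 < r -> 0 <= beta r ;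
  wpi_beta_noninc : forall r s : R, 0 < r -> r <= s -> beta s <= beta r ;
  wpi_Phi_ge0 : forall f, f \in Lfun P 2%:E -> (0 <= Phi f)%E ;
  wpi_Phi_affine : forall (a c : R) f, f \in Lfun P 2%:E ->
    Phi (fun x => c * f x + a) = ((c ^+ 2)%:E * Phi f)%E ;
  wpi_ineq : forall f, smooth f -> forall r : R, 0 < r ->
    ('V_P[f] <= (beta r)%:E * 'E_P[(fun x => enorm (grad f x) ^+ 2)%R]
                + r%:E * Phi f)%E }.

Definition beta_WPI {R : realType} (alpha C : R) (d : nat) (r : R) : R :=
  inf [set C * (d%:R `^ (2 * (2 - 2 * alpha + gamma) / gamma)
                + Num.max (ln r^-1) 0 `^ ((2 - 2 * alpha + gamma) / alpha))
      | gamma in [set gamma : R | 0 < gamma <= 2 * alpha]].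

(* Main.v *)
Require Import Defs.
From mathcomp Require Import all_boot all_order all_algebra.
From mathcomp Require Import all_classical all_reals all_analysis.
From mathcomp Require Import measurable_realfun.
From mathcomp Require Import ring lra.

(** Write V = V_alpha, u = 1 + |x|^2, m0 = d / alpha and u0 = m0^(2/alpha), so
    that V = m0 on the sphere u = u0.  Concavity of u |-> u^(alpha/2) gives
    [ghat <= exp (- V)] for the centred Gaussian weight [ghat] tangent to
    [exp (- V)] at u = u0, so no normalizing constant has to be computed.

    - The radial field X = a(V) x with a = (2/alpha) (V - m0) / (m0 + (V - m0)^2)
      is a Lyapunov field: div X - <X, grad V> <= -1 + C ghat exp V.  It points
      outwards on the faces of a large cube, so the divergence theorem on that
      cube bounds the integral of (f - f y)^2 exp (- V) by the one of
      C (f - f y)^2 ghat + 4 |X|^2 |grad f|^2 exp (- V).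
    - The ghat-average over y of the first term is controlled by the Gaussian
      Poincare inequality, tensorized from a one-dimensional Hardy inequality;
      the loss of a factor d is affordable.
    - Outside the cube of half-side (2 ln(1/r) + 4 m0 + 3)^(1/alpha) the
      measure has mass at most r, and (f - f y)^2 <= Osc(f)^2.

    The resulting constant is of order d^2 max(d, ln(1/r))^(2(1-alpha)/alpha), which
    is below every member of the family whose infimum defines beta. *)

Set Implicit Arguments.
Unset Strict Implicit.
Unset Printing Implicit Defensive.

Import Order.TTheory GRing.Theory Num.Theory.
Import numFieldNormedType.Exports.

Local Open Scope classical_set_scope.
Local Open Scope ring_scope.

(** * Continuity and measurability on row vectors *)

(** The number [m0] is where dilation balances confinement: div x = d, while <x, grad V> = alpha V
    |x|^2 / (1 + |x|^2), and the two agree to leading order at V = d / alpha. Under [exp (- V)] the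
    variable V behaves like a Gamma variable of shape [m0], hence fluctuates around [m0] on the
    scale sqrt m0. This is the width built into X: its drift can be positive only where |V - m0| <=
    4 sqrt m0. Only on that window must [ghat] control [exp (- V)] from above, and tangency makes
    the ratio a constant depending on alpha alone. The obstacle is that |X|^2 grows like |x|^(2 (1 -
    alpha)), so on the whole space the weight in front of the gradient would be unbounded; a bounded
    region costs the tail term. A cube rather than a ball reduces the divergence theorem to the
    fundamental theorem of calculus on lines. The Gaussian has variance u0 / d per coordinate. With
    the factor d lost in tensorization this becomes u0, of order d^(2 / alpha) = d^2 d^(2 (1 -
    alpha) / alpha), which is what the rate allows. *)

Section continuity.
Context {R : realType}.

Lemma continuous_rV (T : topologicalType) n (g : T -> 'rV[R]_n) :
  (forall i, continuous (fun x => g x ord0 i)) -> continuous g.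
Proof.
move=> cg x; apply/cvg_ballP => e e0; have : \forall y \near x, forall k, ball (g x ord0 k) e (g y ord0 k).
  by apply: filter_forall => k; exact: (cvg_ball (cg k x)).
by apply: filterS => y H; split => // i j; rewrite (ord1 i).
Qed.

Section pointwise.
Context {T : topologicalType}.
Implicit Types f g : T -> R.

Lemma fun_continuousD f g : continuous f -> continuous g ->
  continuous (fun x => f x + g x).
Proof. by move=> cf cg x; apply: cvgD; [exact: cf|exact: cg]. Qed.

Lemma fun_continuousM f g : continuous f -> continuous g ->
  continuous (fun x => f x * g x).
Proof. by move=> cf cg x; apply: cvgM; [exact: cf|exact: cg]. Qed.

Lemma fun_continuousN f : continuous f -> continuous (fun x => - f x).
Proof. by move=> cf x; apply: cvgN; exact: cf. Qed.

Lemma fun_continuousX f n : continuous f -> continuous (fun x => f x ^+ n).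
Proof.
move=> cf; elim: n => [|n IHn]; first exact: cst_continuous.
by under eq_fun do rewrite exprS; exact: fun_continuousM.
Qed.

Lemma fun_continuous_sum n (F : 'I_n -> T -> R) : (forall i, continuous (F i)) ->
  continuous (fun x => \sum_(i < n) F i x).
Proof.
elim: n F => [|n IHn] F cF.
  by under eq_fun do rewrite big_ord0; exact: cst_continuous.
under eq_fun do rewrite big_ord_recl.
by apply: fun_continuousD => //; exact: IHn.
Qed.

Lemma fun_continuous_comp (h : R -> R) f : continuous h -> continuous f ->
  continuous (fun x => h (f x)).
Proof. by move=> ch cf x; apply: continuous_comp; [exact: cf|exact: ch]. Qed.

End pointwise.

Lemma continuous_cons_rV n (a : R) : continuous (fun x : 'rV[R]_n => cons_rV (a, x)).
Proof.
apply: continuous_rV => i; case: (unliftP ord0 i) => [j|] ->.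
  under eq_fun do rewrite cons_rVS /=.
  exact: coord_continuous.
under eq_fun do rewrite cons_rV0 /=.
exact: cst_continuous.
Qed.

Lemma continuous_line n (x v : 'rV[R]_n) : continuous (fun s : R => x + s *: v).
Proof.
move=> s; apply: cvgD; first exact: cvg_cst.
by apply: cvgZr_tmp; exact: cvg_id.
Qed.

(** The sigma-algebra is generated by the coordinates, so open sets are not measurable by
    definition. Rounding every coordinate down to the grid of step 1 / (k + 1) gives functions with
    countably many values, each taken on a finite intersection of coordinate conditions; they
    converge pointwise to [f] by continuity. *)
Lemma measurable_continuous_rV n (f : 'rV[R]_n -> R) :
  continuous f -> measurable_fun setT f.
Proof.
move=> cf.
pose rd (k : nat) (x : 'rV[R]_n) : 'rV[int]_n :=
  \row_i Num.floor (x ord0 i * k.+1%:R).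
pose pt (k : nat) (z : 'rV[int]_n) : 'rV[R]_n := \row_i ((z ord0 i)%:~R / k.+1%:R).
apply: (@measurable_fun_cvg _ _ R setT (fun k x => f (pt k (rd k x)))).
- move=> k _ Y mY; rewrite setTI.
  rewrite (_ : _ @^-1` Y = \bigcup_z
     ([set x | rd k x = z] `&` [set x | Y (f (pt k z))])); last first.
    apply/seteqP; split => [x /= Yx|x [z _ [/= xz Yz]]]; last by rewrite /preimage /= xz.
    by exists (rd k x).
  apply: countable_bigcupT_measurable => // z.
  have [Yz|nYz] := pselect (Y (f (pt k z))); last first.
    by rewrite (_ : _ `&` _ = set0)//; apply/seteqP; split => x // [].
  rewrite (_ : [set x | Y _] = setT) ?setIT; last by apply/seteqP; split.
  rewrite (_ : [set x | _] = \bigcap_(i in [set: 'I_n])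
     [set x : 'rV[R]_n | Num.floor (x ord0 i * k.+1%:R) = z ord0 i]); last first.
    apply/seteqP; split => [x /= <- i _ /=|x /= xz]; first by rewrite mxE.
    by apply/rowP => i; rewrite mxE; exact: xz.
  apply: fin_bigcap_measurable => // i _.
  rewrite (_ : [set x | _] = (fun x : 'rV[R]_n => x ord0 i) @^-1`
    `[(z ord0 i)%:~R / k.+1%:R, ((z ord0 i) + 1)%:~R / k.+1%:R[%classic).
    by rewrite -[X in measurable X]setTI; exact: measurable_rV_coord.
  apply/seteqP; split => x /=; rewrite in_itv /= ler_pdivrMr// ltr_pdivlMr//.
    by move=> <-; rewrite floor_le floorD1_gt.
  by move=> H; apply: floor_def.
- move=> x _.
  apply: (cvg_comp (fun k => pt k (rd k x)) f _ (cf x)).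
  apply/cvg_ballP => e e0.
  have [K eK] : exists K : nat, K.+1%:R^-1 < e.
    by exists (Num.bound e^-1); rewrite invf_plt ?posrE// (lt_trans (archi_boundP _)) ?ltr_nat ?invr_ge0 ?ltW.
  exists K => // k /= Kk; split => // i j; rewrite (ord1 i) !mxE.
  have k0 : 0 < k.+1%:R :> R by [].
  rewrite /ball /= ltr_norml.
  have /andP[] := floor_itv (x ord0 j * k.+1%:R).
  rewrite intrD -ler_pdivrMr// -ltr_pdivlMr// mulrDl mul1r.
  set y := _ / _ => ylx xly.
  have : k.+1%:R^-1 < e :> R by apply: le_lt_trans eK; rewrite lef_pV2 ?posrE// ler_nat.
  by move: ylx xly e0; clear; set z := _^-1; lra.
Qed.
End continuity.

(** * Iterated integrals along the first coordinate *)

Section tonelli.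
Context {R : realType}.
Local Open Scope ereal_scope.
Local Notation mu := (@lebesgue_measure R).

Lemma integral_rV_consE n (G : 'rV[R]_n.+1 -> \bar R) :
  measurable_fun setT G -> (forall x, 0 <= G x) ->
  \int[lebesgue_rV n.+1]_x G x = \int[mu \x lebesgue_rV n]_p G (cons_rV p).
Proof.
by move=> mG G0; rewrite [LHS](ge0_integral_pushforward (@measurable_cons_rV R n)).
Qed.

Lemma integral_rV_consl n (G : 'rV[R]_n.+1 -> \bar R) :
  measurable_fun setT G -> (forall x, 0 <= G x) ->
  \int[lebesgue_rV n.+1]_x G x =
  \int[mu]_a \int[lebesgue_rV n]_x G (cons_rV (a, x)).
Proof.
move=> mG G0; rewrite integral_rV_consE// fubini_tonelli1//.
exact: (measurableT_comp mG (@measurable_cons_rV R n)).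
Qed.

Lemma integral_rV_consr n (G : 'rV[R]_n.+1 -> \bar R) :
  measurable_fun setT G -> (forall x, 0 <= G x) ->
  \int[lebesgue_rV n.+1]_x G x =
  \int[lebesgue_rV n]_x \int[mu]_a G (cons_rV (a, x)).
Proof.
move=> mG G0; rewrite integral_rV_consE// fubini_tonelli2//.
exact: (measurableT_comp mG (@measurable_cons_rV R n)).
Qed.

Lemma measurable_integral_consl n (G : 'rV[R]_n.+1 -> \bar R) :
  measurable_fun setT G -> (forall x, 0 <= G x) ->
  measurable_fun setT (fun a : R => \int[lebesgue_rV n]_x G (cons_rV (a, x))).
Proof.
move=> mG G0.
have mGc : measurable_fun setT (G \o @cons_rV R n).
  exact: (measurableT_comp mG (@measurable_cons_rV R n)).
by apply: (@measurable_fun_fubini_tonelli_F _ _ _ _ R (lebesgue_rV n) _ mGc) => p; exact: G0.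
Qed.

Lemma measurable_integral_consr n (G : 'rV[R]_n.+1 -> \bar R) :
  measurable_fun setT G -> (forall x, 0 <= G x) ->
  measurable_fun setT (fun x => \int[mu]_a G (cons_rV (a, x))).
Proof.
move=> mG G0.
have mGc : measurable_fun setT (G \o @cons_rV R n).
  exact: (measurableT_comp mG (@measurable_cons_rV R n)).
by apply: (@measurable_fun_fubini_tonelli_G _ _ _ _ R mu _ mGc) => p; exact: G0.
Qed.

End tonelli.

(** * Derivatives along coordinate lines *)

Section partial_derivatives.
Context {R : realType}.
Local Notation mu := (@lebesgue_measure R).

(* Only derivability along coordinate lines is asked for: this is all that [smooth]
   provides, and all that the divergence inequality needs. *)
Definition is_partial n (i : 'I_n) (H H' : 'rV[R]_n -> R) := forall x,
  is_derive (0 : R) (1 : R) (fun s => H (x + s *: delta_mx ord0 i)) (H' x).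

(** A derivative sees only increments. This converts directional derivatives on row vectors into
    derivatives of one-variable functions, and moves the base point along a line. *)
Lemma is_derive_eq_quotient (V W : normedModType R) (U : normedModType R)
    (f : V -> W) (g : U -> W) x v y w l :
  (forall h : R, f (h *: v + x) - f x = g (h *: w + y) - g y) ->
  is_derive x v f l -> is_derive y w g l.
Proof.
move=> E [df <-].
have eq_quo : (fun h : R => h^-1 *: ((f \o shift x) (h *: v) - f x)) =
         (fun h : R => h^-1 *: ((g \o shift y) (h *: w) - g y)).
  by apply/funext => h /=; rewrite E.
by split; rewrite /derivable /derive -eq_quo.
Qed.

Lemma is_partial_line n (i : 'I_n) (H H' : 'rV[R]_n -> R) x s : is_partial i H H' ->
  is_derive (s : R) (1 : R) (fun s => H (x + s *: delta_mx ord0 i))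
    (H' (x + s *: delta_mx ord0 i)).
Proof.
move=> /(_ (x + s *: delta_mx ord0 i)); apply: is_derive_eq_quotient => h.
by rewrite addr0 scale0r addr0 (scalerDl _ (h *: 1)) addrA addrAC.
Qed.

Lemma is_partial_smooth n (i : 'I_n) (f : 'rV[R]_n -> R) :
  smooth f -> is_partial i f (partial i f).
Proof.
move=> /(_ [::])[_ /= df] x; rewrite /partial.
apply: (is_derive_eq_quotient _ (derivableP (df i x))) => h.
by rewrite addr0 scale0r addr0 -[h *: 1]/(h * 1) mulr1 (addrC x).
Qed.

Lemma continuous_partial n (i : 'I_n) (f : 'rV[R]_n -> R) :
  smooth f -> continuous (partial i f).
Proof. by move=> /(_ [:: i])[]. Qed.

Lemma cons_rV_line0 n (a s : R) (x : 'rV[R]_n) :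
  cons_rV (a, x) + s *: delta_mx ord0 ord0 = cons_rV (a + s, x).
Proof.
apply/rowP => i; rewrite [LHS]mxE [X in _ + X]mxE [delta_mx _ _ _ _]mxE eqxx /=.
case: (unliftP ord0 i) => [j|] ->; first by rewrite !cons_rVS mulr0 addr0.
by rewrite !cons_rV0 eqxx mulr1.
Qed.

Lemma cons_rV_lineS n (a s : R) (x : 'rV[R]_n) j :
  cons_rV (a, x) + s *: delta_mx ord0 (lift ord0 j) =
  cons_rV (a, x + s *: delta_mx ord0 j).
Proof.
apply/rowP => i; rewrite [LHS]mxE [X in _ + X]mxE [delta_mx _ _ _ _]mxE eqxx /=.
case: (unliftP ord0 i) => [k|] ->; last by rewrite !cons_rV0 mulr0 addr0.
rewrite !cons_rVS (inj_eq lift_inj) [in RHS]/= [RHS]mxE [X in _ = _ + X]mxE.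
by rewrite [delta_mx _ _ _ _]mxE.
Qed.

Lemma is_partial_consS n j (a : R) (H H' : 'rV[R]_n.+1 -> R) :
  is_partial (lift ord0 j) H H' ->
  is_partial j (fun x => H (cons_rV (a, x))) (fun x => H' (cons_rV (a, x))).
Proof.
move=> dH x; have := dH (cons_rV (a, x)).
by under eq_fun do rewrite cons_rV_lineS.
Qed.

Lemma is_partial_cons0 n (a : R) (x : 'rV[R]_n) (H H' : 'rV[R]_n.+1 -> R) :
  is_partial ord0 H H' ->
  is_derive a (1 : R) (fun a => H (cons_rV (a, x))) (H' (cons_rV (a, x))).
Proof.
move=> /(is_partial_line (cons_rV (0, x)) a); rewrite cons_rV_line0 add0r.
by under eq_fun do rewrite cons_rV_line0 add0r.
Qed.

Lemma continuous_cons_rVl n (x : 'rV[R]_n) : continuous (fun a : R => cons_rV (a, x)).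
Proof.
rewrite (_ : (fun a : R => _) = fun a => cons_rV (0, x) + a *: delta_mx ord0 ord0).
  exact: continuous_line.
by apply/funext => a; rewrite cons_rV_line0 add0r.
Qed.

Lemma FTC2_continuous (F f : R -> R) (a b : R) : a < b -> continuous f ->
  (forall x, is_derive x (1 : R) F (f x)) ->
  (\int[mu]_(x in `[a, b]) (f x)%:E = (F b - F a)%:E)%E.
Proof.
move=> ab cf dF.
have cF : continuous F.
  by move=> x; apply/differentiable_continuous/derivable1_diffP; case: (dF x).
rewrite (continuous_FTC2 ab (F := F)) ?EFinB//.
- exact: continuous_subspaceT.
- split => [x _||].
  + by case: (dF x).
  + by apply: cvg_at_right_filter; exact: cF.
  + by apply: cvg_at_left_filter; exact: cF.
- by move=> x _; rewrite derive1E; case: (dF x).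
Qed.

End partial_derivatives.

(** * The divergence inequality on a cube *)
Section box.
Context {R : realType}.
Local Notation mu := (@lebesgue_measure R).

Definition segI (N a : R) : R := (`|a| <= N)%R%:R.

Definition boxb n (N : R) (x : 'rV[R]_n) := [forall i, `|x ord0 i| <= N].

Lemma boxb_cons n N a (x : 'rV[R]_n) :
  boxb N (cons_rV (a, x)) = (`|a| <= N) && boxb N x.
Proof.
apply/forallP/andP => [H|[aN /forallP xN] i].
  split; first by have := H ord0; rewrite cons_rV0.
  by apply/forallP => i; have := H (lift ord0 i); rewrite cons_rVS.
by case: (unliftP ord0 i) => [j|] ->; rewrite ?cons_rVS ?cons_rV0 //=.
Qed.

Lemma boxbE n N (x : 'rV[R]_n) :
  (boxb N x)%:R = \prod_(i < n) segI N (x ord0 i).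
Proof.
elim: n x => [|n IHn] x; first by rewrite big_ord0 (_ : boxb N x = true)//; apply/forallP => -[].
rewrite -(uncons_rVK x); case: (uncons_rV x) => a y.
rewrite big_ord_recl boxb_cons cons_rV0 /= -mulnb natrM; congr (_ * _).
by rewrite IHn; apply: eq_bigr => i _; rewrite cons_rVS.
Qed.

Lemma indic_itv_norm (N t : R) : segI N t = \1_`[- N, N]%classic t.
Proof. by rewrite /segI indicE mem_setE in_itv /= ler_norml. Qed.

Lemma measurable_norm_le (N : R) : measurable_fun setT (segI N).
Proof. by rewrite (_ : segI N = \1_`[- N, N]%classic)//; apply/funext => t; exact: indic_itv_norm. Qed.

Lemma measurable_boxb n N : measurable_fun setT (fun x : 'rV[R]_n => (boxb N x)%:R : R).
Proof.
under eq_fun do rewrite boxbE.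
apply: measurable_prod => i _.
by apply: (measurableT_comp (@measurable_norm_le N)); exact: measurable_rV_coord.
Qed.

Lemma integral_norm_le (N : R) (f : R -> \bar R) : measurable_fun setT f ->
  (\int[mu]_a (f a * (segI N a)%:E) = \int[mu]_(a in `[(- N)%R, N]) f a)%E.
Proof.
move=> mf; under eq_integral do rewrite indic_itv_norm.
rewrite [RHS]integral_mkcond/=; apply: eq_integral => a _.
rewrite patchE indicE; case: ifP => _; first by rewrite mule1.
by rewrite mule0.
Qed.

Lemma integral_boxb n (N : R) : 0 <= N ->
  (\int[lebesgue_rV n]_x (boxb N x)%:R%:E = ((2 * N) ^+ n)%:E)%E.
Proof.
move=> N0; under eq_integral do rewrite boxbE.
rewrite (@integral_lebesgue_rV_prod R n (segI N)) //; last exact: measurable_norm_le.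
rewrite EFin_expe; congr (_ ^+ _)%E.
under eq_integral do rewrite -[X in X%:E]mul1r EFinM.
rewrite (@integral_norm_le _ (cst 1%E)) // integral_cst//= mul1e.
rewrite lebesgue_measure_itv /= lte_fin.
case: ltrP => [_|]; first by rewrite -EFinD; congr EFin; lra.
by move=> H; congr EFin; lra.
Qed.

(* The constant [c] keeps every integrand nonnegative, so that Tonelli applies. *)
Lemma box_divergence n (N c : R) (i : 'I_n) (H H' : 'rV[R]_n -> R) :
  0 < N -> 0 <= c -> continuous H' -> is_partial i H H' ->
  (forall x, boxb N x -> 0 <= H' x + c) ->
  (forall x, boxb N x -> x ord0 i = N -> 0 <= H x) ->
  (forall x, boxb N x -> x ord0 i = - N -> H x <= 0) ->
  ((c * (2 * N) ^+ n)%:E <=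
    \int[lebesgue_rV n]_x ((H' x + c) * (boxb N x)%:R)%:E)%E.
Proof.
move=> N0 c0; elim: n i H H' => [[]//|n IHn] i H H' cH' dH H'c HN HNN.
have ge0 m (K : 'rV[R]_m -> R) x : (forall x, boxb N x -> 0 <= K x + c) ->
    0 <= (K x + c) * (boxb N x)%:R.
  by case: (boolP (boxb N x)) => [xN|_]; rewrite ?mulr0// mulr1; apply.
have mK m (K : 'rV[R]_m -> R) : continuous K -> measurable_fun setT
    (fun x => ((K x + c) * (boxb N x)%:R)%:E).
  move=> cK; apply/measurable_EFinP; apply: measurable_funM; last exact: measurable_boxb.
  by apply: measurable_funD => //; exact: measurable_continuous_rV.
case: (unliftP ord0 i) => [j|] ij; subst i.
(* The direction lies in the tail: use the induction hypothesis on each slice with first coordinate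
   [a], then integrate over [a] in [-N, N]. *)
- rewrite integral_rV_consl; [|exact: mK|by move=> x; rewrite lee_fin ge0].
  apply: (@le_trans _ _ (\int[mu]_a ((c * (2 * N) ^+ n)%:E * (segI N a)%:E)))%E.
    rewrite integral_norm_le// integral_cst//= lebesgue_measure_itv /= lte_fin.
    rewrite ifT; last by lra.
    by rewrite -EFinD -EFinM lee_fin exprSr le_eqVlt; apply/orP; left; apply/eqP; ring.
  apply: ge0_le_integral => //.
  + by move=> a _; rewrite -EFinM lee_fin !mulr_ge0// exprn_ge0// mulr_ge0// ltW.
  + apply: emeasurable_funM => //; apply/measurable_EFinP; exact: measurable_norm_le.
  + apply: (@measurable_integral_consl R n (fun x => ((H' x + c) * (boxb N x)%:R)%:E)).
      exact: mK.
    by move=> x; rewrite lee_fin ge0.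
  + move=> a _; case: (boolP (`|a| <= N)) => aN; last first.
      by rewrite /segI (negbTE aN) mule0; apply: integral_ge0 => x _; rewrite lee_fin ge0.
    rewrite /segI aN mule1.
    apply: (le_trans (IHn j (fun x => H (cons_rV (a, x))) (fun x => H' (cons_rV (a, x))) _ _ _ _ _)).
    * move=> x; apply: continuous_comp; [exact: continuous_cons_rV|exact: cH'].
    * exact: is_partial_consS.
    * by move=> x xN; apply: H'c; rewrite boxb_cons aN.
    * by move=> x xN xj; apply: HN; rewrite ?boxb_cons ?aN ?cons_rVS.
    * by move=> x xN xj; apply: HNN; rewrite ?boxb_cons ?aN ?cons_rVS.
    * rewrite le_eqVlt; apply/orP; left; apply/eqP; apply: eq_integral => x _.
      by rewrite boxb_cons aN.
- rewrite integral_rV_consr; [|exact: mK|by move=> x; rewrite lee_fin ge0].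
  apply: (@le_trans _ _ (\int[lebesgue_rV n]_x ((c * (2 * N))%:E * (boxb N x)%:R%:E)))%E.
    rewrite ge0_integralZl//.
    + by rewrite integral_boxb; [rewrite -EFinM lee_fin exprS mulrA|exact: ltW].
    + by apply/measurable_EFinP; exact: measurable_boxb.
    + by rewrite lee_fin !mulr_ge0// ltW.
  apply: ge0_le_integral => //.
  + by move=> a _; rewrite -EFinM lee_fin !mulr_ge0// ltW.
  + apply: emeasurable_funM => //; apply/measurable_EFinP; exact: measurable_boxb.
  + apply: (@measurable_integral_consr R n (fun x => ((H' x + c) * (boxb N x)%:R)%:E)).
      exact: mK.
    by move=> x; rewrite lee_fin ge0.
  + move=> x _; case: (boolP (boxb N x)) => xN; last first.
      by rewrite mule0; apply: integral_ge0 => a _; rewrite lee_fin ge0.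
    rewrite mule1.
    have cl : continuous (fun a => H' (cons_rV (a, x)) + c).
      move=> a; apply: cvgD; last exact: cvg_cst.
      by apply: continuous_comp; [exact: continuous_cons_rVl|exact: cH'].
    (* The primitive absorbs the shift [c]. Its increment over [-N, N] is the flux through two
       opposite faces plus 2 c N, and the sign conditions make the flux nonnegative. *)
    have dF a : is_derive a (1 : R) (fun a => H (cons_rV (a, x)) + c * a)
        (H' (cons_rV (a, x)) + c).
      have := is_partial_cons0 a x dH => dHa.
      have : is_derive a (1 : R) (fun a => c * a) c.
        by apply: is_derive_eq; rewrite -[LHS]/(c * 1) mulr1.
      by move=> ?; exact: is_deriveD.
    rewrite [leRHS](_ : _ = \int[mu]_a ((H' (cons_rV (a, x)) + c)%:E * (segI N a)%:E))%E; last first.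
      by apply: eq_integral => a _; rewrite boxb_cons xN andbT EFinM.
    rewrite integral_norm_le; last first.
      by apply/measurable_EFinP; exact: continuous_measurable_fun.
    rewrite (FTC2_continuous _ cl dF); last by lra.
    rewrite lee_fin.
    have : 0 <= H (cons_rV (N, x)) by apply: HN; rewrite ?boxb_cons ?cons_rV0// xN ger0_norm ?lexx// ltW.
    have : H (cons_rV (- N, x)) <= 0 by apply: HNN; rewrite ?boxb_cons ?cons_rV0// xN normrN ger0_norm ?lexx// ltW.
    lra.
Qed.

End box.
Section box_inequality.
Context {R : realType}.

Lemma continuous_bounded_box n (N : R) (f : 'rV[R]_n -> R) : continuous f ->
  exists2 M, 0 <= M & forall x, boxb N x -> `|f x| <= M.
Proof.
move=> cf.
have cpt : compact [set v : 'rV[R]_n | forall i, `[- N, N]%classic (v ord0 i)].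
  by apply: (@rV_compact R n (fun=> `[- N, N]%classic)) => i; exact: segment_compact.
have := compact_bounded (continuous_compact (continuous_subspaceT cf) cpt).
move=> [M [Mreal HM]]; exists (`|M| + 1); first by rewrite addr_ge0.
move=> x /forallP xN; apply: (HM (`|M| + 1)).
  by rewrite (le_lt_trans (ler_norm M))// ltrDl.
by exists x => // i; rewrite /= in_itv /= -ler_norml.
Qed.

(** A field pointing outwards on the faces has nonnegative total divergence, so the pointwise bound
    integrates to the comparison of [A] and [B]. Compactness of the cube supplies one shift [c] that
    makes all the partial derivatives nonnegative. *)
Lemma box_divergence_le n (N : R) (H H' : 'I_n -> 'rV[R]_n -> R) (A B : 'rV[R]_n -> R) :
  0 < N -> (forall i, continuous (H' i)) -> (forall i, is_partial i (H i) (H' i)) ->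
  (forall i x, boxb N x -> x ord0 i = N -> 0 <= H i x) ->
  (forall i x, boxb N x -> x ord0 i = - N -> H i x <= 0) ->
  measurable_fun setT A -> measurable_fun setT B ->
  (forall x, 0 <= A x) -> (forall x, 0 <= B x) ->
  (forall x, boxb N x -> \sum_i H' i x + A x <= B x) ->
  (\int[lebesgue_rV n]_x (A x * (boxb N x)%:R)%:E <=
   \int[lebesgue_rV n]_x (B x * (boxb N x)%:R)%:E)%E.
Proof.
move=> N0 cH' dH HN HNN mA mB A0 B0 HAB.
have [c c0 Hc] : exists2 c, 0 <= c & forall i x, boxb N x -> 0 <= H' i x + c.
  have /choice[M HM] i : exists M, 0 <= M /\ forall x, boxb N x -> `|H' i x| <= M.
    by have [M M0 MH] := continuous_bounded_box N (@cH' i); exists M.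
  exists (\sum_i M i); first by apply: sumr_ge0 => i _; case: (HM i).
  move=> i x xN; have [_ /(_ x xN)] := HM i; rewrite ler_norml => /andP[Hi _].
  have : M i <= \sum_i M i.
    by rewrite (bigD1 i)//= lerDl sumr_ge0// => j _; case: (HM j).
  lra.
have mbox := @measurable_boxb R n N.
have mH i : measurable_fun setT (fun x => ((H' i x + c) * (boxb N x)%:R)%:E).
  apply/measurable_EFinP; apply: measurable_funM => //.
  by apply: measurable_funD => //; exact: measurable_continuous_rV.
have H0 i x : (0 <= ((H' i x + c) * (boxb N x)%:R)%:E)%E.
  rewrite lee_fin; case: (boolP (boxb N x)) => [xN|_]; rewrite ?mulr0// mulr1.
  exact: Hc.
have mAb : measurable_fun setT (fun x => (A x * (boxb N x)%:R)%:E).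
  by apply/measurable_EFinP; exact: measurable_funM.
have mBb : measurable_fun setT (fun x => (B x * (boxb N x)%:R)%:E).
  by apply/measurable_EFinP; exact: measurable_funM.
(* One copy of c times the volume per coordinate; being finite, it is added to both sides and
   cancelled at the end. *)
pose V := (c * (2 * N) ^+ n) *+ n.
have : (V%:E + \int[lebesgue_rV n]_x (A x * (boxb N x)%:R)%:E <=
        V%:E + \int[lebesgue_rV n]_x (B x * (boxb N x)%:R)%:E)%E.
  apply: (@le_trans _ _ (\sum_(i < n) \int[lebesgue_rV n]_x ((H' i x + c) * (boxb N x)%:R)%:E +
     \int[lebesgue_rV n]_x (A x * (boxb N x)%:R)%:E)%E).
    apply: leeD => //.
    rewrite (_ : V%:E = \sum_(i < n) (c * (2 * N) ^+ n)%:E)%E; last first.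
      by rewrite sumEFin sumr_const card_ord.
    apply: lee_sum => i _; apply: (box_divergence (i := i)); eauto.
  rewrite -ge0_integral_sum//.
  rewrite -ge0_integralD//; last 3 first.
  - by move=> x _; apply: sume_ge0.
  - exact: emeasurable_sum.
  - by move=> x _; rewrite lee_fin mulr_ge0.
  rewrite (_ : V%:E = \int[lebesgue_rV n]_x ((c *+ n)%:E * (boxb N x)%:R%:E))%E; last first.
    rewrite ge0_integralZl//; last 2 first.
    - exact/measurable_EFinP.
    - by rewrite lee_fin mulrn_wge0.
    by rewrite integral_boxb ?(ltW N0)// -EFinM /V -mulrnAl.
  rewrite -ge0_integralD//; last 3 first.
  - by move=> x _; rewrite -EFinM lee_fin mulr_ge0// mulrn_wge0.
  - by apply: emeasurable_funM => //; exact/measurable_EFinP.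
  - by move=> x _; rewrite lee_fin mulr_ge0.
  apply: ge0_le_integral => //.
  - by move=> x _; rewrite adde_ge0 ?sume_ge0// lee_fin mulr_ge0.
  - by apply: emeasurable_funD => //; exact: emeasurable_sum.
  - apply: emeasurable_funD => //; apply: emeasurable_funM => //; exact/measurable_EFinP.
  - move=> x _; rewrite sumEFin -EFinM -!EFinD lee_fin.
    case: (boolP (boxb N x)) => [xN|_]; last by rewrite big1 ?mulr0// => i _; rewrite mulr0.
    under eq_bigr do rewrite mulr1.
    rewrite !mulr1 big_split /= sumr_const card_ord.
    by have := HAB x xN; lra.
by rewrite leeD2lE.
Qed.

End box_inequality.

(** * The Gaussian Poincare inequality *)
Section gaussian_line.
Context {R : realType}.
Local Notation mu := (@lebesgue_measure R).
Variable t : R.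
Hypothesis t0 : 0 < t.

Definition gauss1 (a : R) : R := expR (- (a ^+ 2 / (2 * t ^+ 2))).

Lemma is_derive_gauss1 a : is_derive a (1 : R) gauss1 (- (a / t ^+ 2) * gauss1 a).
Proof.
have d : is_derive a (1 : R) (fun a => - (a ^+ 2 / (2 * t ^+ 2))) (- (a / t ^+ 2)).
  have -> : (fun a => - (a ^+ 2 / (2 * t ^+ 2))) =
      (- (2 * t ^+ 2)^-1) \*: ((fun a : R => a) ^+ 2).
    by apply/funext => b /=; rewrite -[RHS]/(_ * b ^+ 2); ring.
  apply: is_derive_eq; rewrite -[LHS]/(_ * (_ * _)) /= expr1.
  by field; rewrite gt_eqF.
apply: is_derive_eq (is_derive1_comp (is_derive_expR _) d) _.
by rewrite /gauss1 mulrC.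
Qed.

Lemma continuous_gauss1 : continuous gauss1.
Proof.
move=> x; apply/differentiable_continuous/derivable1_diffP.
by case: (is_derive_gauss1 x).
Qed.

Lemma gauss1_ge0 a : 0 <= gauss1 a. Proof. exact: expR_ge0. Qed.

Lemma is_derive_continuous (F f : R -> R) :
  (forall x, is_derive x (1 : R) F (f x)) -> continuous F.
Proof.
by move=> dF x; apply/differentiable_continuous/derivable1_diffP; case: (dF x).
Qed.

(** One-dimensional Lyapunov argument: the derivative of g^2 Y [gauss1] integrates to a boundary
    term of good sign, the drift of Y contributes at most - g^2, and 2 g g' Y <= g^2 / 2 + 2 g'^2
    Y^2 with Y^2 <= 4 t^2 absorbs the cross term. This leaves 1/2 against 8 t^2, hence the factor
    16. *)
Lemma hardy_segment (g g' Y Y' : R -> R) (a b : R) : a < b ->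
  (forall x, is_derive x (1 : R) g (g' x)) -> continuous g' ->
  (forall x, is_derive x (1 : R) Y (Y' x)) -> continuous Y' ->
  (forall x, a <= x <= b -> Y' x - x / t ^+ 2 * Y x <= -1) ->
  (forall x, a <= x <= b -> Y x ^+ 2 <= 4 * t ^+ 2) ->
  0 <= g b ^+ 2 * Y b -> g a ^+ 2 * Y a <= 0 ->
  (\int[mu]_(x in `[a, b]) (g x ^+ 2 * gauss1 x)%:E <=
   (16 * t ^+ 2)%:E * \int[mu]_(x in `[a, b]) (g' x ^+ 2 * gauss1 x)%:E)%E.
Proof.
move=> ab dg cg' dY cY' HY HY2 gb ga.
have cg := is_derive_continuous dg; have cY := is_derive_continuous dY.
pose f x := 2 * g x * g' x * Y x * gauss1 x +
  g x ^+ 2 * (Y' x - x / t ^+ 2 * Y x) * gauss1 x.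
have dF x : is_derive x (1 : R) (fun x => g x ^+ 2 * Y x * gauss1 x) (f x).
  have dgx := dg x; have dYx := dY x; have dgam := is_derive_gauss1 x.
  rewrite (_ : (fun x => _) = (g ^+ 2 * Y) * gauss1); last by [].
  apply: is_derive_eq.
  rewrite -[LHS]/((g x ^+ 2 * Y x) * _ + gauss1 x * (g x ^+ 2 * Y' x + Y x * ((2%:R * g x ^+ 1) * g' x))).
  by rewrite /f; field; rewrite gt_eqF.
have cgam := continuous_gauss1.
have cid : continuous (fun x : R => x) by move=> x; exact: cvg_id.
have ccst (k : R) : continuous (fun x : R => k) by exact: cst_continuous.
have cgg : continuous (fun x => g x ^+ 2 * gauss1 x).
  by apply: fun_continuousM => //; exact: fun_continuousX.
have cgg' : continuous (fun x => g' x ^+ 2 * gauss1 x).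
  by apply: fun_continuousM => //; exact: fun_continuousX.
have cf : continuous f.
  apply: fun_continuousD; apply: fun_continuousM => //.
    by do 3 apply: fun_continuousM => //.
  apply: fun_continuousM; first exact: fun_continuousX.
  apply: fun_continuousD => //; apply: fun_continuousN.
  by do 2 apply: fun_continuousM => //.
have ig (k : R -> R) : continuous k -> mu.-integrable `[a, b] (EFin \o k).
  move=> ck; apply: continuous_compact_integrable; first exact: segment_compact.
  exact: continuous_subspaceT.
have chalf : continuous (fun x => 2^-1 * (g x ^+ 2 * gauss1 x)).
  exact: fun_continuousM.
have c8 : continuous (fun x => 8 * t ^+ 2 * (g' x ^+ 2 * gauss1 x)).
  exact: fun_continuousM.
have ge0 (k : R -> R) x : 0 <= k x ^+ 2 * gauss1 x.
  by rewrite mulr_ge0 ?sqr_ge0 ?gauss1_ge0.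
have mg (k : R -> R) : continuous k -> measurable_fun `[a, b] (fun x => (k x)%:E).
  move=> ck; apply: measurable_funTS; apply/measurable_EFinP.
  exact: continuous_measurable_fun.
have key : (\int[mu]_(x in `[a, b]) (2^-1 * (g x ^+ 2 * gauss1 x))%:E <=
            \int[mu]_(x in `[a, b]) (8 * t ^+ 2 * (g' x ^+ 2 * gauss1 x))%:E)%E.
  apply: (@le_trans _ _ (\int[mu]_(x in `[a, b]) ((2^-1 * (g x ^+ 2 * gauss1 x))%:E + (f x)%:E))%E).
    rewrite integralD//; [|exact: (ig _ chalf)|exact: (ig _ cf)].
    rewrite leeDl// (FTC2_continuous ab cf dF) lee_fin subr_ge0.
    apply: (@le_trans _ _ 0).
      by rewrite mulr_le0_ge0// gauss1_ge0.
    by rewrite mulr_ge0// gauss1_ge0.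
  apply: le_integral => //.
  - apply: integrableD => //; [exact: (ig _ chalf)|exact: (ig _ cf)].
  - exact: (ig _ c8).
  - move=> x; rewrite inE /= in_itv /= => xab.
    rewrite -EFinD lee_fin /f.
    have H1 := HY x xab; have H2 := HY2 x xab; have H3 := gauss1_ge0 x.
    rewrite !mulrA -!mulrDl ler_wpM2r//.
    have : g x ^+ 2 * (Y' x - x / t ^+ 2 * Y x) <= - g x ^+ 2.
      by rewrite -[leRHS]mulrN1 ler_wpM2l ?sqr_ge0.
    have : g' x ^+ 2 * Y x ^+ 2 <= g' x ^+ 2 * (4 * t ^+ 2).
      by rewrite ler_wpM2l ?sqr_ge0.
    have : 0 <= (g x - 2 * (g' x * Y x)) ^+ 2 by exact: sqr_ge0.
    move: (x / t ^+ 2 * Y x) (g x) (g' x) (Y x) (Y' x) => z G G' y y'.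
    nra.
under eq_integral do rewrite -[X in X%:E]mul1r -[X in (X * _)%:E](mulfV (_ : 2 != 0 :> R))// -mulrA EFinM.
rewrite ge0_integralZl//; [|exact: mg|by move=> x _; rewrite lee_fin mulr_ge0].
apply: (@le_trans _ _ (2%:E * \int[mu]_(x in `[a, b]) (8 * t ^+ 2 * (g' x ^+ 2 * gauss1 x))%:E)%E).
  by rewrite lee_pmul2l.
under eq_integral do rewrite EFinM.
rewrite ge0_integralZl//; [|exact: mg|by move=> x _; rewrite lee_fin|by rewrite lee_fin mulr_ge0// sqr_ge0].
by rewrite muleA -EFinM mulrA (_ : 2 * 8 = 16 :> R)//; ring.
Qed.

End gaussian_line.
Section exhaustion.
Local Open Scope ereal_scope.

(** Monotone convergence. It carries to the whole space the bounds obtained on segments and cubes,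
    where boundary terms have a sign, so that no decay at infinity has to be discussed. *)
Lemma le_integral_exhaustion d (T : measurableType d) (R : realType)
    (m : {measure set T -> \bar R}) (F : T -> R) (b : nat -> T -> bool) (C : \bar R) :
  measurable_fun setT F -> (forall x, 0 <= F x)%R ->
  (forall n, measurable_fun setT (fun x => (b n x)%:R : R)) ->
  (forall x n k, (n <= k)%N -> b n x -> b k x) -> (forall x, exists n, b n x) ->
  (forall n, \int[m]_x (F x * (b n x)%:R)%:E <= C) -> \int[m]_x (F x)%:E <= C.
Proof.
move=> mF F0 mb bnd bex FC.
pose g n x := (F x * (b n x)%:R)%:E.
have g0 n x : 0 <= g n x by rewrite lee_fin mulr_ge0.
have mg n : measurable_fun setT (g n) by apply/measurable_EFinP; exact: measurable_funM.
have ndg x : nondecreasing_seq (g ^~ x).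
  move=> n k nk; rewrite lee_fin ler_wpM2l// ler_nat.
  by have := bnd x n k nk; case: (b n x) => // ->.
have -> : \int[m]_x (F x)%:E = \int[m]_x limn (g ^~ x).
  apply: eq_integral => x _; apply/esym/cvg_lim => //.
  apply: cvg_near_cst; have [n bnx] := bex x; exists n => // k /= nk.
  by rewrite /g (bnd _ _ _ nk bnx) mulr1.
rewrite monotone_convergence//.
apply: lime_le; last by near=> n; exact: FC.
apply: ereal_nondecreasing_is_cvgn => n k nk; apply: ge0_le_integral => // x _.
exact: ndg.
Unshelve. all: by end_near. Qed.

End exhaustion.

Section gaussian_hardy.
Context {R : realType}.
Local Notation mu := (@lebesgue_measure R).
Variable t : R.
Hypothesis t0 : 0 < t.

Lemma measurable_gauss1 : measurable_fun setT (gauss1 t).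
Proof. by apply: continuous_measurable_fun; exact: continuous_gauss1. Qed.

Lemma is_derive_expRM (k x : R) : is_derive x (1 : R) (fun x => expR (k * x)) (k * expR (k * x)).
Proof.
have d : is_derive x (1 : R) (fun x => k * x) k.
  by apply: is_derive_eq; rewrite -[LHS]/(k * 1) mulr1.
apply: is_derive_eq (is_derive1_comp (is_derive_expR _) d) _.
by rewrite mulrC.
Qed.

(** Centring at [h 0] rather than at the mean makes the boundary term at the origin vanish, so the
    two half-lines can be treated separately. *)
Lemma hardy_gauss1 (h h' : R -> R) :
  (forall x, is_derive x (1 : R) h (h' x)) -> continuous h' ->
  (\int[mu]_a ((h a - h 0) ^+ 2 * gauss1 t a)%:E <=
   (32 * t ^+ 2)%:E * \int[mu]_a (h' a ^+ 2 * gauss1 t a)%:E)%E.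
Proof.
move=> dh ch'.
pose g a := h a - h 0.
have dg x : is_derive x (1 : R) g (h' x).
  have dhx := dh x.
  rewrite (_ : g = h - cst (h 0))//; apply: is_derive_eq.
  by rewrite subr0.
have cg := is_derive_continuous dg.
have gam0 := gauss1_ge0 t.
have mgam := measurable_gauss1.
have mg : measurable_fun setT (fun x => g x ^+ 2 * gauss1 t x).
  apply: measurable_funM => //; apply: measurable_funX.
  exact: continuous_measurable_fun.
have mh' : measurable_fun setT (fun x => h' x ^+ 2 * gauss1 t x).
  apply: measurable_funM => //; apply: measurable_funX.
  exact: continuous_measurable_fun.
have ge0 (k : R -> R) x : 0 <= k x ^+ 2 * gauss1 t x by rewrite mulr_ge0 ?sqr_ge0.
have t2 : t ^+ 2 != 0 by rewrite sqrf_eq0 gt_eqF.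
have step (s : R) : `|s| = 1 -> forall a b : R, a < b -> (forall x, a <= x <= b -> 0 <= s * x) ->
    0 <= g b ^+ 2 * s -> g a ^+ 2 * s <= 0 ->
    (\int[mu]_(x in `[a, b]) (g x ^+ 2 * gauss1 t x)%:E <=
   (16 * t ^+ 2)%:E * \int[mu]_x (h' x ^+ 2 * gauss1 t x)%:E)%E.
  move=> s1 a b ab sab gb ga.
  have ss : s * s = 1 by rewrite -expr2 -real_normK ?num_real// s1 expr1n.
  (* The sign [s] selects the half-line. With w = s x / t >= 0 and E = exp (- w), the drift of Y is
     - E - w (1 + E), at most -1 because E >= 1 - w; and Y^2 = t^2 (1 + E)^2 <= 4 t^2 because E <=
     1. *)
  pose Y x := s * t * (1 + expR (- s / t * x)).
  pose Y' x := - expR (- s / t * x).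
  have dY x : is_derive x (1 : R) Y (Y' x).
    have dE := is_derive_expRM (- s / t) x.
    rewrite (_ : Y = (s * t) \*: (cst 1 + (fun x => expR (- s / t * x)))); last by [].
    apply: is_derive_eq.
    rewrite add0r -[LHS]/(s * t * _) mulrA /Y'.
    have -> : s * t * (- s / t) = - (s * s) by field; rewrite gt_eqF.
    by rewrite ss mulN1r.
  have cY' : continuous Y'.
    apply: fun_continuousN.
    exact: (is_derive_continuous (is_derive_expRM (- s / t))).
  have E1 x : a <= x <= b -> 0 <= s * x / t /\ expR (- s / t * x) <= 1.
    move=> /sab sx; have sxt : 0 <= s * x / t by rewrite divr_ge0// ltW.
    split=> //; rewrite expR_le1.
    by have -> : - s / t * x = - (s * x / t) by [ring]; rewrite oppr_le0.
  apply: le_trans (hardy_segment t0 ab dg ch' dY cY' _ _ _ _) _.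
  - move=> x xab; have [u0 E2] := E1 x xab.
    have : 1 - s * x / t <= expR (- s / t * x).
      by apply: le_trans (expR_ge1Dx _); rewrite lerD2l le_eqVlt; apply/orP; left; apply/eqP; ring.
    rewrite /Y /Y'; have : 0 <= s * x / t * expR (- s / t * x) by rewrite mulr_ge0// expR_ge0.
    have -> : x / t ^+ 2 * (s * t * (1 + expR (- s / t * x))) = s * x / t * (1 + expR (- s / t * x)).
      by field; rewrite gt_eqF.
    move: (expR _) (s * x / t) => E u; lra.
  - move=> x xab; have [u0 E2] := E1 x xab.
    have E0 := expR_ge0 (- s / t * x).
    have -> : Y x ^+ 2 = (s * s) * t ^+ 2 * (1 + expR (- s / t * x)) ^+ 2 by rewrite /Y; ring.
    rewrite ss mul1r mulrC ler_wpM2r ?sqr_ge0//.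
    move: (expR _) E0 E2 => E; nra.
  - rewrite /Y !mulrA -mulrA mulr_ge0//.
    by rewrite mulr_ge0 ?addr_ge0 ?expR_ge0// ltW.
  - rewrite /Y !mulrA -mulrA mulr_le0_ge0//.
    by rewrite mulr_ge0 ?addr_ge0 ?expR_ge0// ltW.
  - rewrite lee_pmul2l// ?lte_fin ?mulr_gt0 ?exprn_gt0//.
    apply: ge0_subset_integral => //; first exact/measurable_EFinP.
    by move=> x _; rewrite lee_fin.
apply: (@le_integral_exhaustion _ _ R mu (fun a => g a ^+ 2 * gauss1 t a)
  (fun n a => `|a : R| <= n.+1%:R)) => //.
- by move=> n; exact: (@measurable_norm_le R n.+1%:R).
- by move=> x n k nk /le_trans; apply; rewrite ler_nat.
- move=> x; exists (Num.bound x); rewrite (le_trans (ltW (archi_boundP (normr_ge0 x))))//.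
  by rewrite (_ : Num.bound `|x| = Num.bound x) ?ler_nat// /Num.bound normr_id.
move=> n.
pose n1 : R := n.+1%:R.
apply: (@le_trans _ _ ((\int[mu]_(x in `[(- n1)%R, 0%R]) (g x ^+ 2 * gauss1 t x)%:E) +
  (\int[mu]_(x in `[0%R, n1]) (g x ^+ 2 * gauss1 t x)%:E))%E).
  rewrite [X in (_ <= X + _)%E]integral_mkcond [X in (_ <= _ + X)%E]integral_mkcond.
  have rge0 (A : set R) x : (0 <= ((fun x => (g x ^+ 2 * gauss1 t x)%:E) \_ A) x)%E.
    by rewrite patchE; case: ifP => //; rewrite lee_fin.
  have rm (A : set R) : measurable A ->
      measurable_fun setT ((fun x => (g x ^+ 2 * gauss1 t x)%:E) \_ A).
    move=> mA; apply/(measurable_restrictT _ mA); apply: measurable_funTS.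
    exact/measurable_EFinP.
  rewrite -ge0_integralD//; try exact: rm.
  apply: ge0_le_integral => //.
  - by move=> x _; rewrite lee_fin mulr_ge0.
  - apply/measurable_EFinP; apply: measurable_funM => //.
    exact: (@measurable_norm_le R n.+1%:R).
  - by apply: emeasurable_funD; exact: rm.
  - move=> x _; case: (boolP (`|x| <= _)) => xn; last by rewrite mulr0 adde_ge0.
    rewrite mulr1; move: xn; rewrite ler_norml => /andP[xn1 xn2].
    have [x0|x0] := leP x 0.
      by rewrite [X in (_ <= X + _)%E]patchE mem_setE in_itv /= xn1 x0 leeDl.
    by rewrite [X in (_ <= _ + X)%E]patchE mem_setE in_itv /= xn2 (ltW x0) leeDr.
(* Each half-line is bounded by the gradient integral over the full line, so the constants add. *)
have -> : (32 * t ^+ 2 = 16 * t ^+ 2 + 16 * t ^+ 2)%R by ring.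
rewrite EFinD ge0_muleDl ?lee_fin ?mulr_ge0 ?(ltW t0)//.
have g00 : g 0 = 0 by rewrite /g subrr.
apply: leeD.
- apply: (step (-1)).
  + by rewrite normrN1.
  + by rewrite oppr_lt0 ltr0n.
  + by move=> x /andP[_ x0]; rewrite mulN1r oppr_ge0.
  + by rewrite g00 expr0n /= mul0r.
  + by rewrite mulrN1 oppr_le0 sqr_ge0.
- apply: (step 1).
  + by rewrite normr1.
  + by rewrite ltr0n.
  + by move=> x /andP[x0 _]; rewrite mul1r.
  + by rewrite mulr1 sqr_ge0.
  + by rewrite g00 expr0n /= mul0r.
Qed.

End gaussian_hardy.

(** * Integrals of nonnegative real-valued functions *)

Section integral_helpers.
Context d (T : measurableType d) (R : realType) (m : {measure set T -> \bar R}).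
Local Open Scope ereal_scope.

Lemma ge0_integralZlr (k : R) (F : T -> R) : measurable_fun setT F ->
  (forall x, 0 <= F x)%R -> (0 <= k)%R ->
  \int[m]_x (k * F x)%:E = k%:E * \int[m]_x (F x)%:E.
Proof.
move=> mF F0 k0; under eq_integral do rewrite EFinM.
rewrite ge0_integralZl//; first exact/measurable_EFinP.
by move=> x _; rewrite lee_fin.
Qed.

Lemma ge0_integralDr (F G : T -> R) : measurable_fun setT F -> measurable_fun setT G ->
  (forall x, 0 <= F x)%R -> (forall x, 0 <= G x)%R ->
  \int[m]_x (F x + G x)%:E = \int[m]_x (F x)%:E + \int[m]_x (G x)%:E.
Proof.
move=> mF mG F0 G0; under eq_integral do rewrite EFinD.
rewrite ge0_integralD//.
- by move=> x _; rewrite lee_fin.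
- exact/measurable_EFinP.
- by move=> x _; rewrite lee_fin.
- exact/measurable_EFinP.
Qed.

Lemma ge0_le_integralr (F G : T -> R) : measurable_fun setT F -> measurable_fun setT G ->
  (forall x, 0 <= F x)%R -> (forall x, F x <= G x)%R ->
  \int[m]_x (F x)%:E <= \int[m]_x (G x)%:E.
Proof.
move=> mF mG F0 FG; apply: ge0_le_integral => //.
- by move=> x _; rewrite lee_fin.
- exact/measurable_EFinP.
- exact/measurable_EFinP.
- by move=> x _; rewrite lee_fin.
Qed.

Lemma integralr_ge0 (F : T -> R) : (forall x, 0 <= F x)%R -> 0 <= \int[m]_x (F x)%:E.
Proof. by move=> F0; apply: integral_ge0 => x _; rewrite lee_fin. Qed.

End integral_helpers.

Section gaussian_pairs.
Context {R : realType}.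
Local Notation mu := (@lebesgue_measure R).
Variable t : R.
Hypothesis t0 : 0 < t.
Local Notation g1 := (gauss1 t).
Local Notation Z := (\int[mu]_a (g1 a)%:E)%E.

Let mg1 := @measurable_gauss1 R t t0.
Let g10 := @gauss1_ge0 R t.

(** A Poincare inequality written with pairs of points, which needs neither a mean nor a normalized
    Gaussian. The difference is split through [h 0]; by symmetry this gives 4 times the Hardy bound,
    and 128 = 4 * 32. *)
Lemma pair_gauss1 (h h' : R -> R) :
  (forall x, is_derive x (1 : R) h (h' x)) -> continuous h' ->
  (\int[mu]_a \int[mu]_b ((h a - h b) ^+ 2 * (g1 a * g1 b))%:E <=
   (128 * t ^+ 2)%:E * (Z * \int[mu]_a (h' a ^+ 2 * g1 a)%:E))%E.
Proof.
move=> dh ch'; pose k a := (h a - h 0) ^+ 2 * g1 a.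
have ch := is_derive_continuous dh.
have mh : measurable_fun setT h by exact: continuous_measurable_fun.
have mk : measurable_fun setT k.
  by apply: measurable_funM => //; apply: measurable_funX; exact: measurable_funB.
have k0 a : 0 <= k a by rewrite mulr_ge0 ?sqr_ge0.
have t20 : 0 <= t ^+ 2 by exact: sqr_ge0.
set S := (\int[mu]_a (k a)%:E)%E.
have S0 : (0 <= S)%E by exact: integralr_ge0.
have Z0 : (0 <= Z)%E by exact: integralr_ge0.
have K0 a b : 0 <= (h a - h b) ^+ 2 * (g1 a * g1 b).
  by apply: mulr_ge0; [exact: sqr_ge0|exact: mulr_ge0].
have mK : measurable_fun setT (fun p : R * R => ((h p.1 - h p.2) ^+ 2 * (g1 p.1 * g1 p.2))%:E).
  apply/measurable_EFinP; apply: measurable_funM.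
    apply: measurable_funX; apply: measurable_funB.
      exact: (measurableT_comp mh measurable_fst).
    exact: (measurableT_comp mh measurable_snd).
  apply: measurable_funM.
    exact: (measurableT_comp mg1 measurable_fst).
  exact: (measurableT_comp mg1 measurable_snd).
apply: (@le_trans _ _ (\int[mu]_a ((2 * k a)%:E * Z + (2 * g1 a)%:E * S))%E).
  apply: ge0_le_integral => //.
  - by move=> a _; exact: integralr_ge0.
  - apply: (@measurable_fun_fubini_tonelli_F _ _ _ _ R mu _ mK) => p.
    by rewrite lee_fin.
  - apply: emeasurable_funD; apply: emeasurable_funM => //; apply/measurable_EFinP; exact: measurable_funM.
  - move=> a _; rewrite -!ge0_integralZlr//; last 2 first.
      by rewrite mulr_ge0.
      by rewrite mulr_ge0.
    rewrite -ge0_integralDr//; last 4 first.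
      exact: measurable_funM.
      exact: measurable_funM.
      by move=> b; apply: mulr_ge0 => //; exact: mulr_ge0.
      by move=> b; apply: mulr_ge0 => //; exact: mulr_ge0.
    apply: ge0_le_integralr.
    + apply: measurable_funM; last exact: measurable_funM.
      by apply: measurable_funX; exact: measurable_funB.
    + by apply: measurable_funD; apply: measurable_funM.
    + by [].
    + move=> b; rewrite /k.
      have -> : 2 * ((h a - h 0) ^+ 2 * g1 a) * g1 b + 2 * g1 a * ((h b - h 0) ^+ 2 * g1 b) =
        (2 * (h a - h 0) ^+ 2 + 2 * (h b - h 0) ^+ 2) * (g1 a * g1 b) by ring.
      rewrite ler_wpM2r ?mulr_ge0//.
      have := sqr_ge0 ((h a - h 0) + (h b - h 0)); lra.
rewrite ge0_integralD//; last 4 first.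
- by move=> a _; rewrite mule_ge0// lee_fin mulr_ge0.
- by apply: emeasurable_funM => //; apply/measurable_EFinP; exact: measurable_funM.
- by move=> a _; rewrite mule_ge0// lee_fin mulr_ge0.
- by apply: emeasurable_funM => //; apply/measurable_EFinP; exact: measurable_funM.
rewrite !ge0_integralZr//; last 4 first.
- by apply/measurable_EFinP; exact: measurable_funM.
- by move=> a _; rewrite lee_fin mulr_ge0.
- by apply/measurable_EFinP; exact: measurable_funM.
- by move=> a _; rewrite lee_fin mulr_ge0.
rewrite !ge0_integralZlr// -/S.
have -> : (2%:E * S * Z + 2%:E * Z * S = 4%:E * (Z * S))%E.
  by rewrite -!muleA (muleC S) -ge0_muleDl ?lee_fin// -EFinD; congr (_%:E * _)%E; ring.
have := hardy_gauss1 t0 dh ch'; rewrite -/S => HS.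
apply: (@le_trans _ _ (4%:E * (Z * ((32 * t ^+ 2)%:E * \int[mu]_a (h' a ^+ 2 * g1 a)%:E)))%E).
  by rewrite lee_pmul2l// lee_wpmul2l.
rewrite (muleCA Z) (muleA 4%:E) -EFinM le_eqVlt; apply/orP; left; apply/eqP.
by congr (_%:E * _)%E; ring.
Qed.

End gaussian_pairs.
Section gaussian_tensor.
Context {R : realType}.
Local Notation mu := (@lebesgue_measure R).
Variable t : R.
Hypothesis t0 : 0 < t.
Local Notation g1 := (gauss1 t).
Local Notation Z := (\int[mu]_a (g1 a)%:E)%E.

Let mg1 := @measurable_gauss1 R t t0.
Let g10 := @gauss1_ge0 R t.

Definition gauss n (x : 'rV[R]_n) : R := \prod_(i < n) g1 (x ord0 i).

Lemma gauss_ge0 n (x : 'rV[R]_n) : 0 <= gauss x.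
Proof. exact: prodr_ge0. Qed.

Lemma measurable_gauss n : measurable_fun setT (@gauss n).
Proof.
apply: measurable_prod => i _.
by apply: (measurableT_comp mg1); exact: measurable_rV_coord.
Qed.

Lemma gauss_cons n a (x : 'rV[R]_n) : gauss (cons_rV (a, x)) = g1 a * gauss x.
Proof.
rewrite /gauss big_ord_recl cons_rV0; congr (_ * _).
by apply: eq_bigr => i _; rewrite cons_rVS.
Qed.

Lemma integral_gauss n : (\int[lebesgue_rV n]_x (gauss x)%:E = Z ^+ n)%E.
Proof. exact: integral_lebesgue_rV_prod. Qed.

Lemma measurable_tail n : measurable_fun setT (fun x : 'rV[R]_n.+1 => (uncons_rV x).2).
Proof. exact: (measurableT_comp measurable_snd (@measurable_uncons_rV R n)). Qed.

(** Induction on the dimension: move the first coordinate, then the tail. Going through an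
    intermediate point and using a weighted triangle inequality, instead of the exact decomposition
    of the variance, costs the factor [n.+1]. *)
Lemma pair_gauss n (f : 'rV[R]_n -> R) (D : 'I_n -> 'rV[R]_n -> R) :
  continuous f -> (forall i, continuous (D i)) -> (forall i, is_partial i f (D i)) ->
  (\int[lebesgue_rV n]_x \int[lebesgue_rV n]_y ((f x - f y) ^+ 2 * (gauss x * gauss y))%:E <=
   (n.+1%:R * (128 * t ^+ 2))%:E *
     (Z ^+ n * \int[lebesgue_rV n]_x ((\sum_i D i x ^+ 2) * gauss x)%:E))%E.
Proof.
have Z0 : (0 <= Z)%E by exact: integralr_ge0.
have Zn0 k : (0 <= Z ^+ k)%E by exact: expe_ge0.
have t20 : 0 <= 128 * t ^+ 2 by rewrite mulr_ge0// sqr_ge0.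
elim: n f D => [|n IHn] f D cf cD dD.
  rewrite integral0_eq => [|x _]; last first.
    apply: integral0_eq => y _; rewrite (_ : x = y) ?subrr ?expr0n ?mul0r//.
    by apply/rowP => -[].
  apply: mule_ge0; first by rewrite lee_fin mulr_ge0.
  apply: mule_ge0 => //.
  by apply: integralr_ge0 => x; rewrite mulr_ge0 ?gauss_ge0 ?sumr_ge0// => i _; exact: sqr_ge0.
(* The weights in (p + q)^2 <= c p^2 + e q^2. They satisfy 1 / c + 1 / e = 1 and e (n + 1) = c, so
   the new direction and the inductive ones all receive the constant n + 2. *)
pose c : R := n.+2%:R; pose e : R := n.+2%:R / n.+1%:R.
have c0 : 0 <= c by [].
have e0 : 0 <= e by rewrite divr_ge0.
have mf := measurable_continuous_rV cf.
have mG := @measurable_gauss; have mGn := mG n; have mGS := mG n.+1; have G0 := gauss_ge0.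
have mD i : measurable_fun setT (D i) by exact: measurable_continuous_rV.
have msec b : measurable_fun setT (fun x : 'rV[R]_n => f (cons_rV (b, x))).
  apply: measurable_continuous_rV => x.
  by apply: continuous_comp; [exact: continuous_cons_rV|exact: cf].
have mfb b : measurable_fun setT (fun x : 'rV[R]_n.+1 => f (cons_rV (b, (uncons_rV x).2))).
  exact: (measurableT_comp (msec b) (@measurable_tail n)).
(* In [A] only the first coordinate changes, from that of [x] to [b]; in [B] the first coordinate
   stays at [b] and the tails differ. *)
pose A b := (\int[lebesgue_rV n.+1]_x ((f x - f (cons_rV (b, (uncons_rV x).2))) ^+ 2 * (gauss x * g1 b))%:E)%E.
pose B b y := (\int[lebesgue_rV n]_x ((f (cons_rV (b, y)) - f (cons_rV (b, x))) ^+ 2 * (gauss y * gauss x))%:E)%E.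
have A0 b : (0 <= A b)%E.
  by apply: integralr_ge0 => x; apply: mulr_ge0; [exact: sqr_ge0|exact: mulr_ge0].
have B0 b y : (0 <= B b y)%E.
  by apply: integralr_ge0 => x; apply: mulr_ge0; [exact: sqr_ge0|exact: mulr_ge0].
have K0 k (h : 'rV[R]_k -> R) x y : (0 <= (h x - h y) ^+ 2 * (gauss x * gauss y))%R.
  by apply: mulr_ge0; [exact: sqr_ge0|exact: mulr_ge0].
have mK k (h : 'rV[R]_k -> R) : measurable_fun setT h -> measurable_fun setT
    (fun p : 'rV[R]_k * 'rV[R]_k => ((h p.1 - h p.2) ^+ 2 * (gauss p.1 * gauss p.2))%:E).
  move=> mh; apply/measurable_EFinP; apply: measurable_funM.
    apply: measurable_funX; apply: measurable_funB.
      exact: (measurableT_comp mh measurable_fst).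
    exact: (measurableT_comp mh measurable_snd).
  apply: measurable_funM.
    exact: (measurableT_comp (mG k) measurable_fst).
  exact: (measurableT_comp (mG k) measurable_snd).
have mKF k (h : 'rV[R]_k -> R) : measurable_fun setT h -> measurable_fun setT
    (fun x => (\int[lebesgue_rV k]_y ((h x - h y) ^+ 2 * (gauss x * gauss y))%:E)%E).
  move=> mh; apply: (@measurable_fun_fubini_tonelli_F _ _ _ _ R (lebesgue_rV k) _ (mK k h mh)) => p.
  by rewrite lee_fin.
have mB b : measurable_fun setT (B b) by exact: (mKF n (fun x => f (cons_rV (b, x))) (msec b)).
(* The intermediate point is (b, tail of x). The factor [Z] in front of [B] is the mass of the first
   coordinate of [x], on which that term does not depend. *)
have inner b y : (\int[lebesgue_rV n.+1]_x ((f (cons_rV (b, y)) - f x) ^+ 2 *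
      (gauss (cons_rV (b, y)) * gauss x))%:E <=
    (c * gauss y)%:E * A b + (e * g1 b)%:E * (Z * B b y))%E.
  have mk1 : measurable_fun setT (fun x => (f x - f (cons_rV (b, (uncons_rV x).2))) ^+ 2 * (gauss x * g1 b)).
    apply: measurable_funM; last exact: measurable_funM.
    by apply: measurable_funX; exact: measurable_funB.
  have mk2 : measurable_fun setT (fun x => (f (cons_rV (b, y)) - f (cons_rV (b, (uncons_rV x).2))) ^+ 2 *
      (gauss y * gauss x)).
    apply: measurable_funM; last exact: measurable_funM.
    by apply: measurable_funX; exact: measurable_funB.
  have -> : (Z * B b y = \int[lebesgue_rV n.+1]_x ((f (cons_rV (b, y)) - f (cons_rV (b, (uncons_rV x).2))) ^+ 2 *
      (gauss y * gauss x))%:E)%E.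
    rewrite integral_rV_consr; last 2 first.
    - exact/measurable_EFinP.
    - by move=> x; rewrite lee_fin; apply: mulr_ge0; [exact: sqr_ge0|exact: mulr_ge0].
    rewrite muleC /B -ge0_integralZr//; last 2 first.
    - apply/measurable_EFinP; apply: measurable_funM; last exact: measurable_funM.
      by apply: measurable_funX; exact: measurable_funB.
    - by move=> x _; rewrite lee_fin; apply: mulr_ge0; [exact: sqr_ge0|exact: mulr_ge0].
    apply: eq_integral => x _; rewrite -ge0_integralZlr//; last first.
      by apply: mulr_ge0; [exact: sqr_ge0|exact: mulr_ge0].
    by apply: eq_integral => a _; rewrite cons_rVK gauss_cons /=; congr EFin; ring.
  rewrite /A -!ge0_integralZlr//; try exact: mulr_ge0; last 2 first.
  - by move=> x; apply: mulr_ge0; [exact: sqr_ge0|exact: mulr_ge0].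
  - by move=> x; apply: mulr_ge0; [exact: sqr_ge0|exact: mulr_ge0].
  rewrite -ge0_integralDr; last 4 first.
  - exact: measurable_funM.
  - exact: measurable_funM.
  - by move=> x; apply: mulr_ge0; [exact: mulr_ge0|apply: mulr_ge0; [exact: sqr_ge0|exact: mulr_ge0]].
  - by move=> x; apply: mulr_ge0; [exact: mulr_ge0|apply: mulr_ge0; [exact: sqr_ge0|exact: mulr_ge0]].
  apply: ge0_le_integralr.
  - apply: measurable_funM; last exact: measurable_funM.
    by apply: measurable_funX; exact: measurable_funB.
  - by apply: measurable_funD; apply: measurable_funM.
  - by move=> x; exact: K0.
  - move=> x; rewrite gauss_cons.
    set u := f x; set v := f (cons_rV (b, (uncons_rV x).2)); set w := f (cons_rV (b, y)).
    have -> : c * gauss y * ((u - v) ^+ 2 * (gauss x * g1 b)) +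
        e * g1 b * ((w - v) ^+ 2 * (gauss y * gauss x)) =
        (c * (u - v) ^+ 2 + e * (w - v) ^+ 2) * (g1 b * gauss y * gauss x) by ring.
    apply: ler_wpM2r; first by apply: mulr_ge0 => //; exact: mulr_ge0.
    rewrite -subr_ge0.
    have -> : c * (u - v) ^+ 2 + e * (w - v) ^+ 2 - (w - u) ^+ 2 =
        (n.+1%:R * (u - v) + (w - v)) ^+ 2 / n.+1%:R.
      by rewrite /c /e -!natr1; field; rewrite natr1 pnatr_eq0.
    by rewrite divr_ge0// sqr_ge0.
pose DS b := (\int[lebesgue_rV n]_x ((\sum_j D (lift ord0 j) (cons_rV (b, x)) ^+ 2) * gauss x)%:E)%E.
have DS0 b : (0 <= DS b)%E.
  apply: integralr_ge0 => x; apply: mulr_ge0 => //.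
  by apply: sumr_ge0 => i _; exact: sqr_ge0.
have mp : measurable_fun setT (fun p : measurableTypeR R * 'rV[R]_n.+1 => cons_rV (p.1, (uncons_rV p.2).2)).
  apply: (measurableT_comp (@measurable_cons_rV R n)).
  apply: measurable_fun_pair => //=.
  exact: (measurableT_comp (@measurable_tail n) measurable_snd).
have mKA : measurable_fun setT (fun p : measurableTypeR R * 'rV[R]_n.+1 =>
   ((f p.2 - f (cons_rV (p.1, (uncons_rV p.2).2))) ^+ 2 * (gauss p.2 * g1 p.1))%:E).
  apply/measurable_EFinP; apply: measurable_funM.
    apply: measurable_funX; apply: measurable_funB.
      exact: (measurableT_comp mf measurable_snd).
    exact: (measurableT_comp mf mp).
  apply: measurable_funM.
    exact: (measurableT_comp mGS measurable_snd).
  exact: (measurableT_comp mg1 measurable_fst).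
have KA0 (p : measurableTypeR R * 'rV[R]_n.+1) :
   (0 <= ((f p.2 - f (cons_rV (p.1, (uncons_rV p.2).2))) ^+ 2 * (gauss p.2 * g1 p.1))%:E)%E.
  by rewrite lee_fin; apply: mulr_ge0; [exact: sqr_ge0|exact: mulr_ge0].
have mA : measurable_fun setT A.
  exact: (@measurable_fun_fubini_tonelli_F _ _ _ _ R (lebesgue_rV n.+1) _ mKA KA0).
have mSD : measurable_fun setT (fun x : 'rV[R]_n.+1 => (\sum_j D (lift ord0 j) x ^+ 2)).
  by apply: measurable_sum => j; exact: measurable_funX.
have SD0 x : 0 <= \sum_j D (lift ord0 j) x ^+ 2.
  by apply: sumr_ge0 => i _; exact: sqr_ge0.
have gDSE b : ((g1 b)%:E * DS b = \int[lebesgue_rV n]_x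
    ((\sum_j D (lift ord0 j) (cons_rV (b, x)) ^+ 2) * gauss (cons_rV (b, x)))%:E)%E.
  rewrite /DS -ge0_integralZlr//.
  - by apply: eq_integral => x _; rewrite gauss_cons mulrCA.
  - apply: measurable_funM => //.
    apply: (measurableT_comp mSD); apply: (measurableT_comp (@measurable_cons_rV R n)).
    exact: measurable_fun_pair.
  - by move=> x; exact: mulr_ge0.
have mSDG : measurable_fun setT (fun x => ((\sum_j D (lift ord0 j) x ^+ 2) * gauss x)%:E).
  by apply/measurable_EFinP; exact: measurable_funM.
have SDG0 x : (0 <= ((\sum_j D (lift ord0 j) x ^+ 2) * gauss x)%:E)%E.
  by rewrite lee_fin; exact: mulr_ge0.
have mgDS : measurable_fun setT (fun b => (g1 b)%:E * DS b)%E.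
  under eq_fun do rewrite gDSE.
  exact: (measurable_integral_consl mSDG SDG0).
(* The induction hypothesis on the slice with first coordinate [b] bounds the [B] term. *)
have mid b : (\int[lebesgue_rV n]_y ((c * gauss y)%:E * A b + (e * g1 b)%:E * (Z * B b y)) <=
   c%:E * (Z ^+ n * A b) +
   (c * (128 * t ^+ 2))%:E * (Z ^+ n.+1 * ((g1 b)%:E * DS b)))%E.
  rewrite ge0_integralD//; last 4 first.
  - by move=> y _; apply: mule_ge0 => //; rewrite lee_fin; exact: mulr_ge0.
  - by apply: emeasurable_funM => //; apply/measurable_EFinP; exact: measurable_funM.
  - by move=> y _; apply: mule_ge0; [rewrite lee_fin; exact: mulr_ge0|exact: mule_ge0].
  - by apply: emeasurable_funM => //; exact: emeasurable_funM.
  apply: leeD.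
    rewrite ge0_integralZr//; last 2 first.
    - by apply/measurable_EFinP; exact: measurable_funM.
    - by move=> y _; rewrite lee_fin; exact: mulr_ge0.
    by rewrite ge0_integralZlr// integral_gauss muleA.
  rewrite ge0_integralZl//; last 3 first.
  - exact: emeasurable_funM.
  - by move=> y _; exact: mule_ge0.
  - by rewrite lee_fin; exact: mulr_ge0.
  rewrite ge0_integralZl//.
  have := IHn (fun x => f (cons_rV (b, x))) (fun j x => D (lift ord0 j) (cons_rV (b, x))).
  move=> /(_ _ _ _)/wrap[].
  - by move=> x; apply: continuous_comp; [exact: continuous_cons_rV|exact: cf].
  - by move=> i x; apply: continuous_comp; [exact: continuous_cons_rV|exact: cD].
  - by move=> i; exact: is_partial_consS.
  rewrite -/(DS b) => IH.
  apply: (@le_trans _ _ ((e * g1 b)%:E * (Z * ((n.+1%:R * (128 * t ^+ 2))%:E * (Z ^+ n * DS b))))%E).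
    apply: lee_wpmul2l; first by rewrite lee_fin; exact: mulr_ge0.
    exact: lee_wpmul2l.
  rewrite (muleCA Z) (muleA Z) -expeS (muleCA _ (g1 b)%:E) !(muleA _%:E _%:E) -!EFinM.
  rewrite le_eqVlt; apply/orP; left; apply/eqP; congr (_%:E * _)%E.
  by rewrite /e /c; field; rewrite ?natr1 ?nat1r pnatr_eq0.
(* Exchanging the integrals fixes the tail, so the one-dimensional [pair_gauss1] applies on every
   line parallel to the first axis. *)
have HA : (\int[mu]_b A b <= (128 * t ^+ 2)%:E *
    (Z * \int[lebesgue_rV n.+1]_x (D ord0 x ^+ 2 * gauss x)%:E))%E.
  rewrite [leLHS](@fubini_tonelli _ _ _ _ R mu (lebesgue_rV n.+1) _ mKA KA0).
  have mGK := @measurable_fun_fubini_tonelli_G _ _ _ _ R mu _ mKA KA0.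
  have GK0 x : (0 <= fubini_G mu (fun p : measurableTypeR R * 'rV[R]_n.+1 =>
   ((f p.2 - f (cons_rV (p.1, (uncons_rV p.2).2))) ^+ 2 * (gauss p.2 * g1 p.1))%:E) x)%E.
    exact: integral_ge0.
  rewrite (integral_rV_consr mGK GK0).
  have mD0 : measurable_fun setT (fun x : 'rV[R]_n.+1 => (D ord0 x ^+ 2 * gauss x)%:E).
    by apply/measurable_EFinP; apply: measurable_funM => //; exact: measurable_funX.
  have D00 (x : 'rV[R]_n.+1) : (0 <= (D ord0 x ^+ 2 * gauss x)%:E)%E.
    by rewrite lee_fin; apply: mulr_ge0 => //; exact: sqr_ge0.
  rewrite integral_rV_consr// muleA -ge0_integralZl//; last 3 first.
  - exact: (measurable_integral_consr mD0 D00).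
  - by move=> x _; apply: integral_ge0.
  - by rewrite mule_ge0// lee_fin.
  apply: ge0_le_integral => //.
  - by move=> x _; do 2 apply: integral_ge0 => ? _.
  - exact: (measurable_integral_consr mGK GK0).
  - apply: emeasurable_funM => //; exact: (measurable_integral_consr mD0 D00).
  - move=> x _.
    pose h a := f (cons_rV (a, x)); pose h' a := D ord0 (cons_rV (a, x)).
    have ch : continuous h.
      by move=> a; apply: continuous_comp; [exact: continuous_cons_rVl|exact: cf].
    have ch' : continuous h'.
      by move=> a; apply: continuous_comp; [exact: continuous_cons_rVl|exact: cD].
    have mh : measurable_fun setT h by exact: continuous_measurable_fun.
    have mh' : measurable_fun setT h' by exact: continuous_measurable_fun.
    have mhb a : measurable_fun setT (fun b => (h a - h b) ^+ 2 * (g1 a * g1 b)).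
      apply: measurable_funM; last exact: measurable_funM.
      by apply: measurable_funX; exact: measurable_funB.
    have hb0 a b : 0 <= (h a - h b) ^+ 2 * (g1 a * g1 b).
      by apply: mulr_ge0; [exact: sqr_ge0|exact: mulr_ge0].
    rewrite [leLHS](_ : _ = ((gauss x)%:E * \int[mu]_a \int[mu]_b
        ((h a - h b) ^+ 2 * (g1 a * g1 b))%:E)%E); last first.
      rewrite -ge0_integralZl//; last 3 first.
      - have mp2 : measurable_fun setT (fun p : R * R => ((h p.1 - h p.2) ^+ 2 * (g1 p.1 * g1 p.2))%:E).
          apply/measurable_EFinP; apply: measurable_funM.
            apply: measurable_funX; apply: measurable_funB.
              exact: (measurableT_comp mh measurable_fst).
            exact: (measurableT_comp mh measurable_snd).
          apply: measurable_funM.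
            exact: (measurableT_comp mg1 measurable_fst).
          exact: (measurableT_comp mg1 measurable_snd).
        apply: (@measurable_fun_fubini_tonelli_F _ _ _ _ R mu _ mp2) => p.
        by rewrite lee_fin.
      - by move=> a _; exact: integralr_ge0.
      - by rewrite lee_fin.
      apply: eq_integral => a _; rewrite -ge0_integralZlr//.
      apply: eq_integral => b _.
      rewrite -[LHS]/(((f (cons_rV (a, x)) - f (cons_rV (b, (uncons_rV (cons_rV (a, x))).2))) ^+ 2 *
        (gauss (cons_rV (a, x)) * g1 b))%:E) cons_rVK gauss_cons.
      by congr EFin; rewrite /h; ring.
    rewrite [X in (_ <= _ * X)%E](_ : _ = ((gauss x)%:E * \int[mu]_a (h' a ^+ 2 * g1 a)%:E)%E); last first.
      rewrite -ge0_integralZlr//; last 2 first.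
      - by apply: measurable_funM => //; exact: measurable_funX.
      - by move=> a; apply: mulr_ge0 => //; exact: sqr_ge0.
      by apply: eq_integral => a _; rewrite gauss_cons; congr EFin; rewrite /h'; ring.
    rewrite muleCA lee_wpmul2l ?lee_fin// -muleA.
    apply: (pair_gauss1 t0) => // a; exact: (is_partial_cons0 a x (dD ord0)).
have HDS : (\int[mu]_b ((g1 b)%:E * DS b) =
   \int[lebesgue_rV n.+1]_x ((\sum_j D (lift ord0 j) x ^+ 2) * gauss x)%:E)%E.
  by rewrite integral_rV_consl//; apply: eq_integral => b _; rewrite gDSE.
have Phi0 x : (0 <= \int[lebesgue_rV n.+1]_y ((f x - f y) ^+ 2 * (gauss x * gauss y))%:E)%E.
  exact: integralr_ge0.
rewrite integral_rV_consl//; last exact: mKF.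
apply: (@le_trans _ _ (\int[mu]_b (c%:E * (Z ^+ n * A b) +
   (c * (128 * t ^+ 2))%:E * (Z ^+ n.+1 * ((g1 b)%:E * DS b))))%E).
  apply: ge0_le_integral => //.
  - by move=> b _; apply: integral_ge0.
  - by apply: (measurable_integral_consl (mKF _ _ mf)).
  - by apply: emeasurable_funD; apply: emeasurable_funM => //; exact: emeasurable_funM.
  - move=> b _; apply: le_trans (mid b); apply: ge0_le_integral => //.
    + have := measurableT_comp (mKF _ _ mf) (@measurable_cons_rV R n).
      by move/(measurableT_comp); apply; exact: measurable_fun_pair.
    + apply: emeasurable_funD; apply: emeasurable_funM => //.
        by apply/measurable_EFinP; exact: measurable_funM.
      exact: emeasurable_funM.
have cT0 : 0 <= c * (128 * t ^+ 2) by exact: mulr_ge0.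
have gDS0 b : (0 <= (g1 b)%:E * DS b)%E by apply: mule_ge0; rewrite ?lee_fin.
rewrite ge0_integralD//; last 4 first.
- by move=> b _; apply: mule_ge0; [rewrite lee_fin|exact: mule_ge0].
- by apply: emeasurable_funM => //; exact: emeasurable_funM.
- by move=> b _; apply: mule_ge0; [rewrite lee_fin|exact: mule_ge0].
- by apply: emeasurable_funM => //; exact: emeasurable_funM.
rewrite ge0_integralZl//; last 2 first.
- exact: emeasurable_funM.
- by move=> b _; exact: mule_ge0.
have -> : (\int[mu]_b (Z ^+ n * A b) = Z ^+ n * \int[mu]_b A b)%E.
  by rewrite ge0_integralZl.
have -> : (\int[mu]_b ((c * (128 * t ^+ 2))%:E * (Z ^+ n.+1 * ((g1 b)%:E * DS b))) =
   (c * (128 * t ^+ 2))%:E * (Z ^+ n.+1 * \int[mu]_b ((g1 b)%:E * DS b)))%E.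
  rewrite ge0_integralZl//; last 2 first.
  - exact: emeasurable_funM.
  - by move=> b _; exact: mule_ge0.
  by rewrite ge0_integralZl.
rewrite HDS.
rewrite [X in (_ <= _ * (_ * X))%E](_ : _ =
   ((\int[lebesgue_rV n.+1]_x (D ord0 x ^+ 2 * gauss x)%:E) +
   (\int[lebesgue_rV n.+1]_x ((\sum_j D (lift ord0 j) x ^+ 2) * gauss x)%:E))%E); last first.
  rewrite -ge0_integralDr; last 4 first.
  - by apply: measurable_funM => //; exact: measurable_funX.
  - exact: measurable_funM.
  - by move=> x; apply: mulr_ge0 => //; exact: sqr_ge0.
  - by move=> x; exact: mulr_ge0.
  by apply: eq_integral => x _; rewrite big_ord_recl mulrDl.
have I10 : (0 <= \int[lebesgue_rV n.+1]_x (D ord0 x ^+ 2 * gauss x)%:E)%E.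
  by apply: integralr_ge0 => x; apply: mulr_ge0 => //; exact: sqr_ge0.
have I20 : (0 <= \int[lebesgue_rV n.+1]_x ((\sum_j D (lift ord0 j) x ^+ 2) * gauss x)%:E)%E.
  exact: integral_ge0.
set I1 := (X in (_ <= _ * (_ * (X + _)))%E) in I10 *; set I2 := (X in (_ <= _ * (_ * (_ + X)))%E) in I20 *.
rewrite (@ge0_muleDr _ (Z ^+ n.+1)%E I1 I2 I10 I20).
rewrite (@ge0_muleDr _ _ (Z ^+ n.+1 * I1)%E (Z ^+ n.+1 * I2)%E); [|exact: mule_ge0|exact: mule_ge0].
apply: leeD => //.
apply: (@le_trans _ _ (c%:E * (Z ^+ n * ((128 * t ^+ 2)%:E *
    (Z * \int[lebesgue_rV n.+1]_x (D ord0 x ^+ 2 * gauss x)%:E))))%E).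
  by apply: lee_wpmul2l; [rewrite lee_fin|exact: lee_wpmul2l].
rewrite (muleCA (Z ^+ n)%E) (muleA (Z ^+ n)%E) (muleC (Z ^+ n)%E Z) -expeS (muleA c%:E) -EFinM.
by [].
Qed.

End gaussian_tensor.

(** * The Lyapunov field *)
Section scalar_lyapunov.
Context {R : realType}.

(** Young's inequality for x and 1 with exponents s and s / (s - 1). *)
Lemma bernoulli_powR (s x : R) : 1 <= s -> 0 <= x -> 1 + s * (x - 1) <= x `^ s.
Proof.
move=> s1 x0; have [->|sn1] := eqVneq s 1; first by rewrite powRr1//; lra.
have s0 : 0 < s by lra.
have sgt1 : 1 < s by rewrite lt_neqAle eq_sym sn1.
have c0 : 0 < s / (s - 1) by rewrite divr_gt0// subr_gt0.
have conj : s^-1 + (s / (s - 1))^-1 = 1 by field; rewrite subr_eq0 sn1 gt_eqF.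
have := conjugate_powR x0 ler01 s0 c0 conj.
rewrite powR1 mulr1 invf_div mul1r.
have -> : (s - 1) / s = 1 - s^-1 by field; rewrite gt_eqF.
move=> H; have := ler_wpM2r (ltW s0) H.
have -> : (x `^ s / s + (1 - s^-1)) * s = x `^ s + s - 1 by field; rewrite gt_eqF.
lra.
Qed.

(** Bernoulli at x^-1, multiplied by x^s. *)
Lemma powR_sub1_le (s x : R) : 1 <= s -> 0 < x ->
  x `^ s - 1 <= s * x `^ (s - 1) * (x - 1).
Proof.
move=> s1 x0.
have := @bernoulli_powR s x^-1 s1 (ltW (_ : 0 < x^-1)); rewrite invr_gt0 => /(_ x0).
have xs0 : 0 < x `^ s by exact: powR_gt0.
have xs1E : x `^ (s - 1) = x `^ s / x by rewrite powRB ?powRr1 ?(ltW x0)// (gt_eqF x0) implybT.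
have -> : x^-1 `^ s = (x `^ s)^-1 by rewrite -(powR_inv1 (ltW x0)) -powRrM mulN1r powRN.
rewrite -(ler_pM2l xs0) mulfV ?gt_eqF// xs1E => H.
have : x `^ s * (1 + s * (x^-1 - 1)) = x `^ s - s * (x `^ s / x) * (x - 1).
  by field; rewrite gt_eqF.
by move: H => /[swap] ->; lra.
Qed.

(** Here m is V and v is |x|^2 / (1 + |x|^2), so m (1 - v) <= 1; the left side is half the drift of
    the field, relative to [exp (- V)]. Writing z (m0 - m v) = - z^2 + z m (1 - v) shows that the
    first fraction is close to -1 once z^2 dominates [m0], and the second is then nonpositive. *)
Lemma lyapunov_far (m m0 v : R) : 1 <= m0 -> 0 <= m -> 0 <= v <= 1 -> m * (1 - v) <= 1 ->
  let z := m - m0 in 16 * m0 <= z ^+ 2 ->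
  z * (m0 - m * v) / (m0 + z ^+ 2) + m * v * (m0 - z ^+ 2) / (m0 + z ^+ 2) ^+ 2 <= - 2^-1.
Proof.
move=> m01 m_ge0 /andP[v0 v1] ms z zm.
have q0 : 0 < m0 + z ^+ 2 by rewrite ltr_pwDl ?sqr_ge0//; lra.
have T2 : m * v * (m0 - z ^+ 2) / (m0 + z ^+ 2) ^+ 2 <= 0.
  rewrite mulr_le0_ge0 ?invr_ge0 ?exprn_ge0 ?(ltW q0)// mulr_ge0_le0 ?mulr_ge0//; lra.
have T1 : z * (m0 - m * v) / (m0 + z ^+ 2) <= - 2^-1.
  rewrite ler_pdivrMr//.
  have -> : z * (m0 - m * v) = - z ^+ 2 + z * (m * (1 - v)) by rewrite /z; ring.
  have s0 : 0 <= m * (1 - v) by rewrite mulr_ge0//; lra.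
  set s := m * (1 - v) in ms s0 *.
  suff : z * s <= z ^+ 2 / 4 by lra.
  have [z0|z0] := leP 0 z.
    have z4 : 4 <= z by rewrite -(@ler_pXn2r _ 2) ?nnegrE//; lra.
    nra.
  have := sqr_ge0 z; nra.
lra.
Qed.

(** Inside the window m <= 5 m0, so the second fraction is at most 5 and the first at most 1/2. *)
Lemma lyapunov_near (m m0 v : R) : 1 <= m0 -> 0 <= m -> 0 <= v <= 1 -> m * (1 - v) <= 1 ->
  let z := m - m0 in z ^+ 2 <= 16 * m0 ->
  z * (m0 - m * v) / (m0 + z ^+ 2) + m * v * (m0 - z ^+ 2) / (m0 + z ^+ 2) ^+ 2 <= 11 / 2.
Proof.
move=> m01 m_ge0 /andP[v0 v1] ms z zm.
have z20 := sqr_ge0 z.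
have q0 : 0 < m0 + z ^+ 2 by lra.
have m5 : m <= 5 * m0.
  have : z <= 4 * m0.
    have [z0|z0] := leP 0 z; last by lra.
    rewrite -(@ler_pXn2r _ 2) ?nnegrE//; last by lra.
    rewrite exprMn; have : m0 <= m0 ^+ 2 by rewrite expr2 ler_peMl//; lra.
    lra.
  by rewrite /z; lra.
have T1 : z * (m0 - m * v) / (m0 + z ^+ 2) <= 2^-1.
  rewrite ler_pdivrMr//.
  have -> : z * (m0 - m * v) = - z ^+ 2 + z * (m * (1 - v)) by rewrite /z; ring.
  have s0 : 0 <= m * (1 - v) by rewrite mulr_ge0//; lra.
  set s := m * (1 - v) in ms s0 *.
  have := sqr_ge0 (z - s); nra.
have T2 : m * v * (m0 - z ^+ 2) / (m0 + z ^+ 2) ^+ 2 <= 5.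
  rewrite ler_pdivrMr ?exprn_gt0//.
  have mv : m * v <= 5 * m0 by nra.
  have mv0 : 0 <= m * v by rewrite mulr_ge0.
  have [h|h] := leP 0 (m0 - z ^+ 2).
    apply: (@le_trans _ _ (5 * m0 * m0)); first by nra.
    rewrite -mulrA ler_pM2l// sqrrD; have := sqr_ge0 (z ^+ 2); nra.
  apply: (@le_trans _ _ 0); first by nra.
  by rewrite mulr_ge0// sqr_ge0.
lra.
Qed.

(* [m0 * q] plays the role of [V], [u0 * q ^ s] that of [1 + |x|^2]. *)
Lemma gauss_window (s m0 q : R) : 2 <= s -> 1 <= m0 -> 0 < q -> (q - 1) ^+ 2 * m0 <= 16 ->
  m0 * (s^-1 * (q `^ s - 1) - (q - 1)) <= 16 * ((s - 1) * 5 `^ s).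
Proof.
move=> s2 m01 q0 qm.
have q5 : q <= 5.
  have : (q - 1) ^+ 2 <= 4 ^+ 2.
    have : (q - 1) ^+ 2 <= (q - 1) ^+ 2 * m0 by rewrite ler_peMr// sqr_ge0.
    lra.
  have := sqr_ge0 (q - 5); nra.
(* The left side of the goal vanishes to second order at q = 1. Bounding it by a multiple of (q -
   1)^2 lets the window condition cancel the prefactor [m0], and the result is free of the
   dimension. *)
have D1 : s^-1 * (q `^ s - 1) - (q - 1) <= (q `^ (s - 1) - 1) * (q - 1).
  have := @powR_sub1_le s q (_ : 1 <= s) q0; move=> /(_ ltac:(lra)) H.
  have si0 : 0 <= s^-1 by rewrite invr_ge0; lra.
  have := ler_wpM2l si0 H; rewrite -mulrA mulKf; last by apply/eqP; lra.
  lra.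
have P1 : 1 <= 5 `^ s :> R by rewrite -[leLHS](powRr0 5) ler_powR//; lra.
have D2 : (q `^ (s - 1) - 1) * (q - 1) <= (s - 1) * 5 `^ s * (q - 1) ^+ 2.
  have [q1|q1] := leP 1 q.
    have H : q `^ (s - 1) - 1 <= (s - 1) * 5 `^ s * (q - 1).
      apply: le_trans (powR_sub1_le _ q0) _; first by lra.
      apply: ler_wpM2r; first by lra.
      apply: ler_wpM2l; first by lra.
      apply: (@le_trans _ _ (5 `^ (s - 1 - 1))).
        by apply: ge0_ler_powR; rewrite ?nnegrE//; lra.
      by apply: ler_powR; lra.
    by rewrite expr2 mulrA; apply: ler_wpM2r => //; lra.
  have H : 1 - q `^ (s - 1) <= (s - 1) * (1 - q).
    by have := @bernoulli_powR (s - 1) q ltac:(lra) (ltW q0); lra.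
  have -> : (q `^ (s - 1) - 1) * (q - 1) = (1 - q `^ (s - 1)) * (1 - q) by ring.
  apply: (@le_trans _ _ ((s - 1) * (1 - q) * (1 - q))); first by apply: ler_wpM2r => //; lra.
  have -> : (s - 1) * (1 - q) * (1 - q) = (s - 1) * (1 - q) ^+ 2 * 1 by ring.
  have -> : (s - 1) * 5 `^ s * (q - 1) ^+ 2 = (s - 1) * (1 - q) ^+ 2 * 5 `^ s by ring.
  by apply: ler_wpM2l => //; rewrite mulr_ge0 ?sqr_ge0//; lra.
have k0 : 0 <= (s - 1) * 5 `^ s by rewrite mulr_ge0 ?powR_ge0//; lra.
apply: (@le_trans _ _ (m0 * ((s - 1) * 5 `^ s * (q - 1) ^+ 2))).
  by apply: ler_wpM2l; [lra|exact: le_trans D1 D2].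
rewrite mulrCA mulrC (mulrC m0); exact: ler_wpM2r.
Qed.

End scalar_lyapunov.

(** * The divergence inequality for radial fields *)

Section radial_fields.
Context {R : realType}.

Definition sqnorm n (x : 'rV[R]_n) : R := \sum_i x ord0 i ^+ 2.

Lemma sqnorm_ge0 n (x : 'rV[R]_n) : 0 <= sqnorm x.
Proof. by apply: sumr_ge0 => i _; exact: sqr_ge0. Qed.

Lemma sqnorm_ge_coord n (x : 'rV[R]_n) i : x ord0 i ^+ 2 <= sqnorm x.
Proof. by rewrite /sqnorm (bigD1 i)//= lerDl sumr_ge0// => j _; exact: sqr_ge0. Qed.

Lemma continuous_sqnorm n : continuous (@sqnorm n).
Proof.
by apply: fun_continuous_sum => i; apply: fun_continuousX; exact: coord_continuous.
Qed.

Lemma coord_line n (x : 'rV[R]_n) i s j :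
  (x + s *: delta_mx ord0 i) ord0 j = x ord0 j + s * (j == i)%:R.
Proof. by rewrite !mxE eqxx. Qed.

Lemma sqnorm_line n (x : 'rV[R]_n) i s :
  sqnorm (x + s *: delta_mx ord0 i) = sqnorm x + 2 * s * x ord0 i + s ^+ 2.
Proof.
rewrite /sqnorm (bigD1 i)//= [in RHS](bigD1 i)//= coord_line eqxx.
under eq_bigr => j ji do rewrite coord_line (negbTE ji) mulr0 addr0.
rewrite mulr1n; ring.
Qed.

(** The field is g^2 P(1 + |x|^2) x. On a face of the cube 1 + |x|^2 >= 1 + N^2, so the sign of [P]
    beyond that value makes it point outwards; inside, [P] may be negative. *)
Lemma radial_divergence_le n (N : R) (g : 'rV[R]_n -> R) (D : 'I_n -> 'rV[R]_n -> R)
    (P P' : R -> R) (A B : 'rV[R]_n -> R) :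
  0 < N -> continuous g -> (forall i, continuous (D i)) ->
  (forall i, is_partial i g (D i)) ->
  (forall u : R, 1 <= u -> is_derive u (1 : R) P (P' u)) ->
  (forall u : R, 1 <= u -> {for u, continuous P'}) ->
  (forall u : R, 1 + N ^+ 2 <= u -> 0 <= P u) ->
  measurable_fun setT A -> measurable_fun setT B ->
  (forall x, 0 <= A x) -> (forall x, 0 <= B x) ->
  (forall x, boxb N x ->
    2 * g x * P (1 + sqnorm x) * (\sum_i x ord0 i * D i x) +
    g x ^+ 2 * (n%:R * P (1 + sqnorm x) + 2 * sqnorm x * P' (1 + sqnorm x)) + A x <= B x) ->
  (\int[lebesgue_rV n]_x (A x * (boxb N x)%:R)%:E <=
   \int[lebesgue_rV n]_x (B x * (boxb N x)%:R)%:E)%E.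
Proof.
move=> N0 cg cD dg dP cP' P0 mA mB A0 B0 HAB.
pose u (x : 'rV[R]_n) := 1 + sqnorm x.
have u1 x : 1 <= u x by rewrite lerDl sqnorm_ge0.
have cu : continuous u.
  by apply: fun_continuousD; [exact: cst_continuous|exact: continuous_sqnorm].
have cP : continuous (fun x => P (u x)).
  move=> x; apply: continuous_comp; first exact: cu.
  by apply/differentiable_continuous/derivable1_diffP; case: (dP _ (u1 x)).
have cPu' : continuous (fun x => P' (u x)).
  by move=> x; apply: continuous_comp; [exact: cu|exact: cP'].
have cx i : continuous (fun x : 'rV[R]_n => x ord0 i) by exact: coord_continuous.
pose H i x := g x ^+ 2 * P (u x) * x ord0 i.
pose H' i x := 2 * g x * P (u x) * (x ord0 i * D i x) +
  g x ^+ 2 * (P (u x) + 2 * x ord0 i ^+ 2 * P' (u x)).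
have bnd (x : 'rV[R]_n) i : `|x ord0 i| = N -> 1 + N ^+ 2 <= u x.
  by move=> xi; rewrite lerD2l -xi real_normK ?num_real// sqnorm_ge_coord.
apply: (@box_divergence_le R n N H H') => //.
- move=> i; apply: fun_continuousD; apply: fun_continuousM.
  + apply: fun_continuousM => //; apply: fun_continuousM => //; exact: cst_continuous.
  + exact: fun_continuousM.
  + exact: fun_continuousX.
  + apply: fun_continuousD => //; apply: fun_continuousM => //; apply: fun_continuousM.
      exact: cst_continuous.
    exact: fun_continuousX.
- move=> i x.
  have d1 := dg i x.
  have d2 : is_derive (0 : R) (1 : R) (fun s => u (x + s *: delta_mx ord0 i)) (2 * x ord0 i).
    have d2a : is_derive (0 : R) (1 : R) (cst (u x) + (2 * x ord0 i) \*: id) (2 * x ord0 i).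
      by apply: is_derive_eq; rewrite add0r -[LHS]/(_ * 1) mulr1.
    have d2b : is_derive (0 : R) (1 : R) ((id : R -> R) ^+ 2) 0.
      apply: is_derive_eq (is_deriveX 2 (is_derive_id (0 : R) 1)) _.
      by rewrite -[LHS]/(2%:R * 0 ^+ 1 * 1); ring.
    rewrite (_ : (fun s => _) = cst (u x) + (2 * x ord0 i) \*: id + (id : R -> R) ^+ 2); last first.
      apply/funext => s; rewrite /u sqnorm_line.
      rewrite -[RHS]/(1 + sqnorm x + 2 * x ord0 i * s + s ^+ 2); ring.
    by apply: is_derive_eq (is_deriveD d2a d2b) _; rewrite addr0.
  have d3 : is_derive (0 : R) (1 : R) (fun s => P (u (x + s *: delta_mx ord0 i))) (P' (u x) * (2 * x ord0 i)).
    apply: (is_derive1_comp _ d2).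
    by rewrite scale0r addr0; exact: dP.
  have d4 : is_derive (0 : R) (1 : R) (fun s : R => (x + s *: delta_mx ord0 i) ord0 i) 1.
    rewrite (_ : (fun s => _) = cst (x ord0 i) + id); last first.
      by apply/funext => s; rewrite coord_line eqxx mulr1.
    by apply: is_derive_eq; rewrite add0r.
  rewrite /H (_ : (fun s => _) = ((fun s => g (x + s *: delta_mx ord0 i)) ^+ 2 *
      (fun s => P (u (x + s *: delta_mx ord0 i)))) * (fun s : R => (x + s *: delta_mx ord0 i) ord0 i)); last by [].
  apply: is_derive_eq.
  rewrite -[LHS]/((g (x + 0 *: delta_mx ord0 i) ^+ 2 * P (u (x + 0 *: delta_mx ord0 i))) * 1 +
     (x + 0 *: delta_mx ord0 i) ord0 i * (g (x + 0 *: delta_mx ord0 i) ^+ 2 * (P' (u x) * (2 * x ord0 i)) +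
       P (u (x + 0 *: delta_mx ord0 i)) * ((2%:R * g (x + 0 *: delta_mx ord0 i) ^+ 1) * D i x))).
  by rewrite scale0r addr0 /H'; ring.
- move=> i x xN xi; rewrite /H xi mulr_ge0 ?(ltW N0)// mulr_ge0 ?sqr_ge0// P0//.
  by apply: (bnd x i); rewrite xi gtr0_norm.
- move=> i x xN xi; rewrite /H xi mulr_ge0_le0 ?oppr_le0 ?(ltW N0)// mulr_ge0 ?sqr_ge0// P0//.
  by apply: (bnd x i); rewrite xi normrN gtr0_norm.
- move=> x xN; apply: le_trans (HAB x xN); rewrite lerD2r /H' big_split /=.
  rewrite -!mulr_sumr lerD2l big_split /= sumr_const card_ord.
  by rewrite -mulr_suml -mulr_sumr (mulr_natl (P _) n).
Qed.

End radial_fields.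
Section lyapunov_field.
Context {R : realType}.
Variables (alpha : R) (n : nat).
Hypotheses (alpha0 : 0 < alpha) (alpha1 : alpha < 1) (n0 : (0 < n)%N).

Local Notation s := (2 / alpha).
Local Notation m0 := (n%:R / alpha).
Local Notation u0 := (m0 `^ s).

Definition potential (u : R) : R := u `^ (alpha / 2).
Local Notation m := potential.

(** The exponent is minus the tangent line of u^(alpha/2) at [u0], whose value there is [m0] and
    whose slope is s^-1 m0 / u0. *)
Definition ghat (x : 'rV[R]_n) : R :=
  expR (- m0 - s^-1 * m0 * ((1 + sqnorm x) / u0 - 1)).

(* The radial coefficient of X exp (- V) as a function of w = V. *)
Definition lyap_coef (w : R) : R := s * (w - m0) / (m0 + (w - m0) ^+ 2) * expR (- w).

Definition lyap_coef' (w : R) : R :=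
  s * ((m0 - (w - m0) ^+ 2) / (m0 + (w - m0) ^+ 2) ^+ 2 -
       (w - m0) / (m0 + (w - m0) ^+ 2)) * expR (- w).

Lemma params_bounds : [/\ 0 < alpha, alpha < 1, 2 <= s, 1 <= m0 & 0 < m0].
Proof.
have a1 := alpha1.
have m01 : 1 <= m0.
  rewrite ler_pdivlMr// mul1r (le_trans (ltW alpha1))//.
  by rewrite -[leLHS]/(1%:R) ler_nat.
by split => //; [rewrite ler_pdivlMr//; lra|lra].
Qed.

Lemma m0_gt0 : 0 < m0. Proof. by have [] := params_bounds. Qed.

Lemma den_gt0 w : 0 < m0 + (w - m0) ^+ 2.
Proof. by rewrite ltr_pwDl ?sqr_ge0 ?m0_gt0. Qed.

Lemma is_derive_lyap_coef w : is_derive w (1 : R) lyap_coef (lyap_coef' w).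
Proof.
have q0 := den_gt0 w.
have dz : is_derive w (1 : R) (fun w => w - m0) 1.
  by rewrite (_ : (fun w => _) = id - cst m0)//; apply: is_derive_eq; rewrite subr0.
have dq : is_derive w (1 : R) (fun w => m0 + (w - m0) ^+ 2) (2 * (w - m0)).
  rewrite (_ : (fun w => _) = cst m0 + (fun w => w - m0) ^+ 2); last by [].
  apply: is_derive_eq (is_deriveD (is_derive_cst m0 w 1) (is_deriveX 2 dz)) _.
  rewrite -[LHS]/(0 + 2%:R * (w - m0) ^+ 1 * 1).
  by ring.
have dqV : is_derive w (1 : R) (fun w => (m0 + (w - m0) ^+ 2)^-1)
    (- (m0 + (w - m0) ^+ 2) ^- 2 * (2 * (w - m0))).
  have qn0 : (fun w => m0 + (w - m0) ^+ 2) w != 0 by rewrite gt_eqF.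
  exact: (@is_deriveV R (fun w => m0 + (w - m0) ^+ 2) w _ _ qn0 dq).
have dN : is_derive w (1 : R) (fun w => - w) (-1) by exact: is_deriveNid.
have de : is_derive w (1 : R) (fun w => expR (- w)) (expR (- w) * -1).
  exact: (is_derive1_comp (is_derive_expR _) dN).
rewrite (_ : lyap_coef = s \*: ((fun w => w - m0) * (fun w => (m0 + (w - m0) ^+ 2)^-1)) *
    (fun w => expR (- w))); last first.
  by apply/funext => v; rewrite /lyap_coef -[RHS]/(s * ((v - m0) * _) * _) !mulrA.
apply: is_derive_eq.
rewrite -[LHS]/((s * ((w - m0) * (m0 + (w - m0) ^+ 2)^-1)) * (expR (- w) * -1) +
  expR (- w) * (s * ((w - m0) * (- (m0 + (w - m0) ^+ 2) ^- 2 * (2 * (w - m0))) +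
    (m0 + (w - m0) ^+ 2)^-1 * 1))).
rewrite /lyap_coef'; move: q0; set q := m0 + _; set z := w - m0 => q0.
have -> : m0 = q - z ^+ 2 by rewrite /q /z; ring.
by move: (expR _) => E; field; rewrite !gt_eqF.
Qed.

Lemma is_derive_potential (u : R) : 0 < u -> is_derive u (1 : R) m (alpha / 2 * u `^ (alpha / 2 - 1)).
Proof. by move=> ?; exact: is_derive1_powR. Qed.

Definition lyap_prof u := lyap_coef (m u).
Definition lyap_prof' u := lyap_coef' (m u) * (alpha / 2 * u `^ (alpha / 2 - 1)).

Lemma is_derive_lyap_prof (u : R) : 1 <= u -> is_derive u (1 : R) lyap_prof (lyap_prof' u).
Proof.
move=> u1; have up : 0 < u by lra.
exact: (is_derive1_comp (is_derive_lyap_coef _) (is_derive_potential up)).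
Qed.

Lemma is_derive_continuous_at (f : R -> R) x l : is_derive x (1 : R) f l -> {for x, continuous f}.
Proof. by move=> [df _]; apply/differentiable_continuous/derivable1_diffP. Qed.

Lemma continuous_lyap_coef' : continuous lyap_coef'.
Proof.
have cid : continuous (fun x : R => x) by move=> x; exact: cvg_id.
have cz : continuous (fun w : R => w - m0) by apply: fun_continuousD => //; exact: cst_continuous.
have cz2 : continuous (fun w : R => (w - m0) ^+ 2) by exact: fun_continuousX.
have cq : continuous (fun w : R => m0 + (w - m0) ^+ 2).
  by apply: fun_continuousD => //; exact: cst_continuous.
have cV (f : R -> R) : continuous f -> (forall x, f x != 0) -> continuous (fun x => (f x)^-1).
  by move=> cf f0 x; apply: cvgV => //; exact: cf.
have qn0 w : m0 + (w - m0) ^+ 2 != 0 by rewrite gt_eqF// den_gt0.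
apply: fun_continuousM; last first.
  by apply: (@fun_continuous_comp R _ expR (fun w => - w)); [exact: continuous_expR|exact: fun_continuousN].
apply: fun_continuousM; first exact: cst_continuous.
apply: fun_continuousD.
  apply: fun_continuousM.
    by apply: fun_continuousD; [exact: cst_continuous|exact: fun_continuousN].
  apply: cV; first exact: fun_continuousX.
  by move=> w; rewrite expf_neq0.
by apply: fun_continuousN; apply: fun_continuousM => //; exact: cV.
Qed.

Lemma continuous_lyap_prof' (u : R) : 1 <= u -> {for u, continuous lyap_prof'}.
Proof.
move=> u1; have up : 0 < u by lra.
apply: cvgM.
  apply: continuous_comp; last exact: continuous_lyap_coef'.
  exact: is_derive_continuous_at (is_derive_potential up).
apply: cvgM; first exact: cvg_cst.
exact: is_derive_continuous_at (is_derive1_powR _ up).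
Qed.

Lemma potential_ge1 (u : R) : 1 <= u -> 1 <= m u.
Proof.
by move=> u1; rewrite -[leLHS](powRr0 u) ler_powR// divr_ge0// ltW.
Qed.

Lemma potential_powR (u : R) : 0 <= u -> m u `^ s = u.
Proof.
move=> up; rewrite /potential -powRrM (_ : alpha / 2 * s = 1) ?powRr1//.
by field; rewrite gt_eqF.
Qed.

(** With q = V / m0 the exponent of [ghat] becomes - m0 - s^-1 m0 (q^s - 1). Bernoulli then gives
    [ghat_le], and [gauss_window] the reverse comparison near q = 1. *)
Lemma ratio_u0 (u : R) : 0 <= u -> u / u0 = (m u / m0) `^ s.
Proof.
move=> up; have [a0 a1 s2 m01 mm0] := params_bounds.
have q0 : 0 <= m u / m0 by rewrite divr_ge0 ?powR_ge0 ?(ltW mm0).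
have uE : u = (m u / m0) `^ s * u0.
  by rewrite -powRM ?(ltW mm0)// divfK ?(gt_eqF mm0)// potential_powR.
by rewrite {1}uE mulfK// gt_eqF// powR_gt0.
Qed.

Lemma ghat_le (x : 'rV[R]_n) : ghat x <= expR (- m (1 + sqnorm x)).
Proof.
have u1 : 1 <= 1 + sqnorm x by rewrite lerDl sqnorm_ge0.
have [a0 a1 s2 m01 mm0] := params_bounds.
rewrite ler_expR ratio_u0; last by lra.
have q0 : 0 <= m (1 + sqnorm x) / m0 by rewrite divr_ge0 ?powR_ge0// ltW.
have := @bernoulli_powR _ s _ (le_trans (_ : 1 <= 2) s2) q0.
move=> /(_ ltac:(lra)) H.
have k0 : 0 <= s^-1 * m0 by rewrite mulr_ge0 ?invr_ge0//; lra.
have {H} := ler_wpM2l k0 H.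
have -> : s^-1 * m0 * (1 + s * (m (1 + sqnorm x) / m0 - 1)) = s^-1 * m0 + m (1 + sqnorm x) - m0.
  by field; rewrite !gt_eqF// ltr0n.
lra.
Qed.

Definition window_cst : R := expR (16 * ((s - 1) * 5 `^ s)).

Lemma ghat_window (x : 'rV[R]_n) : (m (1 + sqnorm x) - m0) ^+ 2 <= 16 * m0 ->
  expR (- m (1 + sqnorm x)) <= window_cst * ghat x.
Proof.
move=> zm; have u1 : 1 <= 1 + sqnorm x by rewrite lerDl sqnorm_ge0.
have [a0 a1 s2 m01 mm0] := params_bounds; have m1 := potential_ge1 u1.
rewrite /window_cst -expRD ler_expR ratio_u0; last by lra.
set q := m (1 + sqnorm x) / m0.
have mE : m (1 + sqnorm x) = q * m0 by rewrite /q divfK ?gt_eqF.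
have q0 : 0 < q by rewrite divr_gt0//; lra.
have qm : (q - 1) ^+ 2 * m0 <= 16.
  rewrite -(ler_pM2r mm0); apply: le_trans zm; rewrite mE le_eqVlt; apply/orP; left; apply/eqP; ring.
have := gauss_window s2 m01 q0 qm; rewrite mE.
have -> : m0 * (s^-1 * (q `^ s - 1) - (q - 1)) = s^-1 * m0 * (q `^ s - 1) - m0 * (q - 1) by ring.
lra.
Qed.

(** The left side is the divergence of X exp (- V). Outside the window twice the bound -1/2 is
    enough; inside it the drift is at most 11 exp (- V), and one more unit is needed to keep - exp
    (- V), hence 12. *)
Lemma lyapunov_drift (x : 'rV[R]_n) :
  n%:R * lyap_prof (1 + sqnorm x) + 2 * sqnorm x * lyap_prof' (1 + sqnorm x) <=
  - expR (- m (1 + sqnorm x)) + 12 * window_cst * ghat x.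
Proof.
set u := 1 + sqnorm x; have w0 := sqnorm_ge0 x.
have u1 : 1 <= u by rewrite lerDl.
have up : 0 < u by lra.
have [a0 a1 s2 m01 mm0] := params_bounds; have m1 := potential_ge1 u1.
pose v := sqnorm x / u.
have v01 : 0 <= v <= 1.
  by rewrite /v divr_ge0 ?(ltW up)//= ler_pdivrMr// mul1r lerDr.
have mv : m u * (1 - v) <= 1.
  have -> : 1 - v = u^-1 by rewrite /v /u; field; rewrite gt_eqF.
  rewrite -/(_ / _) ler_pdivrMr// mul1r /potential -[leRHS](powRr1 (ltW up)).
  by apply: ler_powR => //; lra.
have q0 := den_gt0 (m u).
have E0 := expR_gt0 (- m u).
have G0 : 0 <= ghat x by exact: expR_ge0.
have W0 : 0 <= window_cst by exact: expR_ge0.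
have -> : n%:R * lyap_prof u + 2 * sqnorm x * lyap_prof' u =
  2 * ((m u - m0) * (m0 - m u * v) / (m0 + (m u - m0) ^+ 2) +
    m u * v * (m0 - (m u - m0) ^+ 2) / (m0 + (m u - m0) ^+ 2) ^+ 2) * expR (- m u).
  rewrite /lyap_prof /lyap_prof' /lyap_coef /lyap_coef'.
  have -> : u `^ (alpha / 2 - 1) = m u / u.
    by rewrite powRB ?powRr1 ?(ltW up)// (gt_eqF up) implybT.
  have -> : (n%:R : R) = alpha * m0 by field; rewrite gt_eqF.
  have -> : sqnorm x = v * u by rewrite /v divfK ?gt_eqF.
  have -> : alpha * m0 / alpha = m0 by field; rewrite gt_eqF.
  have key (E q z k M v' : R) : 0 < q ->
      alpha * k * (s * z / q * E) +
      2 * (v' * u) * (s * ((k - z ^+ 2) / q ^+ 2 - z / q) * E * (alpha / 2 * (M / u))) =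
      2 * (z * (k - M * v') / q + M * v' * (k - z ^+ 2) / q ^+ 2) * E.
    by move=> qp; field; rewrite !gt_eqF.
  exact: key.
have [far|near] := leP (16 * m0) ((m u - m0) ^+ 2).
  have := lyapunov_far m01 (le_trans ler01 m1) v01 mv far.
  set T := (X in X <= _) => HT.
  have : 0 <= 12 * window_cst * ghat x by rewrite !mulr_ge0.
  have := ler_wpM2r (ltW E0) HT; rewrite -/T; lra.
have := lyapunov_near m01 (le_trans ler01 m1) v01 mv (ltW near).
set T := (X in X <= _) => HT.
have := ghat_window (ltW near); rewrite -/u.
have := ler_wpM2r (ltW E0) HT; rewrite -/T; lra.
Qed.

Definition lyap_bound (U : R) : R :=
  s ^+ 2 * ((2 * m0) `^ s / (4 * m0) + 4 * U `^ (1 - alpha)).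

(** Bounds |X|^2. If V <= 2 m0, the coefficient squared is at most s^2 / (4 m0) by the
    arithmetic-geometric inequality, and u <= (2 m0)^s. If V > 2 m0, the coefficient is at most s /
    (V - m0) <= 2 s / V, and u / V^2 = u^(1 - alpha). *)
Lemma lyap_coef_bound (u U : R) : 1 <= u -> u <= U ->
  (s * (m u - m0) / (m0 + (m u - m0) ^+ 2)) ^+ 2 * u <= lyap_bound U.
Proof.
move=> u1 uU; have up : 0 < u by lra.
have [a0 a1 s2 m01 mm0] := params_bounds; have m1 := potential_ge1 u1.
have q0 := den_gt0 (m u).
rewrite /lyap_bound -mulrA exprMn -mulrA ler_pM2l ?exprn_gt0//; last by lra.
set z := m u - m0; set q := m0 + z ^+ 2.
have [mle|mgt] := leP (m u) (2 * m0).
  apply: (@le_trans _ _ ((2 * m0) `^ s / (4 * m0))); last first.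
    by rewrite lerDl mulr_ge0// powR_ge0.
  rewrite mulrC; apply: ler_pM => //.
  - exact: ltW.
  - exact: sqr_ge0.
  - rewrite -{1}(potential_powR (ltW up)); apply: ge0_ler_powR; rewrite ?nnegrE//; lra.
  - have m40 : 0 < 4 * m0 by lra.
    rewrite exprMn exprVn ler_pdivrMr ?exprn_gt0// mulrC ler_pdivlMr//.
    by rewrite /q; have := sqr_ge0 (m0 - z ^+ 2); lra.
apply: (@le_trans _ _ (4 * U `^ (1 - alpha))); last first.
  by rewrite lerDr divr_ge0 ?powR_ge0//; lra.
have zm : m u <= 2 * z by rewrite /z; lra.
have z0 : 0 < z by lra.
have uE : u `^ (1 - alpha) * m u ^+ 2 = u.
  rewrite -powR_mulrn ?powR_ge0// /potential -powRrM -powRD; last by rewrite (gt_eqF up) implybT.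
  by rewrite (_ : 1 - alpha + alpha / 2 * 2%:R = 1) ?powRr1 ?ltW//; field.
apply: (@le_trans _ _ (4 * u `^ (1 - alpha))); last first.
  by rewrite ler_pM2l// ge0_ler_powR ?nnegrE//; lra.
rewrite -[X in _ * X <= _]uE (mulrC 4) (mulrCA _ (u `^ (1 - alpha))).
apply: ler_wpM2l; first exact: powR_ge0.
rewrite exprMn exprVn mulrAC ler_pdivrMr ?exprn_gt0//.
have mz : m u ^+ 2 <= 4 * z ^+ 2.
  have -> : 4 * z ^+ 2 = (2 * z) ^+ 2 by ring.
  by rewrite ler_pXn2r ?nnegrE//; lra.
have zq : z ^+ 2 * z ^+ 2 <= q ^+ 2.
  rewrite -expr2 ler_pXn2r ?nnegrE ?sqr_ge0 ?(ltW q0)// /q; lra.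
have := sqr_ge0 z; nra.
Qed.

End lyapunov_field.

(** * The Lyapunov inequality on a cube and an exponential moment *)

Section box_estimates.
Context {R : realType}.
Variables (alpha : R) (n : nat).
Hypotheses (alpha0 : 0 < alpha) (alpha1 : alpha < 1) (n0 : (0 < n)%N).

Local Notation s := (2 / alpha).
Local Notation m0 := (n%:R / alpha).
Local Notation u0 := (m0 `^ s).
Local Notation m := (potential alpha).
Local Notation V := (@V_alpha R n alpha).
Local Notation ghat := (@ghat R alpha n).
Local Notation W := (window_cst alpha).

Lemma V_alphaE (x : 'rV[R]_n) : V x = m (1 + sqnorm x).
Proof. by rewrite /V_alpha sqr_enorm. Qed.

Lemma measurable_expV (k : R) : measurable_fun setT (fun x : 'rV[R]_n => expR (- (k * V x))).
Proof.
apply: (measurableT_comp (@measurable_expR R)); apply: measurable_funN.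
by apply: measurable_funM => //; exact: measurable_V_alpha.
Qed.

Lemma measurable_expNV : measurable_fun setT (fun x : 'rV[R]_n => expR (- V x)).
Proof. by have := measurable_expV 1; under eq_fun do rewrite mul1r. Qed.

(** Since s^-1 m0 = n / 2, the quadratic part of the exponent of [ghat] is |x|^2 / (2 t^2) with t^2
    = u0 / n. *)
Definition gauss_scale : R := Num.sqrt (u0 / n%:R).
Local Notation t := gauss_scale.

Definition ghat_cst : R := expR (- m0 - s^-1 * m0 * (u0^-1 - 1)).

Lemma u0_gt0 : 0 < u0.
Proof. by rewrite powR_gt0// divr_gt0// ltr0n. Qed.

Lemma gauss_scale_sqr : t ^+ 2 = u0 / n%:R.
Proof. by rewrite sqr_sqrtr// divr_ge0// ltW// u0_gt0. Qed.

Lemma gauss_scale_gt0 : 0 < t.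
Proof. by rewrite sqrtr_gt0 divr_gt0 ?u0_gt0// ltr0n. Qed.

Lemma ghatE x : ghat x = ghat_cst * gauss t x.
Proof.
rewrite /gauss /gauss1 -expR_sum -expRD; congr expR.
rewrite sumrN -mulr_suml -/(sqnorm x) gauss_scale_sqr.
have := u0_gt0; have nr0 : 0 < n%:R :> R by rewrite ltr0n.
move: (u0) (sqnorm x) => u w up.
by field; rewrite !gt_eqF.
Qed.

Lemma measurable_ghat : measurable_fun setT ghat.
Proof.
rewrite (_ : ghat = fun x => ghat_cst * gauss t x); last by apply/funext => x; exact: ghatE.
by apply: measurable_funM => //; exact: measurable_gauss gauss_scale_gt0 _.
Qed.

(** The divergence of g^2 X exp (- V) consists of the drift and the cross term 2 g <X, grad g> exp
    (- V). Cauchy-Schwarz absorbs the cross term into half of g^2 exp (- V), which doubles the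
    constants 12 and 2 into 24 and 4. *)
Lemma box_lyapunov (N : R) (g : 'rV[R]_n -> R) (D : 'I_n -> 'rV[R]_n -> R) :
  0 < N -> m0 <= m (1 + N ^+ 2) -> continuous g -> (forall i, continuous (D i)) ->
  (forall i, is_partial i g (D i)) ->
  (\int[lebesgue_rV n]_x (g x ^+ 2 * expR (- V x) * (boxb N x)%:R)%:E <=
   \int[lebesgue_rV n]_x ((24 * W * (g x ^+ 2 * ghat x) +
     4 * lyap_bound alpha n (1 + n%:R * N ^+ 2) * ((\sum_i D i x ^+ 2) * expR (- V x))) *
     (boxb N x)%:R)%:E)%E.
Proof.
move=> N0 mN cg cD dg.
have [a0 a1 s2 m01 mm0] := params_bounds alpha0 alpha1 n0.
set S := lyap_bound _ _ _.
have U1 : 1 <= 1 + n%:R * N ^+ 2 by rewrite lerDl mulr_ge0// sqr_ge0.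
have S0 : 0 < S.
  rewrite /S /lyap_bound mulr_gt0 ?exprn_gt0//; first by lra.
  rewrite ltr_wpDl// ?mulr_gt0 ?powR_gt0//; last by lra.
  by rewrite divr_ge0 ?powR_ge0//; lra.
have W0 : 0 < W by exact: expR_gt0.
pose A x := g x ^+ 2 * expR (- V x).
pose B x := 24 * W * (g x ^+ 2 * ghat x) + 4 * S * ((\sum_i D i x ^+ 2) * expR (- V x)).
have mg := measurable_continuous_rV cg.
have mD2 : measurable_fun setT (fun x => \sum_i D i x ^+ 2).
  by apply: measurable_sum => i; apply: measurable_funX; exact: measurable_continuous_rV.
have mV := measurable_expNV.
have mA : measurable_fun setT A by apply: measurable_funM => //; exact: measurable_funX.
have mB : measurable_fun setT B.
  apply: measurable_funD; apply: measurable_funM => //; apply: measurable_funM => //.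
    exact: measurable_funX.
  exact: measurable_ghat.
have D20 x : 0 <= \sum_i D i x ^+ 2 by apply: sumr_ge0 => i _; exact: sqr_ge0.
have G0 x : 0 <= ghat x by exact: expR_ge0.
have A0 x : 0 <= A x by rewrite mulr_ge0 ?sqr_ge0 ?expR_ge0.
have B0 x : 0 <= B x.
  rewrite /B addr_ge0//.
    by apply: mulr_ge0; [apply: mulr_ge0 => //; exact: ltW|apply: mulr_ge0 => //; exact: sqr_ge0].
  by apply: mulr_ge0; [apply: mulr_ge0 => //; exact: ltW|apply: mulr_ge0 => //; exact: expR_ge0].
have mb := @measurable_boxb R n N.
suff : (\int[lebesgue_rV n]_x (A x * (boxb N x)%:R)%:E <=
        \int[lebesgue_rV n]_x (B x * (boxb N x)%:R)%:E)%E by [].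
rewrite -(@lee_pmul2l _ (2^-1)%:E)// ?lte_fin//.
rewrite -!ge0_integralZlr//; last 4 first.
- exact: measurable_funM.
- by move=> x; rewrite mulr_ge0.
- exact: measurable_funM.
- by move=> x; rewrite mulr_ge0.
under eq_integral do rewrite mulrA.
under [X in (_ <= X)%E]eq_integral do rewrite mulrA.
apply: (@radial_divergence_le R n N g D (lyap_prof alpha n) (lyap_prof' alpha n)
   (fun x => 2^-1 * A x) (fun x => 2^-1 * B x)).
- exact: N0.
- exact: cg.
- exact: cD.
- exact: dg.
- by move=> u u1; exact: is_derive_lyap_prof.
- by move=> u u1; exact: continuous_lyap_prof'.
- move=> u uN; rewrite /lyap_prof /lyap_coef mulr_ge0 ?expR_ge0//.
  rewrite divr_ge0//; last by rewrite ltW// den_gt0.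
  rewrite mulr_ge0//; first by lra.
  rewrite subr_ge0 (le_trans mN)// /potential ge0_ler_powR ?nnegrE//.
  + by rewrite divr_ge0// ltW.
  + by rewrite addr_ge0// sqr_ge0.
  + by rewrite (le_trans _ uN)// addr_ge0// sqr_ge0.
- exact: measurable_funM.
- exact: measurable_funM.
- by move=> x; rewrite mulr_ge0.
- by move=> x; rewrite mulr_ge0.
move=> x xN; set u := 1 + sqnorm x.
have drift := lyapunov_drift alpha0 alpha1 n0 x.
have u1 : 1 <= u by rewrite lerDl sqnorm_ge0.
have uU : u <= 1 + n%:R * N ^+ 2.
  rewrite lerD2l /sqnorm -[n in n%:R]card_ord -sum1_card natr_sum mulr_suml.
  apply: ler_sum => i _; rewrite mul1r -real_normK ?num_real//.
  by rewrite ler_pXn2r ?nnegrE ?(ltW N0)//; exact: (forallP xN).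
have := lyap_coef_bound alpha0 alpha1 n0 u1 uU; rewrite -/S.
set a := s * (m u - m0) / _ => aS.
have aw : a ^+ 2 * sqnorm x <= S.
  by apply: le_trans aS; rewrite ler_wpM2l ?sqr_ge0// lerDr.
have PE : lyap_prof alpha n u = a * expR (- V x) by rewrite V_alphaE.
(* Cauchy-Schwarz as the nonnegativity of a sum of squares, with the weight 1 / (2 S) balanced by
   |X|^2 <= S. *)
have cs : 2 * g x * a * (\sum_i x ord0 i * D i x) <= 2^-1 * g x ^+ 2 + 2 * S * \sum_i D i x ^+ 2.
  have : 0 <= \sum_i (a * g x * x ord0 i / (2 * S) - D i x) ^+ 2.
    by apply: sumr_ge0 => i _; exact: sqr_ge0.
  under eq_bigr do rewrite sqrrB.
  rewrite big_split /= sumrB.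
  have -> : \sum_i (a * g x * x ord0 i / (2 * S)) ^+ 2 = (a ^+ 2 * sqnorm x) * g x ^+ 2 / (4 * S ^+ 2).
    rewrite /sqnorm mulr_sumr !mulr_suml; apply: eq_bigr => i _.
    by field; rewrite gt_eqF.
  have -> : \sum_i (a * g x * x ord0 i / (2 * S) * D i x *+ 2) = a * g x / S * (\sum_i x ord0 i * D i x).
    rewrite mulr_sumr; apply: eq_bigr => i _; rewrite -mulr_natl.
    by field; rewrite gt_eqF.
  move=> H.
  have : 0 <= 2 * S * (a ^+ 2 * sqnorm x * g x ^+ 2 / (4 * S ^+ 2) -
          a * g x / S * (\sum_i x ord0 i * D i x) + \sum_i D i x ^+ 2).
    by apply: mulr_ge0; [apply: mulr_ge0; [by []|exact: ltW]|exact: H].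
  have -> : 2 * S * (a ^+ 2 * sqnorm x * g x ^+ 2 / (4 * S ^+ 2) -
          a * g x / S * (\sum_i x ord0 i * D i x) + \sum_i D i x ^+ 2) =
     (a ^+ 2 * sqnorm x / S) * (2^-1 * g x ^+ 2) - 2 * g x * a * (\sum_i x ord0 i * D i x) +
      2 * S * \sum_i D i x ^+ 2.
    by field; rewrite gt_eqF.
  have : (a ^+ 2 * sqnorm x / S) * (2^-1 * g x ^+ 2) <= 2^-1 * g x ^+ 2.
    apply: ler_piMl; first by apply: mulr_ge0; [by []|exact: sqr_ge0].
    by rewrite (ler_pdivrMr _ _ S0) mul1r.
  move: (a ^+ 2 * sqnorm x / S) (\sum_i x ord0 i * D i x) (\sum_i D i x ^+ 2) => k X D2.
  lra.
have E0 := expR_ge0 (- V x).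
have {}cs := ler_wpM2r E0 cs.
have {}drift := ler_wpM2l (sqr_ge0 (g x)) drift.
rewrite -V_alphaE in drift.
move: drift cs; rewrite /A /B -/u PE.
move: (\sum_i x ord0 i * D i x) (\sum_i D i x ^+ 2) (expR _) (g x) (ghat x) (lyap_prof' _ _ _) => X D2 E G H P'.
lra.
Qed.

(** An exponential moment of V from the field exp (- V / 2) x, whose divergence is exp (- V / 2) (n
    - (alpha / 2) V |x|^2 / u). Where V >= 1 + 4 m0 this is at most - n exp (- V / 2); elsewhere exp
    (- V / 2) is at most exp ((1 + 4 m0) / 2) exp (- V). The common factor n explains the
    multiplication by n in the proof. *)
Lemma integral_half_potential :
  (\int[lebesgue_rV n]_x (expR (- (2^-1 * V x)))%:E <=
   (2 * expR ((1 + 4 * m0) / 2))%:E * \int[lebesgue_rV n]_x (expR (- V x))%:E)%E.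
Proof.
have [a0 a1 s2 m01 mm0] := params_bounds alpha0 alpha1 n0.
have nr0 : 0 < n%:R :> R by rewrite ltr0n.
set c := 2 * _.
have c0 : 0 <= c by rewrite mulr_ge0// expR_ge0.
have mV := measurable_expNV; have mV2 := measurable_expV (2^-1).
apply: (@le_integral_exhaustion _ _ R (lebesgue_rV n) (fun x => expR (- (2^-1 * V x)))
  (fun k x => boxb k.+1%:R x)) => //.
- by move=> k; exact: measurable_boxb.
- move=> x k l kl /forallP xk; apply/forallP => i; apply: le_trans (xk i) _.
  by rewrite ler_nat.
- move=> x; exists (Num.bound (sqnorm x)); apply/forallP => i.
  have B := archi_boundP (sqnorm_ge0 x).
  rewrite -(@ler_pXn2r _ 2) ?nnegrE// real_normK ?num_real//.
  apply: (le_trans (sqnorm_ge_coord x i)); apply: (le_trans (ltW B)).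
  by rewrite -natrX ler_nat (leq_trans (leqnSn _))// -{1}[(_).+1]expn1 leq_exp2l.
move=> k.
have mb := @measurable_boxb R n k.+1%:R.
apply: (@le_trans _ _ (\int[lebesgue_rV n]_x (c * expR (- V x) * (boxb k.+1%:R x)%:R)%:E)%E); last first.
  rewrite -ge0_integralZlr//.
  apply: ge0_le_integralr => //.
  - by apply: measurable_funM => //; exact: measurable_funM.
  - exact: measurable_funM.
  - by move=> x; rewrite !mulr_ge0 ?expR_ge0.
  - by move=> x; rewrite ler_piMr ?mulr_ge0 ?expR_ge0// lern1 leq_b1.
rewrite -(@lee_pmul2l _ (n%:R)%:E)// ?lte_fin//.
have mc : measurable_fun setT (fun x => c * expR (- V x) * (boxb k.+1%:R x)%:R).
  by apply: measurable_funM => //; exact: measurable_funM.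
have mh : measurable_fun setT (fun x => expR (- (2^-1 * V x)) * (boxb k.+1%:R x)%:R).
  exact: measurable_funM.
have gc x : 0 <= c * expR (- V x) * (boxb k.+1%:R x)%:R by rewrite !mulr_ge0 ?expR_ge0.
have gh x : 0 <= expR (- (2^-1 * V x)) * (boxb k.+1%:R x)%:R by rewrite !mulr_ge0 ?expR_ge0.
rewrite -!ge0_integralZlr//.
under eq_integral do rewrite mulrA.
under [X in (_ <= X)%E]eq_integral do rewrite mulrA.
pose P u := expR (- (2^-1 * m u)).
pose P' u := expR (- (2^-1 * m u)) * (- 2^-1 * (alpha / 2 * u `^ (alpha / 2 - 1))).
have dP (u : R) : 1 <= u -> is_derive u (1 : R) P (P' u).
  move=> u1; have up : 0 < u by lra.
  have dm := is_derive_potential alpha up.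
  have d2 : is_derive u (1 : R) (fun u => - (2^-1 * m u)) (- 2^-1 * (alpha / 2 * u `^ (alpha / 2 - 1))).
    rewrite (_ : (fun u => _) = (- 2^-1) \*: m); last first.
      by apply/funext => v; rewrite -[RHS]/(- 2^-1 * m v) mulNr.
    exact: is_deriveZ.
  exact: (is_derive1_comp (is_derive_expR _) d2).
apply: (@radial_divergence_le R n k.+1%:R (cst 1) (fun=> cst 0) P P'
   (fun x => n%:R * expR (- (2^-1 * V x))) (fun x => n%:R * (c * expR (- V x)))) => //.
- exact: cst_continuous.
- by move=> i; exact: cst_continuous.
- by move=> i x; exact: is_derive_cst.
- move=> u u1; have up : 0 < u by lra.
  apply: cvgM; first exact: (is_derive_continuous_at (dP _ u1)).
  apply: cvgM; first exact: cvg_cst.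
  apply: cvgM; first exact: cvg_cst.
  exact: is_derive_continuous_at (is_derive1_powR _ up).
- by move=> u _; exact: expR_ge0.
- exact: measurable_funM.
- by apply: measurable_funM => //; exact: measurable_funM.
- by move=> x; rewrite !mulr_ge0 ?expR_ge0.
move=> x xN; set u := 1 + sqnorm x.
have u1 : 1 <= u by rewrite lerDl sqnorm_ge0.
have up : 0 < u by lra.
have m1 := potential_ge1 alpha0 u1.
rewrite big1 ?mulr0 ?add0r; last by move=> i _; rewrite mulr0.
rewrite expr1n mul1r /P' -/(P u) V_alphaE -/u.
rewrite -/(P u).
have -> : u `^ (alpha / 2 - 1) = m u / u.
  by rewrite powRB ?powRr1 ?(ltW up)// (gt_eqF up) implybT.
have wE : sqnorm x / u = 1 - u^-1 by rewrite /u; field; rewrite gt_eqF.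
have -> : 2 * sqnorm x * (P u * (- 2^-1 * (alpha / 2 * (m u / u)))) =
    - (P u * (alpha / 2 * (m u * (sqnorm x / u)))) by field; rewrite gt_eqF.
have mu1 : m u / u <= 1.
  rewrite ler_pdivrMr// mul1r /potential -[leRHS](powRr1 (ltW up)).
  by apply: ler_powR => //; lra.
rewrite wE mulrBr mulr1.
have P0 : 0 < P u by exact: expR_gt0.
have -> : expR (- m u) = P u * P u by rewrite /P -expRD; congr expR; field.
have [far|near] := leP (1 + 4 * m0) (m u).
  have h1 : 2 * n%:R <= alpha / 2 * (m u - m u / u).
    have -> : 2 * n%:R = alpha / 2 * (4 * m0) by field; rewrite gt_eqF.
    by apply: ler_wpM2l; [rewrite divr_ge0// ltW|lra].
  have := ler_wpM2l (ltW P0) h1.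
  have : 0 <= n%:R * (c * (P u * P u)) by rewrite !mulr_ge0// ltW.
  lra.
have h1 : 0 <= P u * (alpha / 2 * (m u - m u / u)).
  by rewrite !mulr_ge0 ?(ltW P0)// ?invr_ge0// ?(ltW a0)//; lra.
have h2 : 2 <= c * P u.
  rewrite /c /P -mulrA -expRD; apply: ler_peMr => //; rewrite -[leLHS]expR0 ler_expR; lra.
have := ler_wpM2l (mulr_ge0 (ltW nr0) (ltW P0)) h2.
lra.
Qed.

End box_estimates.

(** * The inequality for Lebesgue integrals *)
Section combination.
Context {R : realType}.
Variables (alpha : R) (n : nat).
Hypotheses (alpha0 : 0 < alpha) (alpha1 : alpha < 1) (n0 : (0 < n)%N).

Local Notation m0 := (n%:R / alpha).
Local Notation m := (potential alpha).
Local Notation V := (@V_alpha R n alpha).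
Local Notation ghat := (@ghat R alpha n).
Local Notation W := (window_cst alpha).
Local Notation t := (gauss_scale alpha n).
Local Notation mu := (@lebesgue_measure R).

Lemma integral_gauss1_gt0 : (0 < \int[mu]_a (gauss1 t a)%:E)%E.
Proof.
have tp := gauss_scale_gt0 alpha0 n0.
have c0 : 0 < gauss1 t 1 by exact: expR_gt0.
apply: (@lt_le_trans _ _ (\int[mu]_a (gauss1 t 1 * segI 1 a)%:E)%E).
  rewrite ge0_integralZlr ?(ltW c0)//; last exact: measurable_norm_le.
  apply: mule_gt0; first by rewrite lte_fin.
  under eq_integral do rewrite -[X in X%:E]mul1r EFinM.
  rewrite (@integral_norm_le _ _ (cst 1%E)) // integral_cst//= mul1e.
  by rewrite lebesgue_measure_itv /= lte_fin ifT ?lte_fin -?EFinD ?lte_fin; lra.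
apply: ge0_le_integralr.
- by apply: measurable_funM => //; exact: measurable_norm_le.
- exact: measurable_gauss1.
- by move=> a; rewrite mulr_ge0// ltW.
- move=> a; rewrite /segI; case: (boolP (`|a| <= 1)) => a1; last by rewrite mulr0 gauss1_ge0.
  rewrite mulr1 ler_expR lerN2 ler_pM2r ?invr_gt0 ?mulr_gt0 ?exprn_gt0//.
  by rewrite expr1n -real_normK ?num_real// expr_le1.
Qed.

(** Finiteness is inherited from [exp (- V)] through [ghat_le]. Both bounds serve to cancel the
    Gaussian mass in [wpi_lebesgue]. *)
Lemma integral_gauss_bounds : (0 < \int[lebesgue_rV n]_x (gauss t x)%:E < +oo)%E.
Proof.
have tp := gauss_scale_gt0 alpha0 n0.
apply/andP; split.
  have := integral_gauss1_gt0; rewrite integral_gauss//.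
  move: (\int[mu]_a _)%E => Z Z0.
  suff : forall k, (0 < Z ^+ k)%E by exact.
  by elim=> [|k IHk]; [rewrite expe0|rewrite expeS; exact: mule_gt0].
have /andP[_] := gibbs_weight_V_alphaT n alpha0.
have k0 : 0 < ghat_cst alpha n by exact: expR_gt0.
have mG := @measurable_gauss R t tp n.
move=> Zoo; rewrite -(@lte_pmul2l _ (ghat_cst alpha n)%:E) ?lte_fin//.
rewrite mulry gtr0_sg// mul1e -ge0_integralZlr//; last 2 first.
- by move=> x; exact: gauss_ge0.
- exact: ltW.
apply: le_lt_trans Zoo; apply: ge0_le_integralr.
- exact: measurable_funM.
- exact: measurable_expNV.
- by move=> x; rewrite mulr_ge0 ?gauss_ge0// ltW.
- by move=> x; rewrite -ghatE//; apply: (le_trans (ghat_le alpha0 alpha1 n0 x)); rewrite -V_alphaE.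
Qed.

(** Chernoff bound: outside the cube V >= m (1 + N^2), so half of V is traded for this lower bound
    and the other half goes into the exponential moment. *)
Lemma tail_outside_box (N : R) : 0 < N ->
  (\int[lebesgue_rV n]_x (expR (- V x) * (~~ boxb N x)%:R)%:E <=
   (2 * expR ((1 + 4 * m0) / 2 - m (1 + N ^+ 2) / 2))%:E *
     \int[lebesgue_rV n]_x (expR (- V x))%:E)%E.
Proof.
move=> N0.
have mb : measurable_fun setT (fun x : 'rV[R]_n => (~~ boxb N x)%:R : R).
  rewrite (_ : (fun x => _) = (fun x => 1 - (boxb N x)%:R)); last first.
    by apply/funext => x; case: (boxb N x); rewrite /= ?subrr ?subr0.
  by apply: measurable_funB => //; exact: measurable_boxb.
apply: (@le_trans _ _ (\int[lebesgue_rV n]_x (expR (- (m (1 + N ^+ 2) / 2)) * expR (- (2^-1 * V x)))%:E)%E).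
  apply: ge0_le_integralr.
  - by apply: measurable_funM => //; exact: measurable_expNV.
  - by apply: measurable_funM => //; exact: measurable_expV.
  - by move=> x; rewrite mulr_ge0 ?expR_ge0.
  - move=> x; case: (boolP (boxb N x)) => [_|]; first by rewrite mulr0 mulr_ge0 ?expR_ge0.
    rewrite negb_forall => /existsP[i]; rewrite -ltNge => xi.
    rewrite mulr1 -expRD ler_expR.
    suff : m (1 + N ^+ 2) <= V x by lra.
    rewrite V_alphaE /potential ge0_ler_powR ?nnegrE//.
    + by rewrite divr_ge0// ltW.
    + by rewrite addr_ge0// sqr_ge0.
    + by rewrite addr_ge0// sqnorm_ge0.
    + rewrite lerD2l (le_trans _ (sqnorm_ge_coord x i))//.
      by rewrite -[leRHS]real_normK ?num_real// ler_pXn2r ?nnegrE//; exact: ltW.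
rewrite ge0_integralZlr//; [|exact: measurable_expV].
apply: le_trans (lee_wpmul2l _ (integral_half_potential alpha0 alpha1 n0)) _.
  by rewrite lee_fin expR_ge0.
rewrite muleA -EFinM le_eqVlt; apply/orP; left; apply/eqP; congr (_%:E * _)%E.
by rewrite mulrCA -expRD; congr (_ * expR _); ring.
Qed.

Definition gradient_cst (N : R) : R :=
  24 * W * (n.+1%:R * (128 * t ^+ 2)) + 4 * lyap_bound alpha n (1 + n%:R * N ^+ 2).

Definition tail_cst (N : R) : R := 2 * expR ((1 + 4 * m0) / 2 - m (1 + N ^+ 2) / 2).

(** In the application [v] is the total mass of [exp (- V)] times the variance, which lies below the
    second moment around any constant. The hypothesis can thus be asked for every centre [f y],
    which leaves [y] free to be averaged. *)
Lemma wpi_lebesgue (N O : R) (f : 'rV[R]_n -> R) (D : 'I_n -> 'rV[R]_n -> R) (v : \bar R) :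
  0 < N -> m0 <= m (1 + N ^+ 2) -> continuous f -> (forall i, continuous (D i)) ->
  (forall i, is_partial i f (D i)) -> (forall x y, `|f x - f y| <= O) -> (0 <= v)%E ->
  (forall y, v <= \int[lebesgue_rV n]_x ((f x - f y) ^+ 2 * expR (- V x))%:E)%E ->
  (v <= (gradient_cst N)%:E * \int[lebesgue_rV n]_x ((\sum_i D i x ^+ 2) * expR (- V x))%:E +
    (O ^+ 2 * tail_cst N)%:E * \int[lebesgue_rV n]_x (expR (- V x))%:E)%E.
Proof.
move=> N0 mN cf cD df fO v0 Hv.
have [a0 a1 s2 m01 mm0] := params_bounds alpha0 alpha1 n0.
have tp := gauss_scale_gt0 alpha0 n0.
have mf := measurable_continuous_rV cf.
have mD2 : measurable_fun setT (fun x => \sum_i D i x ^+ 2).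
  by apply: measurable_sum => i; apply: measurable_funX; exact: measurable_continuous_rV.
have D20 x : 0 <= \sum_i D i x ^+ 2 by apply: sumr_ge0 => i _; exact: sqr_ge0.
have mV := @measurable_expNV R alpha n.
have mG := @measurable_gauss R t tp n.
have G0 := @gauss_ge0 R t n.
have mH := @measurable_ghat R alpha n alpha0 n0.
have H0 x : 0 <= ghat x by exact: expR_ge0.
have E0 x : 0 <= expR (- V x) by exact: expR_ge0.
have mb := @measurable_boxb R n N.
set S := lyap_bound alpha n (1 + n%:R * N ^+ 2).
have S0 : 0 <= S.
  rewrite /S /lyap_bound mulr_ge0 ?sqr_ge0//.
  by rewrite addr_ge0 ?divr_ge0 ?mulr_ge0 ?powR_ge0//; lra.
have W0 : 0 <= W by exact: expR_ge0.
have O0 : 0 <= O by exact: le_trans (fO 0 0).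
set I := (\int[lebesgue_rV n]_x ((\sum_i D i x ^+ 2) * expR (- V x))%:E)%E.
have I0 : (0 <= I)%E by apply: integralr_ge0 => x; rewrite mulr_ge0.
set Zp := (\int[lebesgue_rV n]_x (expR (- V x))%:E)%E.
have Zp0 : (0 <= Zp)%E by exact: integralr_ge0.
have T0 : 0 <= O ^+ 2 * tail_cst N by rewrite mulr_ge0 ?sqr_ge0// mulr_ge0// expR_ge0.
set Q := ((4 * S)%:E * I + (O ^+ 2 * tail_cst N)%:E * Zp)%E.
have Q0 : (0 <= Q)%E by rewrite adde_ge0// mule_ge0// lee_fin// mulr_ge0.
have mfy y : measurable_fun setT (fun x => (f x - f y) ^+ 2).
  by apply: measurable_funX; exact: measurable_funB.
(* Inside the cube by [box_lyapunov] applied to f - f y, outside by the oscillation and the tail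
   bound. *)
have fixed y : (v <= (24 * W)%:E * \int[lebesgue_rV n]_x ((f x - f y) ^+ 2 * ghat x)%:E + Q)%E.
  apply: le_trans (Hv y) _.
  have mnb : measurable_fun setT (fun x : 'rV[R]_n => (~~ boxb N x)%:R : R).
    rewrite (_ : (fun x => _) = (fun x => 1 - (boxb N x)%:R)); last first.
      by apply/funext => x; case: (boxb N x); rewrite /= ?subrr ?subr0.
    exact: measurable_funB.
  have -> : (\int[lebesgue_rV n]_x ((f x - f y) ^+ 2 * expR (- V x))%:E =
     \int[lebesgue_rV n]_x ((f x - f y) ^+ 2 * expR (- V x) * (boxb N x)%:R)%:E +
     \int[lebesgue_rV n]_x ((f x - f y) ^+ 2 * expR (- V x) * (~~ boxb N x)%:R)%:E)%E.
    rewrite -ge0_integralDr.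
    - by apply: eq_integral => x _; case: (boxb N x); rewrite /= mulr1 mulr0 ?addr0 ?add0r.
    - by apply: measurable_funM => //; exact: measurable_funM.
    - by apply: measurable_funM => //; exact: measurable_funM.
    - by move=> x; rewrite mulr_ge0// mulr_ge0// sqr_ge0.
    - by move=> x; rewrite mulr_ge0// mulr_ge0// sqr_ge0.
  rewrite /Q [leRHS](addeA ((24 * W)%:E * _)%E); apply: leeD.
    have cg : continuous (fun x => f x - f y).
      by apply: fun_continuousD => //; exact: cst_continuous.
    have dg i : is_partial i (fun x => f x - f y) (D i).
      move=> x; have dfx := df i x.
      rewrite (_ : (fun s => _) = (fun s => f (x + s *: delta_mx ord0 i)) - cst (f y))//.
      by apply: is_derive_eq; rewrite subr0.
    apply: le_trans (box_lyapunov alpha0 alpha1 n0 N0 mN cg cD dg) _.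
    rewrite -/S.
    have mg2 : measurable_fun setT (fun x => (f x - f y) ^+ 2 * ghat x) by exact: measurable_funM.
    have g20 x : 0 <= (f x - f y) ^+ 2 * ghat x by rewrite mulr_ge0// sqr_ge0.
    have mDE : measurable_fun setT (fun x => (\sum_i D i x ^+ 2) * expR (- V x)) by exact: measurable_funM.
    have DE0 x : 0 <= (\sum_i D i x ^+ 2) * expR (- V x) by rewrite mulr_ge0.
    have W24 : 0 <= 24 * W by rewrite mulr_ge0.
    have S4 : 0 <= 4 * S by rewrite mulr_ge0.
    rewrite /I -!ge0_integralZlr// -ge0_integralDr.
    - apply: ge0_le_integralr.
      + apply: measurable_funM => //; apply: measurable_funD; exact: measurable_funM.
      + by apply: measurable_funD; exact: measurable_funM.
      + by move=> x; rewrite mulr_ge0// addr_ge0// mulr_ge0.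
      + move=> x; apply: ler_piMr; last by rewrite lern1 leq_b1.
        by rewrite addr_ge0// mulr_ge0.
    - exact: measurable_funM.
    - exact: measurable_funM.
    - by move=> x; rewrite mulr_ge0.
    - by move=> x; rewrite mulr_ge0.
  have mEb : measurable_fun setT (fun x => expR (- V x) * (~~ boxb N x)%:R) by exact: measurable_funM.
  have Eb0 x : 0 <= expR (- V x) * (~~ boxb N x)%:R by rewrite mulr_ge0.
  apply: (@le_trans _ _ ((O ^+ 2)%:E * \int[lebesgue_rV n]_x (expR (- V x) * (~~ boxb N x)%:R)%:E)%E).
    rewrite -ge0_integralZlr ?sqr_ge0//; apply: ge0_le_integralr.
    + by apply: measurable_funM => //; exact: measurable_funM.
    + exact: measurable_funM.
    + by move=> x; rewrite -mulrA mulr_ge0// sqr_ge0.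
    + move=> x; rewrite -mulrA ler_wpM2r// -real_normK ?num_real//.
      by rewrite ler_pXn2r ?nnegrE.
  rewrite (EFinM (O ^+ 2) (tail_cst N)) -[leRHS]muleA; apply: lee_wpmul2l; first by rewrite lee_fin sqr_ge0.
  exact: tail_outside_box.
have /andP[Zn0 Znoo] := integral_gauss_bounds.
set Zn := (\int[lebesgue_rV n]_x (gauss t x)%:E)%E in Zn0 Znoo.
have Znfin : Zn \is a fin_num by rewrite ge0_fin_numE// ltW.
pose k := ghat_cst alpha n.
have k0 : 0 <= k by exact: expR_ge0.
pose J y := (\int[lebesgue_rV n]_x ((f y - f x) ^+ 2 * (gauss t y * gauss t x))%:E)%E.
have J0 y : (0 <= J y)%E.
  by apply: integralr_ge0 => x; apply: mulr_ge0; [exact: sqr_ge0|exact: mulr_ge0].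
have mJ : measurable_fun setT J.
  have mp : measurable_fun setT (fun p : 'rV[R]_n * 'rV[R]_n =>
      ((f p.1 - f p.2) ^+ 2 * (gauss t p.1 * gauss t p.2))%:E).
    apply/measurable_EFinP; apply: measurable_funM.
      apply: measurable_funX; apply: measurable_funB.
        exact: (measurableT_comp mf measurable_fst).
      exact: (measurableT_comp mf measurable_snd).
    apply: measurable_funM.
      exact: (measurableT_comp mG measurable_fst).
    exact: (measurableT_comp mG measurable_snd).
  apply: (@measurable_fun_fubini_tonelli_F _ _ _ _ R (lebesgue_rV n) _ mp) => p.
  by rewrite lee_fin; apply: mulr_ge0; [exact: sqr_ge0|exact: mulr_ge0].
have W24k : 0 <= 24 * W * k by rewrite mulr_ge0// mulr_ge0.
(* Average over [y] against the unnormalized Gaussian: both [v] and [Q] pick up its mass [Zn], and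
   [ghat] becomes [k] times a second Gaussian factor. *)
have step1 : (Zn * v <= (24 * W * k)%:E * \int[lebesgue_rV n]_y J y + Zn * Q)%E.
  rewrite /Zn -ge0_integralZr//; last 2 first.
  - exact/measurable_EFinP.
  - by move=> x _; rewrite lee_fin.
  rewrite -ge0_integralZr//; last 2 first.
  - exact/measurable_EFinP.
  - by move=> x _; rewrite lee_fin.
  rewrite -ge0_integralZl// -ge0_integralD//; last 4 first.
  - by move=> y _; rewrite mule_ge0// lee_fin.
  - exact: emeasurable_funM.
  - by move=> y _; rewrite mule_ge0// lee_fin.
  - by apply: emeasurable_funM => //; exact/measurable_EFinP.
  apply: ge0_le_integral => //.
  - by move=> y _; rewrite mule_ge0// lee_fin.
  - by apply: emeasurable_funM => //; exact/measurable_EFinP.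
  - apply: emeasurable_funD; first exact: emeasurable_funM.
    by apply: emeasurable_funM => //; exact/measurable_EFinP.
  move=> y _; apply: le_trans (lee_wpmul2l _ (fixed y)) _; first by rewrite lee_fin.
  rewrite ge0_muleDr//; last first.
    rewrite mule_ge0 ?lee_fin ?mulr_ge0//.
    by apply: integralr_ge0 => x; rewrite mulr_ge0// sqr_ge0.
  apply: leeD => //.
  rewrite muleA -EFinM -ge0_integralZlr//; last 3 first.
  - exact: measurable_funM.
  - by move=> x; rewrite mulr_ge0// sqr_ge0.
  - by rewrite mulr_ge0// mulr_ge0.
  rewrite -ge0_integralZlr//; last 2 first.
  - apply: measurable_funM; last exact: measurable_funM.
    by apply: measurable_funX; exact: measurable_funB.
  - by move=> x; apply: mulr_ge0; [exact: sqr_ge0|exact: mulr_ge0].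
  rewrite le_eqVlt; apply/orP; left; apply/eqP; apply: eq_integral => x _.
  by rewrite ghatE// -/k; congr EFin; ring.
have K0 : 0 <= 24 * W * (n.+1%:R * (128 * t ^+ 2)).
  by apply: mulr_ge0; [exact: mulr_ge0|apply: mulr_ge0 => //; apply: mulr_ge0 => //; exact: sqr_ge0].
(* [pair_gauss] also produces the factor [Zn], and [k] turns the remaining Gaussian back into
   [ghat], which is at most [exp (- V)]. *)
have step2 : ((24 * W * k)%:E * \int[lebesgue_rV n]_y J y <=
    Zn * ((24 * W * (n.+1%:R * (128 * t ^+ 2)))%:E * I))%E.
  apply: le_trans (lee_wpmul2l _ (pair_gauss tp cf cD df)) _; first by rewrite lee_fin.
  rewrite -integral_gauss// -/Zn.
  have kI : (k%:E * \int[lebesgue_rV n]_x ((\sum_i D i x ^+ 2) * gauss t x)%:E <= I)%E.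
    rewrite -ge0_integralZlr//; last 2 first.
    - exact: measurable_funM.
    - by move=> x; rewrite mulr_ge0.
    apply: ge0_le_integralr.
    - by apply: measurable_funM => //; exact: measurable_funM.
    - exact: measurable_funM.
    - by move=> x; rewrite mulr_ge0// mulr_ge0.
    - move=> x; rewrite mulrCA ler_wpM2l// -ghatE//.
      by apply: (le_trans (ghat_le alpha0 alpha1 n0 x)); rewrite -V_alphaE.
  set I' := (\int[lebesgue_rV n]_x ((\sum_i D i x ^+ 2) * gauss t x)%:E)%E in kI *.
  have -> : ((24 * W * k)%:E * ((n.+1%:R * (128 * t ^+ 2))%:E * (Zn * I')) =
     Zn * ((24 * W * (n.+1%:R * (128 * t ^+ 2)))%:E * (k%:E * I')))%E.
    rewrite (muleCA _ Zn) (muleCA _ Zn); congr (_ * _)%E.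
    by rewrite !muleA -!EFinM; congr (_%:E * _)%E; ring.
  apply: lee_wpmul2l; first exact: ltW.
  by apply: lee_wpmul2l => //; rewrite lee_fin.
have : (Zn * v <= Zn * ((24 * W * (n.+1%:R * (128 * t ^+ 2)))%:E * I + Q))%E.
  rewrite ge0_muleDr//; first by apply: (le_trans step1); exact: leeD.
  by rewrite mule_ge0// lee_fin.
rewrite lee_pmul2l// => /le_trans; apply.
rewrite /Q addeA -ge0_muleDl ?lee_fin//.
exact: mulr_ge0.
Qed.

End combination.

(** * The rate function and the oscillation *)
Section rate.
Context {R : realType}.
Variables (alpha : R).
Hypotheses (alpha0 : 0 < alpha) (alpha1 : alpha < 1).

Definition log_part (r : R) : R := Num.max (ln r^-1) 0.

Lemma log_part_ge0 r : 0 <= log_part r.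
Proof. by rewrite le_max lexx orbT. Qed.

Lemma log_part_noninc r s : 0 < r -> r <= s -> log_part s <= log_part r.
Proof.
move=> r0 rs; have s0 : 0 < s by exact: lt_le_trans rs.
rewrite ge_max !le_max lexx orbT andbT ler_ln ?posrE ?invr_gt0//.
by rewrite lef_pV2 ?posrE// rs.
Qed.

(** With th = 2 (1 - alpha) the exponents on the right are 2 + 2 th / gamma and gamma / alpha + th /
    alpha. A single one of the two terms is enough in each case; for L <= d it is the first, because
    gamma <= 2 alpha. *)
Lemma rate_lower_bound (d L gamma : R) : 1 <= d -> 0 <= L -> 0 < gamma <= 2 * alpha ->
  d `^ 2 * (Num.max d L) `^ (2 * (1 - alpha) / alpha) <=
  d `^ (2 * (2 - 2 * alpha + gamma) / gamma) + L `^ ((2 - 2 * alpha + gamma) / alpha).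
Proof.
move=> d1 L0 /andP[g0 g2].
have a0 := alpha0; have a1 := alpha1.
have dp : 0 < d by lra.
set th := 2 * (1 - alpha).
have th0 : 0 <= th by rewrite /th; lra.
have -> : 2 * (2 - 2 * alpha + gamma) / gamma = 2 + 2 * th / gamma.
  by rewrite /th; field; rewrite gt_eqF.
have -> : (2 - 2 * alpha + gamma) / alpha = gamma / alpha + th / alpha.
  by rewrite /th; field; rewrite gt_eqF.
have dD (x y : R) : d `^ (x + y) = d `^ x * d `^ y by rewrite powRD// (gt_eqF dp) implybT.
have [Ld|dL] := leP L d.
  rewrite -(dD 2); apply: (@le_trans _ _ (d `^ (2 + 2 * th / gamma))); last first.
    by rewrite lerDl powR_ge0.
  apply: ler_powR => //; rewrite lerD2l ler_pdivrMr// mulrAC ler_pdivlMr//.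
  nra.
have Lp : 0 < L by lra.
have LD (x y : R) : L `^ (x + y) = L `^ x * L `^ y by rewrite powRD// (gt_eqF Lp) implybT.
(* The terms cross where L^(1/alpha) = d^(2/gamma). Below, raise to the power th to replace
   L^(th/alpha); above, raise to the power gamma to replace d^2. *)
have [h|h] := leP (L `^ alpha^-1) (d `^ (2 / gamma)).
  apply: (@le_trans _ _ (d `^ (2 + 2 * th / gamma))); last first.
    by rewrite lerDl powR_ge0.
  rewrite (dD 2 (2 * th / gamma)) ler_pM2l ?powR_gt0//.
  have -> : th / alpha = alpha^-1 * th by ring.
  have -> : 2 * th / gamma = 2 / gamma * th by ring.
  by rewrite (powRrM L) (powRrM d (2 / gamma)); apply: ge0_ler_powR; rewrite ?nnegrE ?powR_ge0.
apply: (@le_trans _ _ (L `^ (gamma / alpha + th / alpha))); last first.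
  by rewrite lerDr powR_ge0.
rewrite (LD (gamma / alpha)) ler_pM2r ?powR_gt0//.
have -> : gamma / alpha = alpha^-1 * gamma by ring.
rewrite -[X in d `^ X](@divfK _ gamma) ?gt_eqF//.
by rewrite (powRrM L) (powRrM d (2 / gamma)); apply: ge0_ler_powR; rewrite ?nnegrE ?powR_ge0// ltW.
Qed.

Section beta.
Variables (C : R) (d : nat).
Hypotheses (C0 : 0 <= C) (d0 : (0 < d)%N).

Let val (r gamma : R) := C * (d%:R `^ (2 * (2 - 2 * alpha + gamma) / gamma)
  + log_part r `^ ((2 - 2 * alpha + gamma) / alpha)).

Let beta_set r := [set val r gamma | gamma in [set gamma : R | 0 < gamma <= 2 * alpha]].

Let beta_set_n0 r : beta_set r !=set0.
Proof.
exists (val r (2 * alpha)); exists (2 * alpha) => //=.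
by rewrite lexx andbT mulr_gt0.
Qed.

Let val_ge0 r gamma : 0 <= val r gamma.
Proof. by rewrite mulr_ge0// addr_ge0// powR_ge0. Qed.

Lemma beta_WPI_ge (b r : R) :
  (forall gamma, 0 < gamma <= 2 * alpha -> b <= val r gamma) -> b <= beta_WPI alpha C d r.
Proof.
by move=> H; apply: lb_le_inf => [|_ [gamma /= ? <-]]; [exact: beta_set_n0|exact: H].
Qed.

Lemma beta_WPI_le (r gamma : R) : 0 < gamma <= 2 * alpha -> beta_WPI alpha C d r <= val r gamma.
Proof.
move=> gb; apply: ge_inf; last by exists gamma.
by exists 0 => _ [g _ <-]; exact: val_ge0.
Qed.

Lemma beta_WPI_ge0 r : 0 <= beta_WPI alpha C d r.
Proof. by apply: beta_WPI_ge => gamma _. Qed.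

Lemma beta_WPI_noninc r s : 0 < r -> r <= s -> beta_WPI alpha C d s <= beta_WPI alpha C d r.
Proof.
move=> r0 rs; apply: beta_WPI_ge => gamma gb; apply: le_trans (beta_WPI_le s gb) _.
have a0 := alpha0; have a1 := alpha1; case/andP: gb => g0 _.
apply: ler_wpM2l => //; rewrite lerD2l.
apply: ge0_ler_powR; rewrite ?nnegrE ?log_part_ge0//; last exact: log_part_noninc.
by rewrite divr_ge0//; lra.
Qed.

Lemma beta_WPI_lower r :
  C * (d%:R `^ 2 * (Num.max d%:R (log_part r)) `^ (2 * (1 - alpha) / alpha)) <= beta_WPI alpha C d r.
Proof.
apply: beta_WPI_ge => gamma gb; apply: ler_wpM2l => //.
apply: rate_lower_bound => //; last exact: log_part_ge0.
by rewrite -[leLHS]/(1%:R) ler_nat.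
Qed.

End beta.
End rate.

Section oscillation.
Context {R : realType} {T : Type}.
Implicit Type f : T -> R.
Local Open Scope ereal_scope.

Definition supf f : \bar R := ereal_sup (range (EFin \o f)).

Lemma supf_ge f x : (f x)%:E <= supf f.
Proof. by apply: ereal_sup_ubound; exists x. Qed.

Lemma ereal_inf_supN f : ereal_inf (range (EFin \o f)) = - supf (fun x => - f x)%R.
Proof.
rewrite /ereal_inf /supf; congr (- ereal_sup _).
apply/seteqP; split => [_ [_ [x _ <-] <-]|_ [x _ <-]]; first by exists x.
by exists (f x)%:E => //; exists x.
Qed.

Lemma supf_affine_le f (c a : R) : (0 <= c)%R ->
  supf (fun x => c * f x + a)%R <= c%:E * supf f + a%:E.
Proof.
move=> c0; apply: ge_ereal_sup => _ [x _ <-] /=.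
by rewrite EFinD leeD2r// EFinM lee_wpmul2l ?lee_fin ?supf_ge.
Qed.

(** The reverse bound is [supf_affine_le] for the inverse affine map. *)
Lemma supf_affine f (c a : R) : (0 < c)%R ->
  supf (fun x => c * f x + a)%R = c%:E * supf f + a%:E.
Proof.
move=> c0; apply/eqP; rewrite eq_le (supf_affine_le f a (ltW c0)) /=.
rewrite -leeBrDr// -(@lee_pmul2l _ (c^-1)%:E) ?lte_fin ?invr_gt0//.
rewrite muleA -EFinM mulVf ?gt_eqF// mul1e.
have := @supf_affine_le (fun x => c * f x + a)%R c^-1 (- (c^-1 * a)).
rewrite invr_ge0 => /(_ (ltW c0)).
have -> : (fun x => c^-1 * (c * f x + a) - c^-1 * a)%R = f.
  by apply/funext => x; rewrite mulrDr addrK mulKf// gt_eqF.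
by move/le_trans; apply; rewrite [leRHS]muleBr// fin_num_adde_defl.
Qed.

End oscillation.

Section Osc_properties.
Context {R : realType} {d : nat}.
Implicit Type f : 'rV[R]_d -> R.
Local Open Scope ereal_scope.

Lemma OscE f : Osc f = supf f + supf (fun x => - f x)%R.
Proof. by rewrite /Osc ereal_inf_supN oppeK. Qed.

Lemma supf_gtNy f : -oo < supf f.
Proof. exact: lt_le_trans (ltNyr _) (supf_ge f 0%R). Qed.

Lemma Osc_diff f x y : (f x - f y)%:E <= Osc f.
Proof.
rewrite OscE EFinB; apply: leeD; first exact: supf_ge.
exact: (supf_ge (fun x => - f x)%R).
Qed.

Lemma Osc_ge0 f : 0 <= Osc f.
Proof. by have := Osc_diff f 0%R 0%R; rewrite subrr. Qed.

Lemma Osc_affine_pos f (c a : R) : (0 < c)%R -> Osc (fun x => c * f x + a)%R = c%:E * Osc f.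
Proof.
move=> c0; rewrite !OscE.
have -> : (fun x => - (c * f x + a))%R = (fun x => c * (- f x) + (- a))%R.
  by apply/funext => x; rewrite opprD mulrN.
rewrite !supf_affine// addeACA -EFinD subrr adde0 muleDr//.
by rewrite /adde_def (gt_eqF (supf_gtNy f)) (gt_eqF (supf_gtNy (fun x => - f x)%R)) andbF.
Qed.

Lemma Osc_opp f : Osc (fun x => - f x)%R = Osc f.
Proof.
rewrite !OscE addeC; congr (_ + _); congr supf.
by apply/funext => x; rewrite opprK.
Qed.

Lemma Osc_affine f (c a : R) : Osc (fun x => c * f x + a)%R = `|c|%:E * Osc f.
Proof.
have [c0|c0|->] := ltgtP c 0%R.
- rewrite ltr0_norm// -(Osc_opp f) -(@Osc_affine_pos _ _ a) ?oppr_gt0//.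
  by congr Osc; apply/funext => x; rewrite mulrNN.
- by rewrite gtr0_norm// Osc_affine_pos.
(* A constant function. The convention 0 * +oo = 0 gives the right value even if [f] is
   unbounded. *)
- rewrite normr0 mul0e; apply/eqP; rewrite eq_le Osc_ge0 andbT OscE.
  rewrite -[leRHS](subee (isT : a%:E \is a fin_num)) -EFinN; apply: leeD; apply: ge_ereal_sup => _ [x _ <-] /=.
  + by rewrite mul0r add0r.
  + by rewrite mul0r add0r.
Qed.

Lemma Osc_sqr_affine f (c a : R) :
  Osc (fun x => c * f x + a)%R ^+ 2 = (c ^+ 2)%:E * Osc f ^+ 2.
Proof.
by rewrite Osc_affine !expe2 muleACA -EFinM -expr2 real_normK ?num_real.
Qed.

End Osc_properties.

(** * Integration against pi_alpha *)
Section density.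
Context d (T : measurableType d) (R : realType).
Variables (m nu : {measure set T -> \bar R}) (g : T -> R).
Hypotheses (mg : measurable_fun setT g) (g0 : forall x, 0 <= g x).
Hypothesis nuE : forall A, measurable A -> nu A = (\int[m]_(x in A) (g x)%:E)%E.
Import HBNNSimple.

Let integral_density_nnsfun (h : {nnsfun T >-> R}) :
  (\int[nu]_x (h x)%:E = \int[m]_x (h x * g x)%:E)%E.
Proof.
under [LHS]eq_integral do rewrite fimfunE -fsumEFin//.
rewrite [LHS]ge0_integral_fsum//; last 2 first.
  - by move=> r; exact/measurable_EFinP/measurableT_comp.
  - by move=> n x _; rewrite EFinM nnfun_muleindic_ge0.
under [RHS]eq_integral.
  move=> x xD; rewrite EFinM fimfunE -fsumEFin// ge0_mule_fsuml; last first.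
    by move=> r; rewrite EFinM nnfun_muleindic_ge0.
  over.
rewrite [RHS]ge0_integral_fsum//; last 2 first.
  - move=> r; apply: emeasurable_funM; last exact/measurable_EFinP.
    exact/measurable_EFinP/measurableT_comp.
  - by move=> n x _; apply: mule_ge0; [rewrite EFinM nnfun_muleindic_ge0|rewrite lee_fin].
apply: eq_fsbigr => r _.
rewrite integralZl_indic_nnsfun// integral_indic// setIT nuE//.
have [r0|r0] := ltP r 0.
  rewrite preimage_nnfun0// integral_set0 mule0.
  rewrite integral0_eq// => x _.
  by rewrite indicE in_set0 mulr0 mul0e.
rewrite integral_mkcond -ge0_integralZl//; last 2 first.
- have mA : measurable (h @^-1` [set r]) by [].
  apply/(measurable_restrictT _ mA); apply: measurable_funTS; exact/measurable_EFinP.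
- by move=> x _; rewrite patchE; case: ifP => //; rewrite lee_fin.
apply: eq_integral => x _; rewrite patchE indicE.
by case: ifP => _; rewrite ?mulr1 ?mulr0 ?mule0 ?mul0e.
Qed.

(** Integration against a measure with density [g]: true on simple functions by linearity, then
    extended by monotone convergence on both sides. *)
Lemma integral_density (F : T -> R) : measurable_fun setT F -> (forall x, 0 <= F x) ->
  (\int[nu]_x (F x)%:E = \int[m]_x (F x * g x)%:E)%E.
Proof.
move=> mF F0.
have mFE : measurable_fun setT (EFin \o F) by exact/measurable_EFinP.
pose f_ := nnsfun_approx measurableT mFE.
transitivity (lim (\int[nu]_x (f_ n x)%:E @[n --> \oo])%E).
  rewrite -monotone_convergence//=.
  - apply: eq_integral => x /[!inE] xD; apply/esym/cvg_lim => //=.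
    by apply: (cvg_nnsfun_approx measurableT mFE) => // y _; rewrite lee_fin.
  - by move=> n; exact/measurable_EFinP/measurable_funTS.
  - by move=> n ? _; rewrite lee_fin.
  - by move=> ? _ ? ? mn; rewrite lee_fin; exact/lefP/nd_nnsfun_approx.
rewrite [RHS](_ : _ = lim (\int[m]_x (f_ n x * g x)%:E @[n --> \oo])%E); last first.
  rewrite -monotone_convergence//=.
  - apply: eq_integral => x /[!inE] xD; apply/esym/cvg_lim => //.
    under eq_fun do rewrite EFinM.
    rewrite EFinM; apply: cvgeZr => //.
    by apply: (cvg_nnsfun_approx measurableT mFE) => // y _; rewrite lee_fin.
  - by move=> n; apply/measurable_EFinP; exact: measurable_funM.
  - by move=> n ? _; rewrite lee_fin mulr_ge0.
  - move=> x _ a b ab; rewrite lee_fin ler_wpM2r//.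
    exact/lefP/nd_nnsfun_approx.
by apply: congr_lim; apply/funext => n /=; exact: integral_density_nnsfun.
Qed.

End density.

Section variance_bound.
Context d (T : measurableType d) (R : realType) (P : probability T R).
Local Open Scope ereal_scope.

Lemma bounded_Lfun2 (f : T -> R) (M : R) : measurable_fun setT f ->
  (forall x, `|f x| <= M)%R -> f \in Lfun P 2%:E.
Proof.
move=> mf fM; rewrite inE/=; apply/andP; split; rewrite inE//=.
rewrite /finite_norm unlock poweR_lty//.
apply: (@le_lt_trans _ _ (\int[P]_x (M `^ 2)%:E)).
  apply: ge0_le_integralr => //.
  - apply: (measurableT_comp (measurable_powR _)); exact: measurableT_comp.
  - move=> x; apply: ge0_ler_powR; rewrite ?nnegrE//.
    exact: le_trans (fM x).
by rewrite integral_cst//= ?probability_setT ?mule1 ltry.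
Qed.

(** The variance is unchanged by subtracting [c], and it is the second moment minus the square of
    the mean. Boundedness keeps these terms finite, as the subtraction requires. *)
Lemma variance_le_centered (f : T -> R) (M c : R) : measurable_fun setT f ->
  (forall x, `|f x| <= M)%R -> 'V_P[f] <= \int[P]_x ((f x - c) ^+ 2)%:E.
Proof.
move=> mf fM; have f2 := bounded_Lfun2 mf fM.
have g2 : (f \- cst c)%R \in Lfun P 2%:E.
  apply: (@bounded_Lfun2 _ (M + `|c|)); first exact: measurable_funB.
  by move=> x; rewrite (le_trans (ler_normB _ _))// lerD2r.
have g1 : (f \- cst c)%R \in Lfun P 1.
  by move: g2; apply: Lfun_subset12; rewrite fin_num_measure.
rewrite -(varianceB_cst_r c f2) varianceE//.
rewrite leeBlDr ?fin_numX ?expectation_fin_num//.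
have -> : 'E_P[(f \- cst c) ^+ 2] = \int[P]_x ((f x - c) ^+ 2)%:E by rewrite unlock.
rewrite leeDl//.
exact: sqre_ge0.
Qed.

End variance_bound.

(** * Choice of the cube and of the constant *)

Section constants.
Context {R : realType}.
Variables (alpha : R).
Hypotheses (alpha0 : 0 < alpha) (alpha1 : alpha < 1).

Local Notation s := (2 / alpha).
Local Notation e := (2 * (1 - alpha) / alpha).

Definition wpi_scale : R := 5 + 4 / alpha.

(** The first summand pays for the Gaussian step, where 256 = 2 * 128 comes from (n + 1) / n <= 2;
    the second pays for |X|^2 on the cube. *)
Definition wpi_const : R :=
  24 * window_cst alpha * (256 * alpha^-1 `^ s) + 4 * s ^+ 2 * (s `^ s + 8 * wpi_scale `^ e).

Lemma wpi_const_gt0 : 0 < wpi_const.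
Proof.
rewrite /wpi_const; apply: ltr_pwDl.
  have v0 : 0 < alpha^-1 `^ s by rewrite powR_gt0 ?invr_gt0.
  have W0 : 0 < window_cst alpha by exact: expR_gt0.
  by rewrite !pmulr_rgt0.
apply: mulr_ge0; first by apply: mulr_ge0 => //; exact: sqr_ge0.
by apply: addr_ge0; [exact: powR_ge0|apply: mulr_ge0 => //; exact: powR_ge0].
Qed.

Section dimension.
Variables (n : nat) (L : R).
Hypotheses (n0 : (0 < n)%N) (L0 : 0 <= L).

Local Notation m0 := (n%:R / alpha).
Local Notation X := (Num.max n%:R L).

(** Chosen so that (1 + 4 m0) / 2 - level / 2 = - 1 - L. The tail constant is then at most 2 exp (-
    1 - L) <= exp (- L), hence at most r. *)
Definition wpi_level : R := 2 * L + 4 * m0 + 3.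
Definition wpi_radius : R := wpi_level `^ alpha^-1.

Lemma wpi_level_bounds : 1 <= wpi_level /\ m0 <= wpi_level.
Proof.
have [a0 a1 s2 m01 mm0] := params_bounds alpha0 alpha1 n0.
by have Lp := L0; rewrite /wpi_level; split; lra.
Qed.

Lemma wpi_level_le : wpi_level <= wpi_scale * X.
Proof.
have a0 := alpha0; have Lp := L0.
have n1 : 1 <= n%:R :> R by rewrite -[leLHS]/(1%:R) ler_nat.
have nX : n%:R <= X by rewrite le_max lexx.
have LX : L <= X by rewrite le_max lexx orbT.
have h : m0 <= X / alpha by rewrite ler_pM2r ?invr_gt0.
have -> : wpi_scale * X = 5 * X + 4 * (X / alpha) by rewrite /wpi_scale; ring.
rewrite /wpi_level; lra.
Qed.

Lemma wpi_radius_gt0 : 0 < wpi_radius.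
Proof. by have [l1 _] := wpi_level_bounds; rewrite powR_gt0//; lra. Qed.

Lemma sqr_wpi_radius : wpi_radius ^+ 2 = wpi_level `^ s.
Proof.
by rewrite -powR_mulrn ?powR_ge0// -powRrM mulrC.
Qed.

Lemma potential_wpi_radius : wpi_level <= potential alpha (1 + wpi_radius ^+ 2).
Proof.
have a0 := alpha0; have [l1 _] := wpi_level_bounds.
have lp : 0 <= wpi_level by lra.
rewrite -[leLHS](potential_powR alpha0 lp).
rewrite /potential -powRrM (mulrC (alpha / 2)) (powRrM wpi_level s) -sqr_wpi_radius.
apply: ge0_ler_powR; rewrite ?nnegrE ?sqr_ge0 ?addr_ge0 ?sqr_ge0//.
  by rewrite divr_ge0// ltW.
by rewrite lerDr.
Qed.

Lemma tail_cst_le (r : R) : 0 < r -> log_part r <= L -> tail_cst alpha n wpi_radius <= r.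
Proof.
move=> r0 rL; rewrite /tail_cst.
have lr : - ln r <= L.
  by apply: le_trans rL; rewrite /log_part le_max lnV ?posrE// lexx.
have E1 : 2 <= expR 1 :> R by have := expR_ge1Dx (1 : R); lra.
apply: (@le_trans _ _ (expR 1 * expR (- 1 - L))).
  apply: ler_pM; [by []|exact: expR_ge0|by []|].
  rewrite ler_expR; have := potential_wpi_radius; rewrite /wpi_level; lra.
by rewrite -expRD -[leRHS](lnK (_ : r \is Num.pos)) ?posrE// ler_expR; lra.
Qed.

(** The Gaussian part is of order n t^2 = u0, hence n^(2/alpha), and 2 / alpha = 2 + e. On the cube
    |x|^2 <= n [wpi_level]^(2/alpha); its power 1 - alpha gives n^(1 - alpha) [wpi_level]^e, and
    n^(1 - alpha) fits into n^2. *)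
Lemma gradient_cst_le :
  gradient_cst alpha n wpi_radius <= wpi_const * (n%:R `^ 2 * X `^ e).
Proof.
have [a0 a1 s2 m01 mm0] := params_bounds alpha0 alpha1 n0.
have n1 : 1 <= n%:R :> R by rewrite -[leLHS]/(1%:R) ler_nat.
have np : 0 < n%:R :> R by lra.
have [l1 _] := wpi_level_bounds.
have X1 : 1 <= X by rewrite le_max n1.
have e0 : 0 <= e by rewrite divr_ge0//; lra.
have W0 : 0 < window_cst alpha by exact: expR_gt0.
have ns : n%:R `^ s <= n%:R `^ 2 * X `^ e.
  have -> : s = 2 + e by field; rewrite gt_eqF.
  rewrite powRD ?(gt_eqF np) ?implybT// ler_pM2l ?powR_gt0//.
  by apply: ge0_ler_powR; rewrite ?nnegrE ?le_max ?lexx//; lra.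
have T1 : n.+1%:R * (128 * gauss_scale alpha n ^+ 2) <= 256 * alpha^-1 `^ s * n%:R `^ s.
  rewrite gauss_scale_sqr// powRM ?invr_ge0 ?(ltW a0)//.
  rewrite -natr1.
  have -> : (n%:R + 1) * (128 * (n%:R `^ s * alpha^-1 `^ s / n%:R)) =
    ((n%:R + 1) / n%:R) * (128 * (alpha^-1 `^ s * n%:R `^ s)) by ring.
  have -> : 256 * alpha^-1 `^ s * n%:R `^ s = 2 * (128 * (alpha^-1 `^ s * n%:R `^ s)) by ring.
  apply: ler_wpM2r; first by rewrite !mulr_ge0 ?powR_ge0.
  by rewrite ler_pdivrMr//; lra.
have T2 : (2 * m0) `^ s / (4 * m0) <= s `^ s * n%:R `^ s.
  have -> : 2 * m0 = s * n%:R by ring.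
  rewrite powRM ?(ltW np)//; last by lra.
  rewrite ler_pdivrMr; last by lra.
  apply: ler_peMr; first by rewrite mulr_ge0 ?powR_ge0.
  by lra.
have T3 : (1 + n%:R * wpi_radius ^+ 2) `^ (1 - alpha) <= 2 * wpi_scale `^ e * (n%:R `^ 2 * X `^ e).
  have lS : 1 <= wpi_level `^ s by rewrite -[leLHS](powRr0 wpi_level); apply: ler_powR => //; lra.
  apply: (@le_trans _ _ ((2 * n%:R * wpi_level `^ s) `^ (1 - alpha))).
    apply: ge0_ler_powR.
    - lra.
    - by rewrite nnegrE; apply: addr_ge0 => //; apply: mulr_ge0 => //; exact: sqr_ge0.
    - by rewrite nnegrE; apply: mulr_ge0; [exact: mulr_ge0|exact: powR_ge0].
    rewrite sqr_wpi_radius.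
    have : 1 <= n%:R * wpi_level `^ s by rewrite -[leLHS]mulr1 ler_pM.
    lra.
  rewrite powRM ?mulr_ge0 ?powR_ge0// -powRrM.
  have -> : s * (1 - alpha) = e by ring.
  have h1 : (2 * n%:R) `^ (1 - alpha) <= 2 * n%:R `^ 2.
    apply: (@le_trans _ _ ((2 * n%:R) `^ 1)); first by apply: ler_powR; lra.
    rewrite powRr1; last by lra.
    rewrite ler_pM2l// -[leLHS]powRr1 ?(ltW np)//; apply: ler_powR => //; lra.
  have h2 : wpi_level `^ e <= wpi_scale `^ e * X `^ e.
    rewrite -powRM; [|by rewrite /wpi_scale addr_ge0// divr_ge0// ltW|by lra].
    apply: ge0_ler_powR; rewrite ?nnegrE; [by []|by lra| |exact: wpi_level_le].
    by rewrite mulr_ge0; [by []|rewrite /wpi_scale addr_ge0// divr_ge0// ltW|by lra].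
  have -> : 2 * wpi_scale `^ e * (n%:R `^ 2 * X `^ e) = (2 * n%:R `^ 2) * (wpi_scale `^ e * X `^ e) by ring.
  by apply: ler_pM => //; exact: powR_ge0.
rewrite /gradient_cst /lyap_bound /wpi_const [leRHS]mulrDl; apply: lerD.
  rewrite -[leRHS]mulrA; apply: ler_wpM2l; first by rewrite mulr_ge0// ltW.
  apply: (le_trans T1); apply: ler_wpM2l ns.
  by rewrite pmulr_rge0 ?powR_ge0.
rewrite [leLHS]mulrA -[leRHS]mulrA; apply: ler_wpM2l.
  by apply: mulr_ge0 => //; exact: sqr_ge0.
rewrite [leRHS]mulrDl; apply: lerD.
  by apply: (le_trans T2); apply: ler_wpM2l => //; exact: powR_ge0.
have -> : 8 * wpi_scale `^ e * (n%:R `^ 2 * X `^ e) = 4 * (2 * wpi_scale `^ e * (n%:R `^ 2 * X `^ e)) by ring.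
by rewrite ler_pM2l.
Qed.

End dimension.
End constants.

(** * Passage to the normalized measure *)

Section conclusion.
Context {R : realType}.
Variables (alpha : R) (d : nat).
Hypotheses (alpha0 : 0 < alpha) (alpha1 : alpha < 1) (d0 : (0 < d)%N).
Local Open Scope ereal_scope.

Lemma integral_pi_alpha (F : 'rV[R]_d -> R) : measurable_fun setT F -> (forall x, 0 <= F x)%R ->
  (fine (\int[lebesgue_rV d]_x (expR (- V_alpha alpha x))%:E))%:E * \int[pi_alpha d alpha]_x (F x)%:E =
  \int[lebesgue_rV d]_x (F x * expR (- V_alpha alpha x))%:E.
Proof.
move=> mF F0.
set Z := fine _.
have /andP[Z0 Zoo] := gibbs_weight_V_alphaT d alpha0.
have Zp : (0 < Z)%R by rewrite fine_gt0// Z0 Zoo.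
have mE := @measurable_expNV R alpha d.
rewrite (@integral_density _ _ R (lebesgue_rV d) (pi_alpha d alpha)
   (fun x => Z^-1 * expR (- V_alpha alpha x))%R)//.
- rewrite -ge0_integralZlr ?(ltW Zp)//.
  + by apply: eq_integral => x _; congr EFin; rewrite mulrCA mulVKf// gt_eqF.
  + by apply: measurable_funM => //; exact: measurable_funM.
  + by move=> x; rewrite mulr_ge0// mulr_ge0 ?expR_ge0// invr_ge0 ltW.
- exact: measurable_funM.
- by move=> x; rewrite mulr_ge0 ?expR_ge0// invr_ge0 ltW.
- move=> A mA; rewrite [LHS](@pi_alphaE R d alpha A alpha0) -/Z muleC -ge0_integralZl//.
  + exact: measurable_gibbs_density.
  + by rewrite lee_fin invr_ge0 ltW.
Qed.

Lemma weak_poincare_ineq (f : 'rV[R]_d -> R) (r : R) : smooth f -> (0 < r)%R ->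
  'V_(pi_alpha d alpha)[f] <= (beta_WPI alpha (wpi_const alpha) d r)%:E *
     'E_(pi_alpha d alpha)[(fun x => enorm (grad f x) ^+ 2)%R] + r%:E * Osc f ^+ 2.
Proof.
move=> sf r0.
set P := pi_alpha d alpha.
have beta0 := @beta_WPI_ge0 R alpha alpha0 (wpi_const alpha) d (ltW (wpi_const_gt0 alpha0)) r.
have EE : 'E_P[(fun x => enorm (grad f x) ^+ 2)%R] =
    \int[P]_x (\sum_i partial i f x ^+ 2)%:E.
  rewrite unlock; apply: eq_integral => x _; congr EFin; rewrite sqr_enorm.
  by apply: eq_bigr => i _; rewrite mxE.
have S0 (x : 'rV[R]_d) : (0 <= \sum_i partial i f x ^+ 2)%R.
  by apply: sumr_ge0 => i _; exact: sqr_ge0.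
have E0 : 0 <= \int[P]_x (\sum_i partial i f x ^+ 2)%:E by exact: integralr_ge0.
rewrite EE.
have O0 := Osc_ge0 f.
(* For infinite oscillation the right side is +oo, since r > 0 and the gradient term is
   nonnegative. *)
have [Ofin|] := boolP (Osc f \is a fin_num); last first.
  rewrite ge0_fin_numE// ltey negbK => /eqP ->.
  rewrite expe2 mulyy mulry gtr0_sg// mul1e addey ?leey//.
  by rewrite gt_eqF// (lt_le_trans (ltNyr 0))// mule_ge0// lee_fin.
pose O := fine (Osc f).
have OE : Osc f = O%:E by rewrite fineK.
have fO x y : (`|f x - f y| <= O)%R.
  by rewrite ler_norml -lerN2 opprK opprB -!lee_fin -OE !Osc_diff.
have cf : continuous f by case: (sf [::]).
have mf := measurable_continuous_rV cf.
have mD2 : measurable_fun setT (fun x => \sum_i partial i f x ^+ 2)%R.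
  apply: measurable_sum => i; apply: measurable_funX.
  by apply: measurable_continuous_rV; exact: continuous_partial.
pose L := log_part r.
have L0 := log_part_ge0 r.
pose N := wpi_radius alpha d L.
set Z := fine (\int[lebesgue_rV d]_x (expR (- V_alpha alpha x))%:E).
have /andP[Z0 Zoo] := gibbs_weight_V_alphaT d alpha0.
have Zp : (0 < Z)%R by rewrite fine_gt0// Z0 Zoo.
have ZE : \int[lebesgue_rV d]_x (expR (- V_alpha alpha x))%:E = Z%:E.
  by rewrite fineK// ge0_fin_numE// ltW.
have [l1 ml] := wpi_level_bounds alpha0 alpha1 d0 L0.
have := @wpi_lebesgue R alpha d alpha0 alpha1 d0 N O f (fun i => partial i f) (Z%:E * 'V_P[f]).
move=> /(_ (wpi_radius_gt0 alpha0 alpha1 d0 L0) (le_trans ml (potential_wpi_radius alpha0 alpha1 d0 L0)) cf).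
move=> /(_ (fun i => continuous_partial sf) (fun i => is_partial_smooth i sf) fO).
move=> /(_ _ _)/wrap[].
- by rewrite mule_ge0 ?variance_ge0// lee_fin ltW.
- move=> y; rewrite -integral_pi_alpha//; last 2 first.
  + by apply: measurable_funX; exact: measurable_funB.
  + by move=> x; exact: sqr_ge0.
  rewrite -/Z; apply: lee_wpmul2l; first by rewrite lee_fin ltW.
  (* A function of oscillation at most O is bounded by |f 0| + O. *)
  apply: (@variance_le_centered _ _ R P f (`|f 0| + O)%R) => // x.
  rewrite -[f x](subrK (f 0%R)) (le_trans (ler_normD _ _))// addrC lerD2l//.
have K0 : (0 <= gradient_cst alpha d N)%R.
  have [a0 a1 s2 m01 mm0] := params_bounds alpha0 alpha1 d0.
  apply: addr_ge0; apply: mulr_ge0.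
  - by apply: mulr_ge0 => //; exact: expR_ge0.
  - by apply: mulr_ge0 => //; apply: mulr_ge0 => //; exact: sqr_ge0.
  - by [].
  - apply: mulr_ge0; first exact: sqr_ge0.
    apply: addr_ge0; last by apply: mulr_ge0 => //; exact: powR_ge0.
    by apply: divr_ge0; [exact: powR_ge0|lra].
have T0 : (0 <= O ^+ 2 * tail_cst alpha d N)%R.
  by apply: mulr_ge0; [exact: sqr_ge0|apply: mulr_ge0 => //; exact: expR_ge0].
rewrite -integral_pi_alpha// -/Z ZE -/P muleCA (muleC (O ^+ 2 * _)%:E) -ge0_muleDr; last 2 first.
- by rewrite mule_ge0// lee_fin.
- by rewrite lee_fin.
rewrite lee_pmul2l ?lte_fin// => /le_trans; apply.
rewrite OE; apply: leeD.
  apply: lee_wpmul2r => //; rewrite lee_fin.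
  apply: (le_trans (gradient_cst_le alpha0 alpha1 d0 L0)).
  exact: (beta_WPI_lower alpha0 alpha1 (ltW (wpi_const_gt0 alpha0)) d0 r).
rewrite expe2 -!EFinM lee_fin mulrC -expr2; apply: ler_wpM2r; first exact: sqr_ge0.
exact: tail_cst_le.
Qed.

End conclusion.

Theorem proposition5 (R : realType) (alpha : R) (halpha : 0 < alpha < 1) :
  exists2 C : R, 0 < C &
    forall d : nat, (0 < d)%N ->
      weak_poincare (pi_alpha d alpha) (beta_WPI alpha C d)
        (fun f => Osc f ^+ 2)%E.
Proof.
case/andP: halpha => alpha0 alpha1; have C0 := wpi_const_gt0 alpha0.
exists (wpi_const alpha); first exact: C0.
move=> d d0; split.
- by move=> r _; exact: beta_WPI_ge0 (ltW C0) r.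
- by move=> r s; exact: beta_WPI_noninc (ltW C0) r s.
- by move=> f _; exact: sqre_ge0.
- by move=> a c f _; exact: Osc_sqr_affine.
- by move=> f sf r r0; exact: weak_poincare_ineq.
Qed.
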